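(* Let $H^2_{\beta}$ be a weighted Hardy space of polynomial growth. Let $\varphi:\overline{\mathbb{D}}\rightarrow\overline{\mathbb{D}}$ be a nontrivial (i.e. nonconstant) analytic map. Then the following are equivalent. (1) The composition operator $C_{\varphi}$ acting on $H^2_\beta$ is semi-Fredholm. (2) The composition operator $C_{\varphi}$ acting on $H^2_\beta$ has closed range. (3) $\mathbb{T}\subseteq\varphi(\overline{\mathbb{D}})$. (4) $\varphi(\mathbb{T})$ contains an arc in $\mathbb{T}$. (5) $\varphi$ is a finite Blaschke product.
   Context: $\mathbb{D}$ is the open unit disk, $\mathbb{T}$ the unit circle. ''Analytic on $\overline{\mathbb{D}}$'' means analytic on a neighborhood of the closed disk. An arc means a nondegenerate arc (not a single point). Let $w=\{w_k\}_{k\ge1}$ be a sequence of positive numbers with $w_k\to1$, and put $\beta_0=1$, $\beta_k=\prod_{j=1}^k w_j$. The weighted Hardy space $H^2_\beta$ is the Hilbert space of analytic functions $f(z)=\sum_{k\ge0}\widehat f(k)z^k$ on $\mathbb{D}$ with $\|f\|_{H^2_\beta}^2=\sum_{k\ge0}|\widehat f(k)|^2\beta_k^2<\infty$. It is of polynomial growth if $\sup_k (k+1)|w_k-1|<\infty$. $C_\varphi f=f\circ\varphi$; it is known that $C_\varphi$ is bounded on such $H^2_\beta$ when $\varphi$ is analytic on $\overline{\mathbb{D}}$ with $\varphi(\mathbb{D})\subseteq\mathbb{D}$. A bounded operator $T$ on a Hilbert space is semi-Fredholm if it has closed range and at least one of $\dim\ker T<\infty$, $\dim\ker T^*<\infty$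 holds. *)

(* Defs.v *)
From Stdlib Require Import Reals List ClassicalEpsilon.
From Coquelicot Require Import Coquelicot.

Local Open Scope R_scope.
Local Open Scope C_scope.

Definition disk (z : C) : Prop := (Cmod z < 1)%R.
Definition closed_disk (z : C) : Prop := (Cmod z <= 1)%R.
Definition circle (z : C) : Prop := Cmod z = 1%R.

(* A weight sequence is indexed by [k >= 1]; the value [w 0] is never used. *)
Fixpoint beta (w : nat -> R) (k : nat) : R :=
  match k with
  | O => 1%R
  | S j => (beta w j * w (S j))%R
  end.

Definition weight_sequence (w : nat -> R) : Prop :=
  (forall k, (1 <= k)%nat -> (0 < w k)%R) /\ is_lim_seq w 1%R.

Definition polynomial_growth (w : nat -> R) : Prop :=
  exists M : R, forall k, (1 <= k)%nat -> ((INR k + 1) * Rabs (w k - 1) <= M)%R.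

(* A function on the unit disk is represented by a total function [C -> C]
   whose values outside the disk are ignored; accordingly, elements of the
   Hardy space are identified when they are [eq_on_disk]. *)

Definition eq_on_disk (f g : C -> C) : Prop := forall z, disk z -> f z = g z.

Definition power_series_on_disk (f : C -> C) (a : nat -> C) : Prop :=
  forall z, disk z ->
    @is_pseries C_AbsRing C_NormedModule a z (f z).

(* The coefficients are unique when they exist, that is, when [f] is analytic
   on the disk; otherwise [coef f] is arbitrary. *)
Definition coef (f : C -> C) : nat -> C :=
  epsilon (inhabits (fun _ : nat => RtoC 0)) (power_series_on_disk f).

Definition H2 (w : nat -> R) (f : C -> C) : Prop :=
  power_series_on_disk f (coef f) /\
  ex_series (fun k => (Cmod (coef f k) ^ 2 * beta w k ^ 2)%R).

Definition H2_norm (w : nat -> R) (f : C -> C) : R :=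
  sqrt (Series (fun k => (Cmod (coef f k) ^ 2 * beta w k ^ 2)%R)).

(* [Series] is real-valued, so the complex sum is taken componentwise. *)
Definition H2_inner (w : nat -> R) (f g : C -> C) : C :=
  let u k := coef f k * Cconj (coef g k) * RtoC (beta w k ^ 2) in
  (Series (fun k => Re (u k)), Series (fun k => Im (u k))).

Definition bounded_operator (w : nat -> R) (T : (C -> C) -> (C -> C)) : Prop :=
  (forall f, H2 w f -> H2 w (T f)) /\
  (forall (a b : C) (f g : C -> C), H2 w f -> H2 w g ->
     eq_on_disk (T (fun z => a * f z + b * g z))
                (fun z => a * T f z + b * T g z)) /\
  (exists M : R, forall f, H2 w f -> (H2_norm w (T f) <= M * H2_norm w f)%R).

Definition range (w : nat -> R) (T : (C -> C) -> (C -> C)) (g : C -> C) : Prop :=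
  exists f, H2 w f /\ eq_on_disk (T f) g.

Definition kernel (w : nat -> R) (T : (C -> C) -> (C -> C)) (f : C -> C) : Prop :=
  H2 w f /\ eq_on_disk (T f) (fun _ => RtoC 0).

Definition closed_in_H2 (w : nat -> R) (S : (C -> C) -> Prop) : Prop :=
  forall (u : nat -> C -> C) (g : C -> C),
    (forall n, H2 w (u n) /\ S (u n)) -> H2 w g ->
    is_lim_seq (fun n => H2_norm w (fun z => u n z - g z)) 0%R ->
    S g.

Definition closed_range (w : nat -> R) (T : (C -> C) -> (C -> C)) : Prop :=
  closed_in_H2 w (range w T).

(* [sum_n_m _ 1 n] is the empty sum when [n = 0]. *)
Definition finite_dimensional (S : (C -> C) -> Prop) : Prop :=
  exists (n : nat) (e : nat -> C -> C),
    (forall i, (1 <= i <= n)%nat -> S (e i)) /\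
    forall f, S f ->
      exists c : nat -> C,
        eq_on_disk f (fun z => sum_n_m (fun i => c i * e i z) 1 n).

Definition is_adjoint (w : nat -> R) (T T' : (C -> C) -> (C -> C)) : Prop :=
  bounded_operator w T' /\
  forall f g, H2 w f -> H2 w g -> H2_inner w (T f) g = H2_inner w f (T' g).

Definition semi_Fredholm (w : nat -> R) (T : (C -> C) -> (C -> C)) : Prop :=
  bounded_operator w T /\
  closed_range w T /\
  (finite_dimensional (kernel w T) \/
   exists T', is_adjoint w T T' /\ finite_dimensional (kernel w T')).

Definition composition_operator (phi : C -> C) (f : C -> C) : C -> C :=
  fun z => f (phi z).

Definition analytic_at (f : C -> C) (z0 : C) : Prop :=
  exists (a : nat -> C) (r : R), (0 < r)%R /\
    forall z, (Cmod (z - z0) < r)%R ->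
      @is_pseries C_AbsRing C_NormedModule a (z - z0) (f z).

Definition analytic_on_closed_disk (f : C -> C) : Prop :=
  exists U : C -> Prop, open U /\
    (forall z, closed_disk z -> U z) /\
    (forall z, U z -> analytic_at f z).

Definition nonconstant_on_closed_disk (f : C -> C) : Prop :=
  exists z1 z2, closed_disk z1 /\ closed_disk z2 /\ f z1 <> f z2.

Definition image (f : C -> C) (A : C -> Prop) (y : C) : Prop :=
  exists z, A z /\ f z = y.

(* The pair [(cos t, sin t)] is the point [exp (i t)] of the circle. *)
Definition arc (A : C -> Prop) : Prop :=
  exists a b : R, (a < b)%R /\
    forall z : C, A z <-> exists t : R, (a <= t <= b)%R /\ z = (cos t, sin t).

Definition finite_Blaschke_product (f : C -> C) : Prop :=
  exists (c : C) (zeros : list C),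
    circle c /\ List.Forall disk zeros /\
    forall z, closed_disk z ->
      f z = c * fold_right
                  (fun a p => (z - a) / (1 - Cconj a * z) * p) 1 zeros.

(* Main.v *)
(* If phi misses a point zeta of the circle, then (1 - conj zeta z)^-(N+1) lies
   outside the space for large N, although its composition with phi is the limit of
   the compositions of its dilates; so the range is not closed.  If phi maps points
   of the circle onto an arc, then phi(z) conj(phi(1/conj z)) = 1 near the circle,
   and dividing out the zeros of phi leaves a unimodular constant.

   For a finite Blaschke product phi (indeed any inner phi analytic across the
   circle) the matrix A of C_phi on the coefficients is bounded on l2, since its
   Gram matrix is dominated by (|phi(0)|^|m-n|), and decays geometrically off a
   cone m ~ n.  Inside the cone a weight of polynomial growth is constant up to a
   factor on neighbouring geometric blocks, so A is bounded for the weight beta, and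
   also for 1/beta.  When phi(0) = 0, A is isometric on l2, and
   <f, h> = <Af, Ah> with h = beta^2 f turns the bound for 1/beta into a lower bound
   for beta; an automorphism of the disk reduces the general case to this one. *)

Require Import Defs.
From Stdlib Require Import Reals Factorial Lra Lia List ClassicalEpsilon Classical FunctionalExtensionality.
From Coquelicot Require Import Coquelicot.
Local Open Scope R_scope.

(** * Finite sums and limits *)

(** Semi-Fredholmness is reached from the kernel side: for a Blaschke product the lower bound makes
    [C_phi] injective, and the boundedness contained in (1) comes from the same matrix estimate. The
    function theory rests on means over circles. Cauchy's formula turns Taylor coefficients into
    means. A bound for [phi] on a circle of radius above 1 then controls the coefficients of
    [phi ^ n] of index far above [n], and a bound below 1 on a small circle controls those of index
    far below [n]; this is the cone. Parseval's identity gives the strict maximum principle and the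
    link with the Gram matrix. The weight may tend to 0 or to infinity like a power of [k], so [l2]
    estimates do not transfer globally; they are applied block by block. The exponent [N + 1] has
    the same origin: the coefficients of the singular function grow like [k ^ N], while [beta]
    decreases at most like [k ^ - N], so the terms of its norm do not tend to 0. The lower bound,
    proved for polynomials, passes to series only with the help of the upper bound, which controls
    the image of the tail. *)

Fixpoint csum (a : nat -> C) (n : nat) : C :=
  match n with O => 0%C | S m => (csum a m + a m)%C end.

(** Both finite sums stop before index [n], whereas [sum_n] includes it; inductions thus start from
    the empty sum, and the bridges to [sum_n] carry a shift by one. *)
Fixpoint rsum (a : nat -> R) (n : nat) : R :=
  match n with O => 0 | S m => rsum a m + a m end.

Lemma csum_ext (a b : nat -> C) n :
  (forall k, (k < n)%nat -> a k = b k) -> csum a n = csum b n.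
Proof.
  induction n as [|n IH]; intros H; simpl; [easy|].
  rewrite IH, H; auto.
Qed.

Lemma csum_plus (a b : nat -> C) n :
  csum (fun k => a k + b k)%C n = (csum a n + csum b n)%C.
Proof. induction n as [|n IH]; simpl; [|rewrite IH]; ring. Qed.

Lemma csum_scal (c : C) (a : nat -> C) n :
  csum (fun k => c * a k)%C n = (c * csum a n)%C.
Proof. induction n as [|n IH]; simpl; [|rewrite IH]; ring. Qed.

Lemma csum_minus (a b : nat -> C) n :
  csum (fun k => a k - b k)%C n = (csum a n - csum b n)%C.
Proof. induction n as [|n IH]; simpl; [|rewrite IH]; ring. Qed.

Lemma csum_conj (a : nat -> C) n :
  Cconj (csum a n) = csum (fun k => Cconj (a k)) n.
Proof.
  induction n as [|n IH]; simpl.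
  - unfold Cconj, RtoC; simpl; f_equal; ring.
  - now rewrite Cplus_conj, IH.
Qed.

Lemma csum_shift (a : nat -> C) n :
  csum a (S n) = (a O + csum (fun k => a (S k)) n)%C.
Proof.
  induction n as [|n IH]; [simpl; ring|].
  change (csum a (S (S n))) with (csum a (S n) + a (S n))%C.
  rewrite IH; simpl; ring.
Qed.

Lemma csum_delta (a : nat -> C) m n :
  (forall k, k <> m -> a k = 0%C) -> (m < n)%nat -> csum a n = a m.
Proof.
  intros H Hm. induction n as [|n IH]; [lia|]. simpl.
  destruct (Nat.eq_dec n m) as [->|Hn].
  - rewrite (csum_ext _ (fun _ => 0 * 0)%C), csum_scal; [ring|].
    intros k Hk; rewrite H by lia; ring.
  - rewrite IH by lia. rewrite (H n) by easy. ring.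
Qed.

Lemma rsum_ext (a b : nat -> R) n :
  (forall k, (k < n)%nat -> a k = b k) -> rsum a n = rsum b n.
Proof.
  induction n as [|n IH]; intros H; simpl; [easy|].
  rewrite IH, H; auto.
Qed.

Lemma rsum_plus (a b : nat -> R) n :
  rsum (fun k => a k + b k) n = rsum a n + rsum b n.
Proof. induction n as [|n IH]; simpl; [|rewrite IH]; ring. Qed.

Lemma rsum_scal (c : R) (a : nat -> R) n :
  rsum (fun k => c * a k) n = c * rsum a n.
Proof. induction n as [|n IH]; simpl; [|rewrite IH]; ring. Qed.

Lemma rsum_switch (u : nat -> nat -> R) n m :
  rsum (fun i => rsum (u i) m) n = rsum (fun j => rsum (fun i => u i j) n) m.
Proof.
  induction n as [|n IH]; simpl.
  - induction m as [|m IHm]; simpl; [easy|rewrite <- IHm; ring].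
  - now rewrite IH, <- rsum_plus.
Qed.

Lemma rsum_le (a b : nat -> R) n :
  (forall k, (k < n)%nat -> a k <= b k) -> rsum a n <= rsum b n.
Proof.
  induction n as [|n IH]; intros H; simpl; [lra|].
  apply Rplus_le_compat; auto.
Qed.

Lemma rsum_nonneg (a : nat -> R) n : (forall k, 0 <= a k) -> 0 <= rsum a n.
Proof.
  intros H; induction n as [|n IH]; simpl; [lra|].
  specialize (H n); lra.
Qed.

Lemma rsum_mono (a : nat -> R) n m :
  (forall k, 0 <= a k) -> (n <= m)%nat -> rsum a n <= rsum a m.
Proof.
  intros H Hnm; induction Hnm as [|m Hnm IH]; simpl; [lra|].
  specialize (H m); lra.
Qed.

Lemma rsum_term_le (a : nat -> R) k n :
  (forall k, 0 <= a k) -> (k < n)%nat -> a k <= rsum a n.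
Proof.
  intros H Hk. apply Rle_trans with (rsum a (S k)).
  - simpl. assert (0 <= rsum a k) by now apply rsum_nonneg. lra.
  - now apply rsum_mono.
Qed.

Lemma rsum_Cauchy_Schwarz (x y : nat -> R) n :
  (rsum (fun k => x k * y k) n) ^ 2
  <= rsum (fun k => x k ^ 2) n * rsum (fun k => y k ^ 2) n.
Proof.
  induction n as [|n IH]; cbn [rsum]; [lra|].
  set (s := rsum (fun k => x k * y k) n) in *.
  assert (HX : 0 <= rsum (fun k => x k ^ 2) n)
    by (apply rsum_nonneg; intros; apply pow2_ge_0).
  assert (HY : 0 <= rsum (fun k => y k ^ 2) n)
    by (apply rsum_nonneg; intros; apply pow2_ge_0).
  set (X := rsum (fun k => x k ^ 2) n) in *.
  set (Y := rsum (fun k => y k ^ 2) n) in *.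
  set (a := x n) in *. set (b := y n) in *.
  (* The cross term: by the induction hypothesis its square is at most [4 X Y a^2 b^2], which is at
     most [(X b^2 + Y a^2)^2]. *)
  assert (H : 2 * (s * (a * b)) <= X * b ^ 2 + Y * a ^ 2).
  { assert (0 <= X * b ^ 2) by (apply Rmult_le_pos; [easy|apply pow2_ge_0]).
    assert (0 <= Y * a ^ 2) by (apply Rmult_le_pos; [easy|apply pow2_ge_0]).
    apply Rsqr_incr_0_var; [|lra]. unfold Rsqr.
    assert (s ^ 2 * (a * b) ^ 2 <= X * Y * (a * b) ^ 2)
      by (apply Rmult_le_compat_r; [apply pow2_ge_0|easy]).
    assert (0 <= (X * b ^ 2 - Y * a ^ 2) ^ 2) by apply pow2_ge_0.
    nra. }
  nra.
Qed.

Lemma Cmod_csum_le (a : nat -> C) n : Cmod (csum a n) <= rsum (fun k => Cmod (a k)) n.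
Proof.
  induction n as [|n IH]; simpl; [rewrite Cmod_0; lra|].
  apply Rle_trans with (1 := Cmod_triangle _ _). lra.
Qed.

Lemma Re_csum (a : nat -> C) n : Re (csum a n) = rsum (fun k => Re (a k)) n.
Proof. induction n as [|n IH]; simpl; [easy|now rewrite <- IH]. Qed.

Lemma Im_csum (a : nat -> C) n : Im (csum a n) = rsum (fun k => Im (a k)) n.
Proof. induction n as [|n IH]; simpl; [easy|now rewrite <- IH]. Qed.

Lemma sum_n_rsum (a : nat -> R) n : sum_n a n = rsum a (S n).
Proof.
  induction n as [|n IH].
  - rewrite sum_O; simpl; ring.
  - rewrite sum_Sn, IH; simpl; unfold plus; simpl; ring.
Qed.

Lemma is_series_rsum (a : nat -> R) (l : R) :
  is_series a l <-> is_lim_seq (rsum a) l.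
Proof.
  rewrite (is_lim_seq_incr_1 (rsum a)).
  split; intros H.
  - apply is_lim_seq_ext with (2 := H). intros; now rewrite sum_n_rsum.
  - change (is_lim_seq (sum_n a) l).
    apply is_lim_seq_ext with (2 := H). intros; now rewrite sum_n_rsum.
Qed.

Lemma series_of_bounded (a : nat -> R) (M : R) :
  (forall k, 0 <= a k) -> (forall n, rsum a n <= M) ->
  ex_series a /\ Series a <= M.
Proof.
  intros Ha HM.
  destruct (ex_finite_lim_seq_incr (rsum a) M) as [l Hl].
  - intros n; simpl; specialize (Ha n); lra.
  - easy.
  - assert (Hs : is_series a l) by now apply is_series_rsum.
    split; [now exists l|].
    rewrite (is_series_unique _ _ Hs).
    apply (is_lim_seq_le (rsum a) (fun _ => M) l M); auto using is_lim_seq_const.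
Qed.

Lemma rsum_le_Series (a : nat -> R) n :
  (forall k, 0 <= a k) -> ex_series a -> rsum a n <= Series a.
Proof.
  intros Ha Hs. apply Series_correct, is_series_rsum in Hs.
  apply (is_lim_seq_incr_compare _ _ Hs).
  intros k; simpl; specialize (Ha k); lra.
Qed.

Lemma Series_nonneg (a : nat -> R) :
  (forall k, 0 <= a k) -> ex_series a -> 0 <= Series a.
Proof. intros Ha Hs. now apply (rsum_le_Series a 0). Qed.

Lemma Cmod_minus_sym (a b : C) : Cmod (a - b) = Cmod (b - a).
Proof. rewrite <- Cmod_opp. f_equal. ring. Qed.

Lemma Cmod_triangle_minus (a b c : C) : Cmod (a - c) <= Cmod (a - b) + Cmod (b - c).
Proof. replace (a - c)%C with ((a - b) + (b - c))%C by ring. apply Cmod_triangle. Qed.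

Lemma Cmod_le_minus (a b : C) : Cmod a <= Cmod b + Cmod (a - b).
Proof.
  replace a with (b + (a - b))%C at 1 by ring. apply Cmod_triangle.
Qed.

Lemma Cmod_minus_le (a b : C) : Cmod (a - b) <= Cmod a + Cmod b.
Proof. unfold Cminus. rewrite <- (Cmod_opp b). apply Cmod_triangle. Qed.

Lemma Cminus_eq_0 (a b : C) : Cmod (a - b) = 0 -> a = b.
Proof.
  intros H. apply Cmod_eq_0 in H.
  replace a with (a - b + b)%C by ring. rewrite H. ring.
Qed.

Lemma Re_minus (a b : C) : Re (a - b) = Re a - Re b.
Proof. unfold Re, Cminus, Cplus, Copp; simpl; ring. Qed.

Lemma Im_minus (a b : C) : Im (a - b) = Im a - Im b.
Proof. unfold Im, Cminus, Cplus, Copp; simpl; ring. Qed.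

Lemma im_le_Cmod (c : C) : Rabs (Im c) <= Cmod c.
Proof. apply Rle_trans with (2 := Rmax_Cmod c). apply Rmax_r. Qed.

Lemma Cmod_le_re_im (c : C) : Cmod c <= Rabs (Re c) + Rabs (Im c).
Proof.
  replace c with (RtoC (Re c) + Ci * RtoC (Im c))%C at 1.
  - apply Rle_trans with (1 := Cmod_triangle _ _).
    rewrite Cmod_mult, Cmod_Ci, !Cmod_R. lra.
  - destruct c as [x y]. unfold Ci, RtoC, Cplus, Cmult, Re, Im; simpl.
    f_equal; ring.
Qed.

(** * Limits of complex sequences, through real sequences of distances *)

Definition clim (u : nat -> C) (l : C) : Prop := is_lim_seq (fun n => Cmod (u n - l)) 0.

Lemma is_lim_seq_0_le (u v : nat -> R) :
  (forall n, 0 <= u n <= v n) -> is_lim_seq v 0 -> is_lim_seq u 0.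
Proof.
  intros H Hv. apply is_lim_seq_le_le with (u := fun _ => 0) (w := v); auto.
  apply is_lim_seq_const.
Qed.

Lemma clim_le (u : nat -> C) (l : C) (v : nat -> R) :
  (forall n, Cmod (u n - l) <= v n) -> is_lim_seq v 0 -> clim u l.
Proof.
  intros H. apply is_lim_seq_0_le. intros n; split; [apply Cmod_ge_0|easy].
Qed.

Lemma is_lim_seq_0_plus (u v : nat -> R) :
  is_lim_seq u 0 -> is_lim_seq v 0 -> is_lim_seq (fun n => u n + v n) 0.
Proof.
  intros Hu Hv. replace 0 with (0 + 0) by ring. now apply is_lim_seq_plus'.
Qed.

Lemma is_lim_seq_0_scal (c : R) (u : nat -> R) :
  is_lim_seq u 0 -> is_lim_seq (fun n => c * u n) 0.
Proof.
  intros Hu. replace 0 with (c * 0) by ring.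
  apply (is_lim_seq_scal_l u c 0 Hu).
Qed.

Lemma is_lim_seq_0_pow (q : R) : 0 <= q < 1 -> is_lim_seq (fun n => q ^ n) 0.
Proof. intros Hq. apply is_lim_seq_geom. rewrite Rabs_pos_eq; lra. Qed.

Lemma clim_const (l : C) : clim (fun _ => l) l.
Proof.
  apply clim_le with (fun _ => 0); [|apply is_lim_seq_const].
  intros _. replace (l - l)%C with (RtoC 0) by ring. rewrite Cmod_0; lra.
Qed.

Lemma clim_ext (u v : nat -> C) (l : C) : (forall n, u n = v n) -> clim u l -> clim v l.
Proof. intros H. apply is_lim_seq_ext. intros n. now rewrite H. Qed.

Lemma clim_plus (u v : nat -> C) (l m : C) :
  clim u l -> clim v m -> clim (fun n => u n + v n)%C (l + m).
Proof.
  intros Hu Hv. apply clim_le with (2 := is_lim_seq_0_plus _ _ Hu Hv).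
  intros n. replace (u n + v n - (l + m))%C with ((u n - l) + (v n - m))%C by ring.
  apply Cmod_triangle.
Qed.

Lemma clim_scal (c : C) (u : nat -> C) (l : C) :
  clim u l -> clim (fun n => c * u n)%C (c * l).
Proof.
  intros Hu. apply clim_le with (2 := is_lim_seq_0_scal (Cmod c) _ Hu).
  intros n. replace (c * u n - c * l)%C with (c * (u n - l))%C by ring.
  rewrite Cmod_mult; lra.
Qed.

Lemma clim_minus (u v : nat -> C) (l m : C) :
  clim u l -> clim v m -> clim (fun n => u n - v n)%C (l - m).
Proof.
  intros Hu Hv.
  replace (l - m)%C with (l + (- (1)) * m)%C by ring.
  apply clim_ext with (fun n => u n + (- (1)) * v n)%C; [intros; ring|].
  apply clim_plus; auto. now apply clim_scal.
Qed.

Lemma clim_mod (u : nat -> C) (l : C) :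
  clim u l -> is_lim_seq (fun n => Cmod (u n)) (Cmod l).
Proof.
  intros Hu.
  apply is_lim_seq_le_le with (u := fun n => Cmod l - Cmod (u n - l))
    (w := fun n => Cmod l + Cmod (u n - l)).
  - intros n. generalize (Cmod_le_minus l (u n)) (Cmod_le_minus (u n) l).
    rewrite (Cmod_minus_sym l). lra.
  - replace (Cmod l) with (Cmod l - 0) at 1 by ring.
    apply is_lim_seq_minus'; [apply is_lim_seq_const|exact Hu].
  - replace (Cmod l) with (Cmod l + 0) at 1 by ring.
    apply is_lim_seq_plus'; [apply is_lim_seq_const|exact Hu].
Qed.

Lemma clim_bound (u : nat -> C) (l : C) (M : R) :
  clim u l -> (forall n, Cmod (u n) <= M) -> Cmod l <= M.
Proof.
  intros Hu HM.
  apply (is_lim_seq_le (fun n => Cmod (u n)) (fun _ => M) (Cmod l) M); auto.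
  - now apply clim_mod.
  - apply is_lim_seq_const.
Qed.

Lemma clim_unique (u : nat -> C) (l m : C) : clim u l -> clim u m -> l = m.
Proof.
  intros Hl Hm. generalize (clim_minus _ _ _ _ Hl Hm). intros H.
  apply Cminus_eq_0. apply Rle_antisym; [|apply Cmod_ge_0].
  apply clim_bound with (1 := H). intros n.
  replace (u n - u n)%C with (RtoC 0) by ring. rewrite Cmod_0; lra.
Qed.

Lemma clim_shift (u : nat -> C) (l : C) : clim u l <-> clim (fun n => u (S n)) l.
Proof. apply (is_lim_seq_incr_1 (fun n => Cmod (u n - l))). Qed.

Lemma clim_re_im (u : nat -> C) (l : C) :
  clim u l <->
  is_lim_seq (fun n => Re (u n)) (Re l) /\ is_lim_seq (fun n => Im (u n)) (Im l).
Proof.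
  split.
  - intros H. split.
    + apply is_lim_seq_le_le with (fun n => Re l - Cmod (u n - l)) (fun n => Re l + Cmod (u n - l)).
      * intros n. generalize (re_le_Cmod (u n - l)).
        rewrite Re_minus.
        intros Hn; apply Rabs_le_between in Hn; lra.
      * replace (Re l) with (Re l - 0) at 1 by ring.
        apply is_lim_seq_minus'; [apply is_lim_seq_const|exact H].
      * replace (Re l) with (Re l + 0) at 1 by ring.
        apply is_lim_seq_plus'; [apply is_lim_seq_const|exact H].
    + apply is_lim_seq_le_le with (fun n => Im l - Cmod (u n - l)) (fun n => Im l + Cmod (u n - l)).
      * intros n. generalize (im_le_Cmod (u n - l)).
        rewrite Im_minus.
        intros Hn; apply Rabs_le_between in Hn; lra.
      * replace (Im l) with (Im l - 0) at 1 by ring.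
        apply is_lim_seq_minus'; [apply is_lim_seq_const|exact H].
      * replace (Im l) with (Im l + 0) at 1 by ring.
        apply is_lim_seq_plus'; [apply is_lim_seq_const|exact H].
  - intros [Hr Hi].
    assert (H1 : is_lim_seq (fun n => Rabs (Re (u n) - Re l)) 0).
    { rewrite <- Rabs_R0. apply (is_lim_seq_abs _ 0).
      replace 0 with (Re l - Re l) by ring.
      apply is_lim_seq_minus'; [exact Hr|apply is_lim_seq_const]. }
    assert (H2 : is_lim_seq (fun n => Rabs (Im (u n) - Im l)) 0).
    { rewrite <- Rabs_R0. apply (is_lim_seq_abs _ 0).
      replace 0 with (Im l - Im l) by ring.
      apply is_lim_seq_minus'; [exact Hi|apply is_lim_seq_const]. }
    apply clim_le with (2 := is_lim_seq_0_plus _ _ H1 H2).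
    intros n. apply Rle_trans with (1 := Cmod_le_re_im _).
    rewrite Re_minus, Im_minus. lra.
Qed.

Lemma clim_eps (u : nat -> C) (l : C) :
  clim u l <-> forall eps, 0 < eps -> exists N, forall n, (N <= n)%nat -> Cmod (u n - l) < eps.
Proof.
  unfold clim. rewrite <- is_lim_seq_spec. unfold is_lim_seq', eventually.
  split.
  - intros H eps He. destruct (H (mkposreal eps He)) as [N HN]. exists N. intros n Hn.
    specialize (HN n Hn). simpl in HN. rewrite Rminus_0_r, Rabs_pos_eq in HN; auto.
    apply Cmod_ge_0.
  - intros H eps. destruct (H eps (cond_pos eps)) as [N HN]. exists N. intros n Hn.
    rewrite Rminus_0_r, Rabs_pos_eq; auto. apply Cmod_ge_0.
Qed.

Lemma csum_abs_cv (a : nat -> C) :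
  ex_series (fun k => Cmod (a k)) -> exists l, clim (csum a) l.
Proof.
  intros H.
  assert (Hr : ex_series (fun k => Re (a k))).
  { apply (ex_series_le (V := R_CompleteNormedModule)) with (2 := H).
    intros n. apply re_le_Cmod. }
  assert (Hi : ex_series (fun k => Im (a k))).
  { apply (ex_series_le (V := R_CompleteNormedModule)) with (2 := H).
    intros n. apply im_le_Cmod. }
  destruct Hr as [x Hx], Hi as [y Hy].
  exists (x, y). apply clim_re_im. split.
  - apply is_series_rsum in Hx. apply is_lim_seq_ext with (2 := Hx).
    intros; now rewrite Re_csum.
  - apply is_series_rsum in Hy. apply is_lim_seq_ext with (2 := Hy).
    intros; now rewrite Im_csum.
Qed.

Definition pseries (a : nat -> C) (z l : C) : Prop := clim (csum (fun k => a k * z ^ k)%C) l.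

Lemma pow_n_Cpow (z : C) k : pow_n (K := C_AbsRing) z k = (z ^ k)%C.
Proof. induction k as [|k IH]; simpl; [easy|now rewrite IH]. Qed.

Lemma sum_n_csum (a : nat -> C) n : sum_n (G := C_AbelianGroup) a n = csum a (S n).
Proof.
  induction n as [|n IH].
  - rewrite sum_O; simpl; ring.
  - rewrite sum_Sn, IH; simpl; unfold plus; simpl; ring.
Qed.

Lemma ball_C (x y : C) (e : posreal) :
  ball (M := C_UniformSpace) x e y <-> Rabs (Re y - Re x) < e /\ Rabs (Im y - Im x) < e.
Proof. easy. Qed.

(** The uniform structure on [C] is the product one, whose balls are squares; passing to [Cmod]
    costs a factor 2, hence the halved radius in one direction. *)
Lemma is_pseries_pseries (a : nat -> C) (z l : C) :
  @is_pseries C_AbsRing C_NormedModule a z l <-> pseries a z l.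
Proof.
  unfold is_pseries, is_series, pseries.
  rewrite (clim_shift (csum _)), clim_eps.
  assert (E : forall n, sum_n (G := C_AbelianGroup)
     (fun k => scal (V := C_NormedModule) (pow_n (K := C_AbsRing) z k) (a k)) n
     = csum (fun k => a k * z ^ k)%C (S n)).
  { intros n. rewrite sum_n_csum. apply csum_ext. intros k _.
    rewrite pow_n_Cpow. unfold scal; simpl. unfold mult; simpl. ring. }
  rewrite (@filterlim_locally nat C_UniformSpace eventually _ _ l).
  split; intros H.
  - intros eps He. assert (He2 : pos (pos_div_2 (mkposreal eps He)) = eps / 2) by reflexivity.
    destruct (H (pos_div_2 (mkposreal eps He))) as [N HN].
    exists N. intros n Hn. specialize (HN n Hn). 
    destruct (proj1 (ball_C _ _ _) HN) as [H1 H2]; rewrite He2 in H1, H2.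
    rewrite <- E. apply Rle_lt_trans with (1 := Cmod_le_re_im _).
    rewrite Re_minus, Im_minus. refine (Rlt_le_trans _ (eps / 2 + eps / 2) _ (Rplus_lt_compat _ _ _ _ H1 H2) _). lra.
  - intros eps. destruct (H eps (cond_pos eps)) as [N HN].
    exists N. intros n Hn. specialize (HN n Hn). rewrite <- E in HN.
    apply ball_C. split; apply Rle_lt_trans with (2 := HN).
    + apply Rle_trans with (2 := re_le_Cmod _). rewrite Re_minus. exact (Rle_refl _).
    + apply Rle_trans with (2 := im_le_Cmod _). rewrite Im_minus. exact (Rle_refl _).
Qed.

(** * Complex derivatives *)

Local Notation contC f x := (continuous (U := C_UniformSpace) f x).

Lemma locally_Cmod (z : C) (P : C -> Prop) :
  locally (T := C_UniformSpace) z P <->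
  exists d, 0 < d /\ forall y, Cmod (y - z) < d -> P y.
Proof.
  split.
  - intros [d Hd]. exists d. split; [apply cond_pos|].
    intros y Hy. apply Hd. apply ball_C. rewrite <- Re_minus, <- Im_minus.
    split; apply Rle_lt_trans with (2 := Hy); [apply re_le_Cmod|apply im_le_Cmod].
  - intros [d [Hd H]]. exists (pos_div_2 (mkposreal d Hd)).
    intros y Hy. apply H. destruct (proj1 (ball_C _ _ _) Hy) as [H1 H2].
    apply Rle_lt_trans with (1 := Cmod_le_re_im _).
    rewrite Re_minus, Im_minus.
    refine (Rlt_le_trans _ (d / 2 + d / 2) _ (Rplus_lt_compat _ _ _ _ H1 H2) _). lra.
Qed.

Lemma continuous_pair_C {T : UniformSpace} (u v : T -> R) (x : T) :
  continuous u x -> continuous v x ->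
  contC (fun t => (u t, v t)) x.
Proof.
  intros Hu Hv.
  apply (continuous_comp_2 (X := C_UniformSpace) u v (fun a b => (a, b)) x Hu Hv).
  apply continuous_ext with (fun p : R_UniformSpace * R_UniformSpace => p).
  - intros [a b]; easy.
  - apply continuous_id.
Qed.

Lemma continuous_Re {T : UniformSpace} (f : T -> C) (x : T) :
  contC f x -> continuous (fun t => Re (f t)) x.
Proof.
  intros Hf. apply (continuous_comp (V := C_UniformSpace) f Re); auto.
  apply (continuous_fst (U := R_UniformSpace) (V := R_UniformSpace)).
Qed.

Lemma continuous_Im {T : UniformSpace} (f : T -> C) (x : T) :
  contC f x -> continuous (fun t => Im (f t)) x.
Proof.
  intros Hf. apply (continuous_comp (V := C_UniformSpace) f Im); auto.
  apply (continuous_snd (U := R_UniformSpace) (V := R_UniformSpace)).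
Qed.

Lemma continuous_Cplus {T : UniformSpace} (f g : T -> C) (x : T) :
  contC f x -> contC g x ->
  contC (fun t => f t + g t)%C x.
Proof.
  intros Hf Hg. apply continuous_pair_C.
  - apply (continuous_plus (V := R_NormedModule)); now apply continuous_Re.
  - apply (continuous_plus (V := R_NormedModule)); now apply continuous_Im.
Qed.

Lemma continuous_Copp {T : UniformSpace} (f : T -> C) (x : T) :
  contC f x ->
  contC (fun t => - f t)%C x.
Proof.
  intros Hf. apply continuous_pair_C.
  - apply (continuous_opp (V := R_NormedModule)); now apply continuous_Re.
  - apply (continuous_opp (V := R_NormedModule)); now apply continuous_Im.
Qed.

Lemma continuous_Cconj {T : UniformSpace} (f : T -> C) (x : T) :
  contC f x ->
  contC (fun t => Cconj (f t)) x.
Proof.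
  intros Hf. apply continuous_pair_C.
  - now apply continuous_Re.
  - apply (continuous_opp (V := R_NormedModule)); now apply continuous_Im.
Qed.

Lemma continuous_Cminus {T : UniformSpace} (f g : T -> C) (x : T) :
  contC f x -> contC g x ->
  contC (fun t => f t - g t)%C x.
Proof.
  intros Hf Hg. apply (continuous_Cplus f (fun t => - g t)%C); auto.
  now apply continuous_Copp.
Qed.

Lemma continuous_Cmult {T : UniformSpace} (f g : T -> C) (x : T) :
  contC f x -> contC g x ->
  contC (fun t => f t * g t)%C x.
Proof.
  intros Hf Hg.
  assert (Hm : forall u v : T -> R, continuous u x -> continuous v x ->
     continuous (fun t => u t * v t) x)
    by (intros u v; apply (continuous_mult (K := R_AbsRing))).
  apply continuous_pair_C.
  - apply (continuous_minus (V := R_NormedModule)); apply Hm;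
      auto using continuous_Re, continuous_Im.
  - apply (continuous_plus (V := R_NormedModule)); apply Hm;
      auto using continuous_Re, continuous_Im.
Qed.

Lemma continuous_RtoC {T : UniformSpace} (f : T -> R) (x : T) :
  continuous f x -> contC (fun t => RtoC (f t)) x.
Proof. intros Hf. apply continuous_pair_C; [easy|apply continuous_const]. Qed.

Lemma continuous_Cpow {T : UniformSpace} (f : T -> C) (x : T) n :
  contC f x ->
  contC (fun t => f t ^ n)%C x.
Proof.
  intros Hf. induction n as [|n IH]; simpl.
  - apply continuous_const.
  - now apply continuous_Cmult.
Qed.

Lemma continuous_Cmod_iff {T : UniformSpace} (f : T -> C) (x : T) :
  contC f x <->
  forall eps, 0 < eps -> locally x (fun y => Cmod (f y - f x) < eps).
Proof.
  split.
  - intros Hf eps He. apply (Hf (fun w => Cmod (w - f x) < eps)).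
    apply locally_Cmod. now exists eps.
  - intros H P HP. apply locally_Cmod in HP. destruct HP as [d [Hd HP]].
    apply (filter_imp (F := locally x)) with (2 := H d Hd).
    intros y Hy. now apply HP.
Qed.

Lemma continuous_C_eps (f : C -> C) (z : C) :
  contC f z <->
  forall eps, 0 < eps -> exists d, 0 < d /\
    forall y, Cmod (y - z) < d -> Cmod (f y - f z) < eps.
Proof.
  rewrite continuous_Cmod_iff.
  split; intros H eps He; specialize (H eps He); now apply locally_Cmod.
Qed.

(** Written without a difference quotient, so that [h = 0] is allowed and the chain rule needs no
    case where the inner increment vanishes. *)
Definition cderiv (f : C -> C) (z d : C) : Prop :=
  forall eps, 0 < eps -> exists r, 0 < r /\
    forall h, Cmod h < r -> Cmod (f (z + h)%C - f z - d * h) <= eps * Cmod h.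

Lemma cderiv_const (c z : C) : cderiv (fun _ => c) z 0.
Proof.
  intros eps He. exists 1. split; [lra|]. intros h _.
  replace (c - c - 0 * h)%C with (RtoC 0) by ring. rewrite Cmod_0.
  apply Rmult_le_pos; [lra|apply Cmod_ge_0].
Qed.

Lemma cderiv_id (z : C) : cderiv (fun y => y) z 1.
Proof.
  intros eps He. exists 1. split; [lra|]. intros h _.
  replace (z + h - z - 1 * h)%C with (RtoC 0) by ring. rewrite Cmod_0.
  apply Rmult_le_pos; [lra|apply Cmod_ge_0].
Qed.

Lemma cderiv_plus (f g : C -> C) (z a b : C) :
  cderiv f z a -> cderiv g z b -> cderiv (fun y => f y + g y)%C z (a + b).
Proof.
  intros Hf Hg eps He.
  destruct (Hf (eps / 2)) as [r [Hr Hf']]; [lra|].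
  destruct (Hg (eps / 2)) as [s [Hs Hg']]; [lra|].
  exists (Rmin r s). split; [now apply Rmin_pos|]. intros h Hh.
  assert (Cmod h < r) by (apply Rlt_le_trans with (1 := Hh), Rmin_l).
  assert (Cmod h < s) by (apply Rlt_le_trans with (1 := Hh), Rmin_r).
  replace (f (z + h)%C + g (z + h)%C - (f z + g z) - (a + b) * h)%C
    with ((f (z + h)%C - f z - a * h) + (g (z + h)%C - g z - b * h))%C by ring.
  apply Rle_trans with (1 := Cmod_triangle _ _).
  specialize (Hf' h). specialize (Hg' h). lra.
Qed.

(** [S] restricts the increment, not the point. All increments give [cderiv], real ones give the
    derivative of a curve, and one chain rule serves both. *)
Definition cderiv_within (S : C -> Prop) (f : C -> C) (z d : C) : Prop :=
  forall eps, 0 < eps -> exists r, 0 < r /\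
    forall h, S h -> Cmod h < r -> Cmod (f (z + h)%C - f z - d * h) <= eps * Cmod h.

Lemma cderiv_within_full (f : C -> C) (z d : C) :
  cderiv f z d <-> cderiv_within (fun _ => True) f z d.
Proof.
  split; intros H eps He; destruct (H eps He) as [r [Hr Hh]]; exists r; auto.
Qed.

Lemma cderiv_within_bound (S : C -> Prop) (f : C -> C) (z d : C) :
  cderiv_within S f z d -> exists r, 0 < r /\
    forall h, S h -> Cmod h < r -> Cmod (f (z + h)%C - f z) <= (Cmod d + 1) * Cmod h.
Proof.
  intros Hf. destruct (Hf 1) as [r [Hr H]]; [lra|].
  exists r. split; auto. intros h HS Hh. specialize (H h HS Hh).
  replace (f (z + h)%C - f z)%C with ((f (z + h)%C - f z - d * h) + d * h)%C by ring.
  apply Rle_trans with (1 := Cmod_triangle _ _). rewrite Cmod_mult. lra.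
Qed.

Lemma cderiv_continuous (f : C -> C) (z d : C) :
  cderiv f z d -> contC f z.
Proof.
  intros Hf. apply continuous_C_eps. intros eps He.
  destruct (cderiv_within_bound _ _ _ _ (proj1 (cderiv_within_full _ _ _) Hf)) as [r [Hr H]].
  assert (Hd : 0 < Cmod d + 1) by (generalize (Cmod_ge_0 d); lra).
  exists (Rmin r (eps / (Cmod d + 1))). split.
  - apply Rmin_pos; auto. now apply Rdiv_lt_0_compat.
  - intros y Hy. specialize (H (y - z)%C).
    replace (z + (y - z))%C with y in H by ring.
    apply Rle_lt_trans with ((Cmod d + 1) * Cmod (y - z)).
    + apply H; auto. apply Rlt_le_trans with (1 := Hy), Rmin_l.
    + apply Rlt_le_trans with ((Cmod d + 1) * (eps / (Cmod d + 1))).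
      * apply Rmult_lt_compat_l; auto.
        apply Rlt_le_trans with (1 := Hy), Rmin_r.
      * right. field. lra.
Qed.

Lemma cderiv_within_comp (S : C -> Prop) (f g : C -> C) (z a b : C) :
  cderiv f (g z) a -> cderiv_within S g z b -> cderiv_within S (fun y => f (g y)) z (a * b).
Proof.
  intros Hf Hg eps He.
  destruct (cderiv_within_bound _ _ _ _ Hg) as [r1 [Hr1 H1]].
  set (L := Cmod b + 1) in *.
  assert (HL : 0 < L) by (unfold L; generalize (Cmod_ge_0 b); lra).
  assert (HA : 0 < Cmod a + 1) by (generalize (Cmod_ge_0 a); lra).
  destruct (Hf (eps / (2 * L))) as [r2 [Hr2 H2]].
  { apply Rdiv_lt_0_compat; lra. }
  destruct (Hg (eps / (2 * (Cmod a + 1)))) as [r3 [Hr3 H3]].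
  { apply Rdiv_lt_0_compat; lra. }
  exists (Rmin r1 (Rmin (r2 / L) r3)). split.
  { repeat apply Rmin_pos; auto. now apply Rdiv_lt_0_compat. }
  intros h HS Hh.
  assert (Hh1 : Cmod h < r1) by (apply Rlt_le_trans with (1 := Hh), Rmin_l).
  assert (Hh2 : Cmod h < r2 / L).
  { apply Rlt_le_trans with (1 := Hh). apply Rle_trans with (1 := Rmin_r _ _). apply Rmin_l. }
  assert (Hh3 : Cmod h < r3).
  { apply Rlt_le_trans with (1 := Hh). apply Rle_trans with (1 := Rmin_r _ _). apply Rmin_r. }
  set (k := (g (z + h)%C - g z)%C).
  assert (Hk : Cmod k <= L * Cmod h) by now apply H1.
  assert (Hk2 : Cmod k < r2).
  { apply Rle_lt_trans with (1 := Hk).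
    apply Rlt_le_trans with (L * (r2 / L)); [now apply Rmult_lt_compat_l|].
    right; field; lra. }
  specialize (H2 k Hk2). specialize (H3 h HS Hh3).
  replace (g z + k)%C with (g (z + h)%C) in H2 by (unfold k; ring).
  replace (f (g (z + h)%C) - f (g z) - a * b * h)%C
    with ((f (g (z + h)%C) - f (g z) - a * k) + a * (g (z + h)%C - g z - b * h))%C
    by (unfold k; ring).
  apply Rle_trans with (1 := Cmod_triangle _ _). rewrite Cmod_mult.
  assert (E1 : eps / (2 * L) * Cmod k <= eps / 2 * Cmod h).
  { apply Rle_trans with (eps / (2 * L) * (L * Cmod h)).
    - apply Rmult_le_compat_l; auto. apply Rlt_le, Rdiv_lt_0_compat; lra.
    - right; field; lra. }
  assert (E2 : Cmod a * Cmod (g (z + h)%C - g z - b * h) <= eps / 2 * Cmod h).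
  { apply Rle_trans with ((Cmod a + 1) * (eps / (2 * (Cmod a + 1)) * Cmod h)).
    - apply Rmult_le_compat; auto using Cmod_ge_0; lra.
    - right; field; lra. }
  lra.
Qed.

Lemma cderiv_comp (f g : C -> C) (z a b : C) :
  cderiv f (g z) a -> cderiv g z b -> cderiv (fun y => f (g y)) z (a * b).
Proof.
  intros Hf Hg. apply cderiv_within_full, cderiv_within_comp; auto.
  now apply cderiv_within_full.
Qed.

Lemma cderiv_eq (f : C -> C) (z a b : C) : cderiv f z a -> a = b -> cderiv f z b.
Proof. now intros H <-. Qed.

Lemma cderiv_sqr (z : C) : cderiv (fun y => y * y)%C z (2 * z).
Proof.
  intros eps He. exists eps. split; auto. intros h Hh.
  replace ((z + h) * (z + h) - z * z - 2 * z * h)%C with (h * h)%C by ring.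
  rewrite Cmod_mult. apply Rmult_le_compat_r; [apply Cmod_ge_0|lra].
Qed.

Lemma cderiv_scal (c : C) (f : C -> C) (z a : C) :
  cderiv f z a -> cderiv (fun y => c * f y)%C z (c * a).
Proof.
  intros Hf. apply cderiv_comp with (f := fun y => (c * y)%C); auto.
  intros eps He. exists 1. split; [lra|]. intros h _.
  replace (c * (f z + h) - c * f z - c * h)%C with (RtoC 0) by ring. rewrite Cmod_0.
  apply Rmult_le_pos; [lra|apply Cmod_ge_0].
Qed.

(* Polarization reduces the product rule to the derivative of a square. *)
Lemma cderiv_mult (f g : C -> C) (z a b : C) :
  cderiv f z a -> cderiv g z b -> cderiv (fun y => f y * g y)%C z (a * g z + f z * b).
Proof.
  intros Hf Hg.
  assert (Hp := cderiv_plus _ _ _ _ _ Hf Hg).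
  assert (Hm := cderiv_plus _ _ _ _ _ Hf (cderiv_scal (- (1)) _ _ _ Hg)).
  assert (H1 := cderiv_comp _ _ _ _ _ (cderiv_sqr _) Hp).
  assert (H2 := cderiv_comp _ _ _ _ _ (cderiv_sqr _) Hm).
  assert (H := cderiv_plus _ _ _ _ _ (cderiv_scal (/ 4) _ _ _ H1)
                 (cderiv_scal (- / 4) _ _ _ H2)).
  cbv beta in H.
  assert (H4 : RtoC 4 <> 0) by (intros E; apply RtoC_inj in E; lra).
  apply cderiv_eq with (b := (a * g z + f z * b)%C) in H.
  - intros eps He. destruct (H eps He) as [r [Hr Hh]]. exists r; split; auto.
    intros h Hl. specialize (Hh h Hl).
    replace (f (z + h)%C * g (z + h)%C - f z * g z)%C with
      (/ 4 * ((f (z + h)%C + g (z + h)%C) * (f (z + h)%C + g (z + h)%C)) +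
      - / 4 * ((f (z + h)%C + - (1) * g (z + h)%C) * (f (z + h)%C + - (1) * g (z + h)%C))
      - (/ 4 * ((f z + g z) * (f z + g z)) +
         - / 4 * ((f z + - (1) * g z) * (f z + - (1) * g z))))%C; [exact Hh|].
    field; auto.
  - field; auto.
Qed.

Lemma cderiv_inv_pt (z : C) : z <> 0 -> cderiv (fun y => / y)%C z (- / (z * z)).
Proof.
  intros Hz eps He.
  assert (Hm : 0 < Cmod z) by now apply Cmod_gt_0.
  set (m := Cmod z) in *.
  (* The remainder is [h^2 / (z^2 (z + h))]. The first radius gives [|z + h| >= m / 2], so it is at
     most [2 |h|^2 / m^3], and the second makes this at most [eps |h|]. *)
  exists (Rmin (m / 2) (eps * m ^ 3 / 2)). split.
  { apply Rmin_pos; [lra|]. apply Rdiv_lt_0_compat; [|lra].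
    apply Rmult_lt_0_compat; auto. now apply pow_lt. }
  intros h Hh.
  assert (Hh1 : Cmod h < m / 2) by (apply Rlt_le_trans with (1 := Hh), Rmin_l).
  assert (Hh2 : Cmod h < eps * m ^ 3 / 2) by (apply Rlt_le_trans with (1 := Hh), Rmin_r).
  assert (Hl : m / 2 <= Cmod (z + h)).
  { generalize (Cmod_le_minus z (- h)). rewrite Cmod_opp.
    replace (z - - h)%C with (z + h)%C by ring. fold m. lra. }
  assert (Hzh : (z + h)%C <> 0) by (apply Cmod_gt_0; lra).
  replace (/ (z + h) - / z - - / (z * z) * h)%C with (h * h * / ((z * z) * (z + h)))%C
    by (field; auto).
  assert (Hzz : (z * z)%C <> 0) by now apply Cmult_neq_0.
  rewrite !Cmod_mult, Cmod_inv, !Cmod_mult by now apply Cmult_neq_0.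
  fold m.
  assert (Hden : 0 < m * m * Cmod (z + h)) by (repeat apply Rmult_lt_0_compat; lra).
  rewrite Rmult_assoc, (Rmult_comm eps).
  apply Rmult_le_compat_l; [apply Cmod_ge_0|].
  apply Rmult_le_reg_r with (m * m * Cmod (z + h)); auto.
  rewrite Rmult_assoc, Rinv_l, Rmult_1_r by lra.
  apply Rle_trans with (eps * (m * m * (m / 2))).
  - lra.
  - apply Rmult_le_compat_l; [lra|]. apply Rmult_le_compat_l; [|easy].
    apply Rmult_le_pos; lra.
Qed.

Lemma cderiv_inv (f : C -> C) (z a : C) :
  cderiv f z a -> f z <> 0 -> cderiv (fun y => / f y)%C z (- / (f z * f z) * a).
Proof.
  intros Hf Hz. apply cderiv_comp with (f := fun y => (/ y)%C); auto.
  now apply cderiv_inv_pt.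
Qed.

Lemma continuous_Cinv {T : UniformSpace} (f : T -> C) (x : T) :
  contC f x -> f x <> 0 ->
  contC (fun t => / f t)%C x.
Proof.
  intros Hf Hx.
  apply (continuous_comp (V := C_UniformSpace) (W := C_UniformSpace) f Cinv); auto.
  apply cderiv_continuous with (1 := cderiv_inv_pt _ Hx).
Qed.

Lemma cderiv_unique (f : C -> C) (z a b : C) : cderiv f z a -> cderiv f z b -> a = b.
Proof.
  intros Ha Hb. apply Cminus_eq_0. apply Rle_antisym; [|apply Cmod_ge_0].
  apply le_epsilon. intros eps He. rewrite Rplus_0_l.
  destruct (Ha (eps / 2)) as [r [Hr H1]]; [lra|].
  destruct (Hb (eps / 2)) as [s [Hs H2]]; [lra|].
  assert (Hm : 0 < Rmin r s) by now apply Rmin_pos.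
  set (t := Rmin r s / 2).
  assert (Ht : 0 < t) by (unfold t; lra).
  assert (Hmod : Cmod t = t) by (rewrite Cmod_R; apply Rabs_pos_eq; lra).
  assert (t < r) by (generalize (Rmin_l r s); unfold t; lra).
  assert (t < s) by (generalize (Rmin_r r s); unfold t; lra).
  specialize (H1 t). specialize (H2 t). rewrite Hmod in H1, H2.
  apply Rmult_le_reg_r with t; auto. rewrite <- Hmod at 1. rewrite <- Cmod_mult.
  replace ((a - b) * t)%C with
    ((f (z + t)%C - f z - b * t) - (f (z + t)%C - f z - a * t))%C by ring.
  apply Rle_trans with (1 := Cmod_minus_le _ _). lra.
Qed.

(* Continuity of the derivative is part of the definition so that Cauchy's formula
   can be proved by differentiating under the integral sign. *)
Definition holo (U : C -> Prop) (f : C -> C) : Prop :=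
  exists f' : C -> C, forall z, U z ->
    cderiv f z (f' z) /\ contC f' z.

Lemma holo_subset (U V : C -> Prop) (f : C -> C) :
  (forall z, V z -> U z) -> holo U f -> holo V f.
Proof. intros HVU [f' H]. exists f'. auto. Qed.

Lemma holo_continuous (U : C -> Prop) (f : C -> C) (z : C) :
  holo U f -> U z -> contC f z.
Proof. intros [f' H] Hz. apply cderiv_continuous with (f' z). now apply H. Qed.

Lemma holo_const (U : C -> Prop) (c : C) : holo U (fun _ => c).
Proof.
  exists (fun _ => RtoC 0). intros z _. split; [apply cderiv_const|].
  apply continuous_const.
Qed.

Lemma holo_id (U : C -> Prop) : holo U (fun z => z).
Proof.
  exists (fun _ => RtoC 1). intros z _. split; [apply cderiv_id|].
  apply continuous_const.
Qed.

Lemma holo_plus (U : C -> Prop) (f g : C -> C) :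
  holo U f -> holo U g -> holo U (fun z => f z + g z)%C.
Proof.
  intros [f' Hf] [g' Hg]. exists (fun z => f' z + g' z)%C. intros z Hz.
  destruct (Hf z Hz), (Hg z Hz). split.
  - now apply cderiv_plus.
  - now apply continuous_Cplus.
Qed.

Lemma holo_mult (U : C -> Prop) (f g : C -> C) :
  holo U f -> holo U g -> holo U (fun z => f z * g z)%C.
Proof.
  intros Hf0 Hg0. generalize Hf0 Hg0. intros [f' Hf] [g' Hg].
  exists (fun z => f' z * g z + f z * g' z)%C. intros z Hz.
  destruct (Hf z Hz), (Hg z Hz). split.
  - now apply cderiv_mult.
  - apply continuous_Cplus; apply continuous_Cmult; auto.
    + now apply (holo_continuous U).
    + now apply (holo_continuous U).
Qed.

Lemma holo_minus (U : C -> Prop) (f g : C -> C) :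
  holo U f -> holo U g -> holo U (fun z => f z - g z)%C.
Proof.
  intros [f' Hf] [g' Hg]. exists (fun z => f' z + (- (1)) * g' z)%C. intros z Hz.
  destruct (Hf z Hz) as [Hf1 Hf2], (Hg z Hz) as [Hg1 Hg2]. split.
  - generalize (cderiv_plus _ _ _ _ _ Hf1 (cderiv_scal (- (1)) _ _ _ Hg1)).
    intros H eps He. destruct (H eps He) as [r [Hr Hh]]. exists r; split; auto.
    intros h Hl. specialize (Hh h Hl). revert Hh.
    match goal with |- Cmod ?a <= _ -> Cmod ?b <= _ => replace a with b by ring end.
    easy.
  - apply continuous_Cplus; auto. apply continuous_Cmult; auto. apply continuous_const.
Qed.

Lemma holo_inv (U : C -> Prop) (f : C -> C) :
  holo U f -> (forall z, U z -> f z <> 0) -> holo U (fun z => / f z)%C.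
Proof.
  intros Hf0 Hnz. generalize Hf0. intros [f' Hf].
  exists (fun z => - / (f z * f z) * f' z)%C. intros z Hz.
  destruct (Hf z Hz) as [Hf1 Hf2]. split.
  - apply cderiv_inv; auto.
  - assert (Hc : contC f z)
      by now apply (holo_continuous U).
    apply continuous_Cmult; auto. apply continuous_Copp, continuous_Cinv.
    + now apply continuous_Cmult.
    + apply Cmult_neq_0; auto.
Qed.

Lemma holo_comp (U V : C -> Prop) (f g : C -> C) :
  holo V f -> holo U g -> (forall z, U z -> V (g z)) -> holo U (fun z => f (g z)).
Proof.
  intros [f' Hf] Hg0 HUV. generalize Hg0. intros [g' Hg].
  exists (fun z => f' (g z) * g' z)%C. intros z Hz.
  destruct (Hf (g z) (HUV z Hz)), (Hg z Hz). split.
  - now apply cderiv_comp.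
  - apply continuous_Cmult; auto.
    apply (continuous_comp (U := C_UniformSpace) (V := C_UniformSpace) (W := C_UniformSpace) g f'); auto.
    now apply (holo_continuous U).
Qed.

Lemma holo_pow (U : C -> Prop) (f : C -> C) n :
  holo U f -> holo U (fun z => f z ^ n)%C.
Proof.
  intros Hf. induction n as [|n IH]; simpl; [apply holo_const|now apply holo_mult].
Qed.

Lemma cderiv_ext_loc (f g : C -> C) (z d : C) (r : R) :
  0 < r -> (forall y, Cmod (y - z) < r -> f y = g y) -> cderiv f z d -> cderiv g z d.
Proof.
  intros Hr H Hf eps He. destruct (Hf eps He) as [s [Hs Hh]].
  exists (Rmin r s). split; [now apply Rmin_pos|].
  intros h Hl. rewrite <- !H.
  - apply Hh. apply Rlt_le_trans with (1 := Hl), Rmin_r.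
  - replace (z - z)%C with (RtoC 0) by ring. now rewrite Cmod_0.
  - replace (z + h - z)%C with h by ring. apply Rlt_le_trans with (1 := Hl), Rmin_l.
Qed.

(** Each point comes with its own derivative function. A single global one is chosen by [epsilon],
    and uniqueness of the derivative identifies it near each point with the local one, from which it
    inherits continuity. *)
Lemma holo_local (U : C -> Prop) (f : C -> C) :
  (forall z, U z -> exists r, 0 < r /\ holo (fun y => Cmod (y - z) < r) f) -> holo U f.
Proof.
  intros H.
  set (D := fun z => epsilon (inhabits (RtoC 0)) (cderiv f z)).
  assert (HD : forall z d, cderiv f z d -> D z = d).
  { intros z d Hd. apply (cderiv_unique f z); auto.
    unfold D. apply epsilon_spec. now exists d. }
  exists D. intros z Hz. destruct (H z Hz) as [r [Hr [f' Hf']]].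
  assert (H0 : Cmod (z - z) < r)
    by (replace (z - z)%C with (RtoC 0) by ring; now rewrite Cmod_0).
  destruct (Hf' z H0) as [H1 H2].
  split.
  - now rewrite (HD z _ H1).
  - apply continuous_ext_loc with f'; auto.
    apply locally_Cmod. exists r. split; auto. intros y Hy.
    symmetry. apply HD. now apply Hf'.
Qed.

Definition ballC (R0 : R) (z : C) : Prop := Cmod z < R0.

Lemma ballC_nbhd (R0 : R) (z : C) : ballC R0 z ->
  exists r, 0 < r /\ forall y, Cmod (y - z) < r -> ballC R0 y.
Proof.
  unfold ballC. intros Hz. exists (R0 - Cmod z). split; [lra|]. intros y Hy.
  generalize (Cmod_le_minus y z). lra.
Qed.

Lemma holo_ext_ball (R0 : R) (f g : C -> C) :
  (forall z, ballC R0 z -> f z = g z) -> holo (ballC R0) f -> holo (ballC R0) g.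
Proof.
  intros H [f' Hf]. exists f'. intros z Hz. destruct (Hf z Hz) as [H1 H2].
  split; auto. destruct (ballC_nbhd R0 z Hz) as [r [Hr Hb]].
  apply cderiv_ext_loc with (3 := H1) (1 := Hr). auto.
Qed.

(** * Power series *)

Lemma is_lim_seq_INR_ratio : is_lim_seq (fun n => (INR n + 2) / (INR n + 1)) 1.
Proof.
  apply is_lim_seq_ext with (fun n => 1 + / (INR (S n))).
  - intros n. rewrite S_INR. field. generalize (pos_INR n); lra.
  - replace (Finite 1) with (Finite (1 + 0)) by (f_equal; ring).
    apply is_lim_seq_plus'; [apply is_lim_seq_const|].
    apply (is_lim_seq_incr_1 (fun n => / INR n)).
    apply (is_lim_seq_inv INR p_infty); [apply is_lim_seq_INR|easy].
Qed.

Lemma is_lim_seq_pow_1 (u : nat -> R) p :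
  is_lim_seq u 1 -> is_lim_seq (fun n => u n ^ p) 1.
Proof.
  intros Hu. induction p as [|p IH]; simpl; [apply is_lim_seq_const|].
  replace (Finite 1) with (Finite (1 * 1)) by (f_equal; ring).
  now apply is_lim_seq_mult'.
Qed.

Lemma ex_series_poly_geom (p : nat) (q : R) :
  0 <= q < 1 -> ex_series (fun k => (INR k + 1) ^ p * q ^ k).
Proof.
  intros [H0 H1].
  assert (Hpos : forall k x, 0 <= x -> 0 <= (INR k + 1) ^ p * x ^ k).
  { intros k x Hx. apply Rmult_le_pos; apply pow_le; auto.
    generalize (pos_INR k); lra. }
  (* The ratio test needs nonzero terms, and [q] may be 0; a larger base still below 1 avoids
     this. *)
  set (q1 := (q + 1) / 2).
  apply (ex_series_le (V := R_CompleteNormedModule)) with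
    (fun k => Rabs ((INR k + 1) ^ p * q1 ^ k)).
  { intros k. unfold norm; simpl; unfold abs; simpl.
    rewrite !Rabs_pos_eq by (apply Hpos; unfold q1; lra).
    apply Rmult_le_compat_l.
    - apply pow_le; generalize (pos_INR k); lra.
    - apply pow_incr. unfold q1; lra. }
  assert (Hq1 : 0 < q1 < 1) by (unfold q1; lra).
  apply ex_series_DAlembert with q1; [easy| |].
  - intros n. apply Rmult_integral_contrapositive_currified; apply pow_nonzero; [|lra].
    generalize (pos_INR n); lra.
  - apply is_lim_seq_ext with (fun n => q1 * ((INR n + 2) / (INR n + 1)) ^ p).
    + intros n. generalize (pos_INR n); intros Hn.
      rewrite S_INR. replace (INR n + 1 + 1) with (INR n + 2) by ring.
      assert (0 < INR n + 1) by lra.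
      assert (0 < (INR n + 1) ^ p) by now apply pow_lt.
      assert (0 < (INR n + 2) ^ p) by (apply pow_lt; lra).
      assert (0 < q1 ^ n) by now apply pow_lt.
      rewrite Rabs_pos_eq.
      * unfold Rdiv. rewrite Rpow_mult_distr, pow_inv. simpl. field. lra.
      * apply Rlt_le, Rdiv_lt_0_compat; apply Rmult_lt_0_compat; auto.
        now apply pow_lt.
    + replace (Finite q1) with (Finite (q1 * 1)) by (f_equal; ring).
      apply (is_lim_seq_scal_l _ q1 1). now apply is_lim_seq_pow_1, is_lim_seq_INR_ratio.
Qed.

Lemma clim_bounded (u : nat -> C) (l : C) :
  clim u l -> exists K, 0 <= K /\ forall n, Cmod (u n) <= K.
Proof.
  intros H. destruct (proj1 (clim_eps u l) H 1) as [N HN]; [lra|].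
  assert (HS : 0 <= rsum (fun k => Cmod (u k)) N)
    by (apply rsum_nonneg; intros; apply Cmod_ge_0).
  exists (Cmod l + 1 + rsum (fun k => Cmod (u k)) N). split.
  { generalize (Cmod_ge_0 l); lra. }
  intros n. destruct (Nat.le_gt_cases N n) as [Hn|Hn].
  - specialize (HN n Hn). generalize (Cmod_le_minus (u n) l). lra.
  - apply Rle_trans with (rsum (fun k => Cmod (u k)) N).
    + apply (rsum_term_le (fun k => Cmod (u k))); auto. intros; apply Cmod_ge_0.
    + generalize (Cmod_ge_0 l); lra.
Qed.

(** Partial sums of a convergent series are bounded, and each term is a difference of two of
    them. *)
Lemma pseries_coef_bound (a : nat -> C) (s : R) (l : C) :
  0 <= s -> pseries a s l -> exists K, 0 <= K /\ forall k, Cmod (a k) * s ^ k <= K.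
Proof.
  intros Hs H. destruct (clim_bounded _ _ H) as [K [HK0 HK]].
  exists (K + K). split; [lra|]. intros k.
  replace (Cmod (a k) * s ^ k) with (Cmod (a k * s ^ k)).
  2:{ rewrite Cmod_mult, Cmod_pow, Cmod_R, Rabs_pos_eq; auto. }
  replace (a k * s ^ k)%C with
    (csum (fun j => a j * s ^ j)%C (S k) - csum (fun j => a j * s ^ j)%C k)%C
    by (simpl; ring).
  apply Rle_trans with (1 := Cmod_minus_le _ _).
  apply Rplus_le_compat; apply HK.
Qed.

Lemma ex_series_coef_bound (a : nat -> C) (s K r : R) (p : nat) :
  (forall k, Cmod (a k) * s ^ k <= K) -> 0 <= r < s ->
  ex_series (fun k => (INR k + 1) ^ p * Cmod (a k) * r ^ k).
Proof.
  intros HK [Hr Hs].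
  apply (ex_series_le (V := R_CompleteNormedModule)) with
    (fun k => K * ((INR k + 1) ^ p * (r / s) ^ k)).
  - intros k.
    assert (Hp : 0 <= (INR k + 1) ^ p) by (apply pow_le; generalize (pos_INR k); lra).
    assert (Hrk : 0 <= r ^ k) by now apply pow_le.
    unfold norm; simpl; unfold abs; simpl. rewrite Rabs_pos_eq.
    2:{ repeat apply Rmult_le_pos; auto. apply Cmod_ge_0. }
    unfold Rdiv. rewrite Rpow_mult_distr, pow_inv.
    assert (Hsk : 0 < s ^ k) by (apply pow_lt; lra).
    apply Rle_trans with ((INR k + 1) ^ p * (Cmod (a k) * s ^ k) * (r ^ k * / s ^ k)).
    + right. field. lra.
    + rewrite <- Rmult_assoc, <- (Rmult_assoc K), (Rmult_comm K), !Rmult_assoc.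
      apply Rmult_le_compat_l; auto. rewrite <- Rmult_assoc.
      apply Rmult_le_compat_r; auto. apply Rmult_le_pos; auto.
      apply Rlt_le, Rinv_0_lt_compat; auto.
  - apply (ex_series_scal (K := R_AbsRing) (V := R_NormedModule) K). apply ex_series_poly_geom.
    split.
    + apply Rmult_le_pos; auto. apply Rlt_le, Rinv_0_lt_compat. lra.
    + apply Rmult_lt_reg_r with s; [lra|]. unfold Rdiv.
      rewrite Rmult_assoc, Rinv_l; lra.
Qed.

Lemma pseries_of_coef_bound (a : nat -> C) (s K : R) (z : C) :
  (forall k, Cmod (a k) * s ^ k <= K) -> Cmod z < s -> exists l, pseries a z l.
Proof.
  intros HK Hz. apply csum_abs_cv.
  apply ex_series_ext with (fun k => (INR k + 1) ^ 0 * Cmod (a k) * Cmod z ^ k).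
  - intros k. rewrite Cmod_mult, Cmod_pow. simpl; ring.
  - apply ex_series_coef_bound with (1 := HK). split; auto. apply Cmod_ge_0.
Qed.

(** The second-order remainder of [z ^ k] on the disk of radius [r]. The factor [r ^ 2] stands on
    the left so that no exponent [k - 2] occurs, which would be wrong for small [k] with truncated
    subtraction. *)
Lemma Cpow_remainder (z h : C) (r : R) k :
  0 <= r -> Cmod z <= r -> Cmod (z + h) <= r ->
  r ^ 2 * Cmod ((z + h) ^ k - z ^ k - INR k * z ^ pred k * h)
  <= INR k ^ 2 * r ^ k * Cmod h ^ 2.
Proof.
  intros Hr Hz Hzh. induction k as [|k IH].
  - replace ((z + h) ^ 0 - z ^ 0 - INR 0 * z ^ pred 0 * h)%C with (RtoC 0)
      by (simpl; ring).
    rewrite Cmod_0. simpl. lra.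
  - replace ((z + h) ^ S k - z ^ S k - INR (S k) * z ^ pred (S k) * h)%C with
      ((z + h) * ((z + h) ^ k - z ^ k - INR k * z ^ pred k * h)
       + INR k * z ^ pred k * (h * h))%C.
    2:{ rewrite S_INR, RtoC_plus. destruct k as [|k].
        - simpl. ring.
        - simpl pred. rewrite !Cpow_S. ring. }
    apply Rle_trans with (r ^ 2 * (Cmod (z + h) * Cmod ((z + h) ^ k - z ^ k - INR k * z ^ pred k * h)
       + INR k * Cmod z ^ pred k * Cmod h ^ 2)).
    { apply Rmult_le_compat_l; [apply pow2_ge_0|].
      apply Rle_trans with (1 := Cmod_triangle _ _).
      rewrite !Cmod_mult, Cmod_pow, Cmod_R, (Rabs_pos_eq (INR k)) by apply pos_INR.
      right; ring. }
    rewrite Rmult_plus_distr_l.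
    set (e := Cmod ((z + h) ^ k - z ^ k - INR k * z ^ pred k * h)) in *.
    assert (He : 0 <= e) by apply Cmod_ge_0.
    assert (H1 : r ^ 2 * (Cmod (z + h) * e) <= r * (INR k ^ 2 * r ^ k * Cmod h ^ 2)).
    { replace (r ^ 2 * (Cmod (z + h) * e)) with (Cmod (z + h) * (r ^ 2 * e)) by ring.
      apply Rmult_le_compat; auto; [apply Cmod_ge_0|].
      apply Rmult_le_pos; auto. apply pow2_ge_0. }
    assert (H2 : r ^ 2 * (INR k * Cmod z ^ pred k * Cmod h ^ 2)
                 <= INR k * r ^ S k * Cmod h ^ 2).
    { destruct k as [|k]; [simpl; lra|].
      replace (INR (S k) * r ^ S (S k) * Cmod h ^ 2) with
        (r ^ 2 * (INR (S k) * r ^ k * Cmod h ^ 2)) by (simpl; ring).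
      apply Rmult_le_compat_l; [apply pow2_ge_0|].
      apply Rmult_le_compat_r; [apply pow2_ge_0|].
      apply Rmult_le_compat_l; [apply pos_INR|]. simpl pred.
      apply pow_incr. split; auto. apply Cmod_ge_0. }
    apply Rle_trans with (1 := Rplus_le_compat _ _ _ _ H1 H2).
    rewrite S_INR.
    assert (H3 : 0 <= r ^ S k * Cmod h ^ 2).
    { apply Rmult_le_pos; [now apply pow_le|apply pow2_ge_0]. }
    generalize (pos_INR k); intros Hk. simpl in *. nra.
Qed.

Definition dcoef (a : nat -> C) (k : nat) : C := (INR (S k) * a (S k))%C.

Lemma pseries_cderiv (a : nat -> C) (R0 : R) (f g : C -> C) :
  (forall z, ballC R0 z -> pseries a z (f z)) ->
  (forall z, ballC R0 z -> pseries (dcoef a) z (g z)) ->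
  forall z, ballC R0 z -> cderiv f z (g z).
Proof.
  intros Hf Hg z Hz eps He. unfold ballC in *.
  (* Two intermediate radii: convergence at [s] bounds the coefficients, and on the smaller disk of
     radius [r], which must contain [z + h], the second-order remainders are summable. *)
  set (s := (Cmod z + R0) / 2). set (r := (Cmod z + s) / 2).
  assert (Hz0 := Cmod_ge_0 z).
  assert (Hr : Cmod z < r < s) by (unfold r, s; lra).
  assert (Hs : s < R0) by (unfold s; lra).
  destruct (pseries_coef_bound a s (f s)) as [K [HK0 HK]]; [lra| |].
  { apply Hf. rewrite Cmod_R, Rabs_pos_eq; lra. }
  assert (HS := ex_series_coef_bound a s K r 2 HK).
  assert (HS' : ex_series (fun k => (INR k + 1) ^ 2 * Cmod (a k) * r ^ k))
    by (apply HS; lra).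
  set (S0 := Series (fun k => (INR k + 1) ^ 2 * Cmod (a k) * r ^ k)) in *.
  assert (Hpos : forall k, 0 <= (INR k + 1) ^ 2 * Cmod (a k) * r ^ k).
  { intros k. apply Rmult_le_pos; [apply Rmult_le_pos|apply pow_le; lra].
    - apply pow2_ge_0.
    - apply Cmod_ge_0. }
  assert (HS0 : 0 <= S0) by now apply Series_nonneg.
  assert (Hr2 : 0 < r ^ 2) by (apply pow_lt; lra).
  exists (Rmin (r - Cmod z) (eps * r ^ 2 / (S0 + 1))). split.
  { apply Rmin_pos; [lra|]. apply Rdiv_lt_0_compat; [|lra]. now apply Rmult_lt_0_compat. }
  intros h Hh.
  assert (Hh1 : Cmod h < r - Cmod z) by (apply Rlt_le_trans with (1 := Hh), Rmin_l).
  assert (Hh2 : Cmod h < eps * r ^ 2 / (S0 + 1))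
    by (apply Rlt_le_trans with (1 := Hh), Rmin_r).
  assert (Hzh : Cmod (z + h) < r) by (generalize (Cmod_triangle z h); lra).
  assert (Hlim : clim (fun n => csum (fun k =>
     a k * ((z + h) ^ k - z ^ k - INR k * z ^ pred k * h))%C (S n))
     (f (z + h)%C - f z - g z * h)%C).
  { apply clim_ext with (fun n => csum (fun k => a k * (z + h) ^ k)%C (S n)
      - csum (fun k => a k * z ^ k)%C (S n)
      - h * csum (fun k => dcoef a k * z ^ k)%C n)%C.
    - intros n.
      (* [dcoef] lowers the index by one, so [n] terms of the derived series match [n + 1] terms of
         the original; the extra term of index 0 is zero. *)
      replace (csum (fun k => dcoef a k * z ^ k)%C n) with
        (csum (fun k => INR k * a k * z ^ pred k)%C (S n)).
      + rewrite <- csum_scal, <- !csum_minus. apply csum_ext. intros k _. ring.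
      + rewrite csum_shift. unfold dcoef. simpl pred. simpl (INR 0). ring.
    - replace (g z * h)%C with (h * g z)%C by ring.
      apply clim_minus; [apply clim_minus|apply clim_scal].
      + apply (proj1 (clim_shift (csum (fun k => a k * (z + h) ^ k)%C) _)).
        apply Hf. lra.
      + apply (proj1 (clim_shift (csum (fun k => a k * z ^ k)%C) _)).
        apply Hf. lra.
      + apply Hg. lra. }
  assert (Hb : Cmod (f (z + h)%C - f z - g z * h) <= Cmod h ^ 2 / r ^ 2 * S0).
  { apply clim_bound with (1 := Hlim). intros n.
    apply Rle_trans with (1 := Cmod_csum_le _ _).
    apply Rle_trans with
      (Cmod h ^ 2 / r ^ 2 * rsum (fun k => (INR k + 1) ^ 2 * Cmod (a k) * r ^ k) (S n)).
    - rewrite <- rsum_scal. apply rsum_le. intros k _. rewrite Cmod_mult.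
      assert (HE := Cpow_remainder z h r k).
      apply Rmult_le_reg_l with (r ^ 2); auto.
      replace (r ^ 2 * (Cmod h ^ 2 / r ^ 2 * ((INR k + 1) ^ 2 * Cmod (a k) * r ^ k)))
        with (Cmod (a k) * ((INR k + 1) ^ 2 * r ^ k * Cmod h ^ 2)) by (field; lra).
      rewrite (Rmult_comm (Cmod (a k))), <- Rmult_assoc, (Rmult_comm _ (Cmod (a k))).
      apply Rmult_le_compat_l; [apply Cmod_ge_0|].
      apply Rle_trans with (INR k ^ 2 * r ^ k * Cmod h ^ 2).
      + apply HE; lra.
      + apply Rmult_le_compat_r; [apply pow2_ge_0|].
        apply Rmult_le_compat_r; [apply pow_le; lra|].
        apply pow_incr. generalize (pos_INR k); lra.
    - apply Rmult_le_compat_l.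
      + apply Rmult_le_pos; [apply pow2_ge_0|]. apply Rlt_le, Rinv_0_lt_compat; auto.
      + now apply rsum_le_Series. }
  apply Rle_trans with (1 := Hb).
  replace (Cmod h ^ 2 / r ^ 2 * S0) with (Cmod h * S0 / r ^ 2 * Cmod h) by (field; lra).
  apply Rmult_le_compat_r; [apply Cmod_ge_0|].
  apply Rmult_le_reg_r with (r ^ 2); auto.
  unfold Rdiv. rewrite Rmult_assoc, Rinv_l, Rmult_1_r by lra.
  apply Rmult_lt_compat_r with (r := S0 + 1) in Hh2; [|lra].
  unfold Rdiv in Hh2. rewrite Rmult_assoc, Rinv_l, Rmult_1_r in Hh2 by lra.
  generalize (Cmod_ge_0 h). nra.
Qed.

Lemma pseries_dcoef (a : nat -> C) (R0 : R) (f : C -> C) :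
  (forall z, ballC R0 z -> pseries a z (f z)) ->
  exists g, forall z, ballC R0 z -> pseries (dcoef a) z (g z).
Proof.
  intros Hf.
  exists (fun z => epsilon (inhabits (RtoC 0)) (pseries (dcoef a) z)).
  intros z Hz. apply epsilon_spec. unfold ballC in *.
  set (s := (Cmod z + R0) / 2). set (r := (Cmod z + s) / 2).
  assert (Hz0 := Cmod_ge_0 z).
  assert (Hr : Cmod z < r < s) by (unfold r, s; lra).
  assert (Hs : s < R0) by (unfold s; lra).
  destruct (pseries_coef_bound a s (f s)) as [K [HK0 HK]]; [lra| |].
  { apply Hf. rewrite Cmod_R, Rabs_pos_eq; lra. }
  assert (HS : ex_series (fun k => (INR k + 1) ^ 1 * Cmod (a k) * r ^ k)).
  { apply (ex_series_coef_bound a s K r 1 HK). lra. }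
  assert (Hpos : forall k, 0 <= (INR k + 1) ^ 1 * Cmod (a k) * r ^ k).
  { intros k. apply Rmult_le_pos; [|apply pow_le; lra].
    apply Rmult_le_pos; [|apply Cmod_ge_0]. generalize (pos_INR k); lra. }
  apply pseries_of_coef_bound with r
    (Series (fun k => (INR k + 1) ^ 1 * Cmod (a k) * r ^ k) / r); [|lra].
  intros k. apply Rmult_le_reg_r with r; [lra|].
  unfold Rdiv. rewrite (Rmult_assoc (Series _)), Rinv_l, Rmult_1_r by lra.
  apply Rle_trans with (2 := rsum_le_Series _ (S (S k)) Hpos HS).
  apply Rle_trans with (2 := rsum_term_le _ (S k) (S (S k)) Hpos (Nat.lt_succ_diag_r _)).
  unfold dcoef. rewrite Cmod_mult, Cmod_R, Rabs_pos_eq by apply pos_INR.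
  replace (INR (S k) * Cmod (a (S k)) * r ^ k * r) with
    (INR (S k) * (Cmod (a (S k)) * r ^ S k)) by (simpl; ring).
  rewrite pow_1, Rmult_assoc. apply Rmult_le_compat_r; [|lra].
  apply Rmult_le_pos; [apply Cmod_ge_0|apply pow_le; lra].
Qed.

Lemma pseries_holo (a : nat -> C) (R0 : R) (f : C -> C) :
  (forall z, ballC R0 z -> pseries a z (f z)) -> holo (ballC R0) f.
Proof.
  intros Hf. destruct (pseries_dcoef a R0 f Hf) as [g Hg].
  destruct (pseries_dcoef _ R0 g Hg) as [g' Hg'].
  exists g. intros z Hz. split.
  - now apply (pseries_cderiv a R0 f g).
  - apply cderiv_continuous with (g' z). now apply (pseries_cderiv (dcoef a) R0 g g').
Qed.

Lemma pseries_at_0 (a : nat -> C) : pseries a 0 (a O).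
Proof.
  apply clim_shift. apply clim_ext with (fun _ => a O).
  - intros n. rewrite csum_shift.
    rewrite (csum_ext _ (fun _ => 0 * 0)%C), csum_scal.
    + simpl; ring.
    + intros k _. simpl. ring.
  - apply clim_const.
Qed.

Lemma pseries_tail (a : nat -> C) (z l : C) :
  z <> 0 -> pseries a z l -> pseries (fun k => a (S k)) z ((l - a O) / z).
Proof.
  intros Hz H. apply (proj1 (clim_shift _ _)) in H.
  replace ((l - a O) / z)%C with (/ z * (l - a O))%C by (field; auto).
  apply clim_ext with (fun n => / z * (csum (fun k => a k * z ^ k)%C (S n) - a O))%C.
  - intros n. rewrite csum_shift.
    rewrite (csum_ext (fun k => a (S k) * z ^ S k)%C (fun k => z * (a (S k) * z ^ k))%C), csum_scal.
    + simpl. field. auto.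
    + intros k _. simpl; ring.
  - apply clim_scal, clim_minus; [exact H|apply clim_const].
Qed.

Lemma pseries_zeros_0 (R0 : R) (a : nat -> C) (f : C -> C) :
  0 < R0 -> (forall z, ballC R0 z -> pseries a z (f z)) ->
  (forall d, 0 < d -> exists z, 0 < Cmod z < d /\ f z = 0) -> a O = 0.
Proof.
  intros HR Hf Hz.
  assert (Hf0 : f 0 = a O).
  { apply (clim_unique (csum (fun k => a k * 0 ^ k)%C)).
    - apply Hf. unfold ballC. now rewrite Cmod_0.
    - apply pseries_at_0. }
  assert (Hc : contC f (RtoC 0)).
  { apply (holo_continuous (ballC R0)).
    - now apply pseries_holo with a.
    - unfold ballC. now rewrite Cmod_0. }
  rewrite <- Hf0. apply Cmod_eq_0. apply Rle_antisym; [|apply Cmod_ge_0].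
  apply le_epsilon. intros eps He. rewrite Rplus_0_l.
  destruct (proj1 (continuous_C_eps f 0) Hc eps He) as [d [Hd H]].
  destruct (Hz d Hd) as [z [[_ Hzd] Hfz]].
  specialize (H z). rewrite Hfz in H.
  replace (z - 0)%C with z in H by ring.
  replace (0 - f 0)%C with (- f 0)%C in H by ring.
  rewrite Cmod_opp in H. apply Rlt_le. now apply H.
Qed.

(** When zeros accumulate at 0, continuity kills the constant coefficient. Then [f z / z] has the
    shifted series and the same nonzero zeros, so the argument repeats for each coefficient. *)
Lemma pseries_zeros (R0 : R) (k : nat) : 0 < R0 -> forall (a : nat -> C) (f : C -> C),
  (forall z, ballC R0 z -> pseries a z (f z)) ->
  (forall d, 0 < d -> exists z, 0 < Cmod z < d /\ f z = 0) -> a k = 0.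
Proof.
  intros HR. induction k as [|k IH]; intros a f Hf Hz.
  - now apply (pseries_zeros_0 R0 a f).
  - assert (H0 : a O = 0) by now apply (pseries_zeros_0 R0 a f).
    (* The removable singularity at 0 is filled with the constant coefficient of the shifted
       series. *)
    set (f1 := fun z => if excluded_middle_informative (z = RtoC 0) then a 1%nat
                        else ((f z - a O) / z)%C).
    apply (IH (fun k => a (S k)) f1).
    + intros z Hzb. unfold f1. destruct (excluded_middle_informative (z = RtoC 0)) as [->|Hz0].
      * apply (pseries_at_0 (fun k => a (S k))).
      * apply pseries_tail; auto.
    + intros d Hd. destruct (Hz d Hd) as [z [Hzd Hfz]]. exists z. split; auto.
      unfold f1. destruct (excluded_middle_informative (z = RtoC 0)) as [->|Hz0].
      * rewrite Cmod_0 in Hzd; lra.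
      * rewrite Hfz, H0. field; auto.
Qed.

Lemma pseries_minus (a b : nat -> C) (z l m : C) :
  pseries a z l -> pseries b z m -> pseries (fun k => a k - b k)%C z (l - m).
Proof.
  intros Ha Hb.
  apply clim_ext with (fun n => csum (fun k => a k * z ^ k)%C n - csum (fun k => b k * z ^ k)%C n)%C.
  - intros n. rewrite <- csum_minus. apply csum_ext. intros; ring.
  - now apply clim_minus.
Qed.

Lemma pseries_coef_unique (R0 : R) (a b : nat -> C) (f : C -> C) :
  0 < R0 ->
  (forall z, ballC R0 z -> pseries a z (f z)) ->
  (forall z, ballC R0 z -> pseries b z (f z)) -> forall k, a k = b k.
Proof.
  intros HR Ha Hb k. apply Cminus_eq_0.
  rewrite (pseries_zeros R0 k HR (fun k => a k - b k)%C (fun z => f z - f z)%C).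
  - apply Cmod_0.
  - intros z Hz. apply pseries_minus; auto.
  - intros d Hd. exists (RtoC (d / 2)). split; [|ring].
    rewrite Cmod_R, Rabs_pos_eq; lra.
Qed.

(** * Means over the circle *)

Definition cis (t : R) : C := (cos t, sin t).

Lemma Cmod_cis (t : R) : Cmod (cis t) = 1.
Proof.
  unfold Cmod, cis; simpl fst; simpl snd. rewrite <- sqrt_1 at 1. f_equal.
  generalize (sin2_cos2 t). unfold Rsqr. simpl. lra.
Qed.

Lemma cis_conj (t : R) : (cis t * Cconj (cis t))%C = 1.
Proof. rewrite <- Cmod2_conj, Cmod_cis. f_equal. ring. Qed.

Lemma cis_neq_0 (t : R) : cis t <> 0.
Proof. apply Cmod_gt_0. rewrite Cmod_cis. lra. Qed.

Lemma cis_0 : cis 0 = 1.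
Proof. unfold cis. now rewrite cos_0, sin_0. Qed.

Lemma cis_2PI : cis (2 * PI) = 1.
Proof. unfold cis. now rewrite cos_2PI, sin_2PI. Qed.

Definition ccont (h : R -> C) : Prop :=
  forall t, continuous (T := R_UniformSpace) (U := C_UniformSpace) h t.

Lemma ccont_cis : ccont cis.
Proof.
  intros t. apply continuous_pair_C; [apply continuous_cos|apply continuous_sin].
Qed.

Lemma ccont_const (c : C) : ccont (fun _ => c).
Proof. intros t. apply continuous_const. Qed.

Lemma ccont_plus (f g : R -> C) : ccont f -> ccont g -> ccont (fun t => f t + g t)%C.
Proof. intros Hf Hg t. now apply continuous_Cplus. Qed.

Lemma ccont_minus (f g : R -> C) : ccont f -> ccont g -> ccont (fun t => f t - g t)%C.
Proof. intros Hf Hg t. now apply continuous_Cminus. Qed.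

Lemma ccont_mult (f g : R -> C) : ccont f -> ccont g -> ccont (fun t => f t * g t)%C.
Proof. intros Hf Hg t. now apply continuous_Cmult. Qed.

Lemma ccont_conj (f : R -> C) : ccont f -> ccont (fun t => Cconj (f t)).
Proof. intros Hf t. now apply continuous_Cconj. Qed.

Lemma ccont_pow (f : R -> C) n : ccont f -> ccont (fun t => f t ^ n)%C.
Proof. intros Hf t. now apply continuous_Cpow. Qed.

Lemma ccont_inv (f : R -> C) : ccont f -> (forall t, f t <> 0) -> ccont (fun t => / f t)%C.
Proof. intros Hf H t. now apply continuous_Cinv. Qed.

Lemma ccont_csum (f : nat -> R -> C) n :
  (forall k, ccont (f k)) -> ccont (fun t => csum (fun k => f k t) n).
Proof.
  intros Hf. induction n as [|n IH]; simpl; [apply ccont_const|now apply ccont_plus].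
Qed.

Ltac ccont_tac :=
  repeat match goal with
  | H : ccont ?f |- ccont ?f => exact H
  | H : ccont ?f |- ccont (fun t => ?f t) => exact H
  | |- ccont cis => exact ccont_cis
  | |- ccont (fun t => cis t) => exact ccont_cis
  | |- ccont (fun _ => ?c) => exact (ccont_const c)
  | |- ccont (fun t => (@?f t * @?g t)%C) => apply (ccont_mult f g)
  | |- ccont (fun t => (@?f t + @?g t)%C) => apply (ccont_plus f g)
  | |- ccont (fun t => (@?f t - @?g t)%C) => apply (ccont_minus f g)
  | |- ccont (fun t => (@?f t ^ ?n)%C) => apply (ccont_pow f n)
  | |- ccont (fun t => Cconj (@?f t)) => apply (ccont_conj f)
  end.

Lemma ccont_comp (U : C -> Prop) (f : C -> C) (g : R -> C) :
  holo U f -> ccont g -> (forall t, U (g t)) -> ccont (fun t => f (g t)).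
Proof.
  intros Hf Hg HU t.
  apply (continuous_comp (V := C_UniformSpace) (W := C_UniformSpace) g f); auto.
  now apply (holo_continuous U).
Qed.

Definition cmean (h : R -> C) : C :=
  (RInt (fun t => Re (h t)) 0 (2 * PI) / (2 * PI),
   RInt (fun t => Im (h t)) 0 (2 * PI) / (2 * PI)).

Lemma ex_RInt_Re (h : R -> C) a b : ccont h -> ex_RInt (fun t => Re (h t)) a b.
Proof.
  intros Hh. apply (ex_RInt_continuous (V := R_CompleteNormedModule)).
  intros t _. now apply continuous_Re.
Qed.

Lemma ex_RInt_Im (h : R -> C) a b : ccont h -> ex_RInt (fun t => Im (h t)) a b.
Proof.
  intros Hh. apply (ex_RInt_continuous (V := R_CompleteNormedModule)).
  intros t _. now apply continuous_Im.
Qed.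

Lemma RInt_R_lin (u v : R -> R) (p q a b : R) :
  ex_RInt u a b -> ex_RInt v a b ->
  RInt (fun t => p * u t + q * v t) a b = p * RInt u a b + q * RInt v a b.
Proof.
  intros Hu Hv. apply is_RInt_unique.
  apply (is_RInt_plus (V := R_NormedModule) (fun t => p * u t) (fun t => q * v t)).
  - apply (is_RInt_scal (V := R_NormedModule) u). now apply (RInt_correct u).
  - apply (is_RInt_scal (V := R_NormedModule) v). now apply (RInt_correct v).
Qed.

Lemma two_PI_pos : 0 < 2 * PI.
Proof. generalize PI_RGT_0; lra. Qed.

Lemma cmean_ext (f g : R -> C) :
  (forall t, 0 <= t <= 2 * PI -> f t = g t) -> cmean f = cmean g.
Proof.
  intros H. assert (HP := two_PI_pos).
  unfold cmean. f_equal; f_equal; apply RInt_ext; intros t Ht; rewrite H; auto;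
    rewrite Rmin_left, Rmax_right in Ht; lra.
Qed.

Lemma cmean_plus (f g : R -> C) : ccont f -> ccont g ->
  cmean (fun t => f t + g t)%C = (cmean f + cmean g)%C.
Proof.
  intros Hf Hg. assert (HP := two_PI_pos). unfold cmean, Cplus; simpl fst; simpl snd.
  f_equal.
  - rewrite <- (Rmult_1_l (RInt (fun t => Re (f t)) _ _)),
      <- (Rmult_1_l (RInt (fun t => Re (g t)) _ _)).
    rewrite <- Rdiv_plus_distr, <- RInt_R_lin; auto using ex_RInt_Re.
    f_equal. apply RInt_ext. intros t _. unfold Re; simpl. ring.
  - rewrite <- (Rmult_1_l (RInt (fun t => Im (f t)) _ _)),
      <- (Rmult_1_l (RInt (fun t => Im (g t)) _ _)).
    rewrite <- Rdiv_plus_distr, <- RInt_R_lin; auto using ex_RInt_Im.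
    f_equal. apply RInt_ext. intros t _. unfold Im; simpl. ring.
Qed.

Lemma cmean_scal (c : C) (f : R -> C) : ccont f ->
  cmean (fun t => c * f t)%C = (c * cmean f)%C.
Proof.
  intros Hf. assert (HP := two_PI_pos). unfold cmean, Cmult; simpl fst; simpl snd.
  f_equal.
  - rewrite (RInt_ext _ (fun t => fst c * Re (f t) + (- snd c) * Im (f t))).
    + rewrite RInt_R_lin; auto using ex_RInt_Re, ex_RInt_Im. field. lra.
    + intros t _. unfold Re, Im; simpl. ring.
  - rewrite (RInt_ext _ (fun t => fst c * Im (f t) + snd c * Re (f t))).
    + rewrite RInt_R_lin; auto using ex_RInt_Re, ex_RInt_Im. field. lra.
    + intros t _. unfold Re, Im; simpl. ring.
Qed.

Lemma cmean_minus (f g : R -> C) : ccont f -> ccont g ->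
  cmean (fun t => f t - g t)%C = (cmean f - cmean g)%C.
Proof.
  intros Hf Hg.
  rewrite (cmean_ext _ (fun t => f t + (- (1)) * g t)%C) by (intros; ring).
  rewrite cmean_plus, cmean_scal; auto; [ring|].
  apply ccont_mult; auto. apply ccont_const.
Qed.

Lemma cmean_conj (f : R -> C) : ccont f -> cmean (fun t => Cconj (f t)) = Cconj (cmean f).
Proof.
  intros Hf. assert (HP := two_PI_pos). unfold cmean, Cconj; simpl fst; simpl snd.
  f_equal.
  rewrite (RInt_ext _ (fun t => (-1) * Im (f t) + 0 * Im (f t))).
  - rewrite RInt_R_lin; auto using ex_RInt_Im. field. lra.
  - intros t _. unfold Im; simpl. ring.
Qed.

Lemma cmean_const (c : C) : cmean (fun _ => c) = c.
Proof.
  assert (HP := two_PI_pos). unfold cmean. rewrite !RInt_const.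
  destruct c as [x y]. unfold scal; simpl; unfold mult; simpl. f_equal; field; lra.
Qed.

Lemma cmean_csum (f : nat -> R -> C) n : (forall k, ccont (f k)) ->
  cmean (fun t => csum (fun k => f k t) n) = csum (fun k => cmean (f k)) n.
Proof.
  intros Hf. induction n as [|n IH]; simpl; [apply cmean_const|].
  rewrite cmean_plus, IH; auto. now apply ccont_csum.
Qed.

Lemma cmean_bound (f : R -> C) (B : R) : ccont f ->
  (forall t, 0 <= t <= 2 * PI -> Cmod (f t) <= B) -> Cmod (cmean f) <= B.
Proof.
  intros Hf HB. assert (HP := two_PI_pos).
  assert (HB0 : 0 <= B).
  { apply Rle_trans with (Cmod (f 0)); [apply Cmod_ge_0|]. apply HB; lra. }
  set (m := cmean f).
  destruct (Req_dec (Cmod m) 0) as [->|Hm]; auto.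
  assert (Hm0 : 0 < Cmod m) by (generalize (Cmod_ge_0 m); lra).
  apply Rmult_le_reg_l with (Cmod m); auto.
  (* Multiplying by the conjugate of the mean [m] turns it into the real number [|m|^2], so the
     estimate reduces to monotonicity of a real integral and no factor is lost by treating
     components separately. *)
  assert (Hc : ccont (fun t => Cconj m * f t)%C) by (apply ccont_mult; auto using ccont_const).
  replace (Cmod m * Cmod m) with (Re (cmean (fun t => Cconj m * f t)%C)).
  2:{ rewrite cmean_scal by auto. fold m.
      replace (Cconj m * m)%C with (m * Cconj m)%C by ring.
      rewrite <- Cmod2_conj. simpl. ring. }
  change (RInt (fun t => Re (Cconj m * f t)) 0 (2 * PI) / (2 * PI) <= Cmod m * B).
  apply Rmult_le_reg_r with (2 * PI); auto.
  unfold Rdiv. rewrite (Rmult_assoc (RInt _ _ _)), Rinv_l, Rmult_1_r by lra.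
  apply Rle_trans with (RInt (fun _ => Cmod m * B) 0 (2 * PI)).
  - apply RInt_le; [lra|now apply (ex_RInt_Re (fun t => Cconj m * f t)%C)|apply ex_RInt_const|].
    intros t Ht. apply Rle_trans with (1 := Rle_abs _).
    apply Rle_trans with (1 := re_le_Cmod _). rewrite Cmod_mult, Cmod_conj.
    apply Rmult_le_compat_l; [apply Cmod_ge_0|]. apply HB; lra.
  - rewrite RInt_const. unfold scal; simpl; unfold mult; simpl. lra.
Qed.

Lemma ccont_bounded (f : R -> C) (b : R) : 0 <= b -> ccont f ->
  exists B, forall t, 0 <= t <= b -> Cmod (f t) <= B.
Proof.
  intros Hb Hf.
  destruct (continuity_ab_maj (fun t => Cmod (f t)) 0 b Hb) as [m [Hm _]].
  - intros t _. apply continuity_pt_filterlim.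
    assert (H := proj1 (continuous_Cmod_iff f t) (Hf t)).
    intros P [e He]. apply (filter_imp (F := locally t)) with (2 := H e (cond_pos e)).
    intros y Hy. apply He. change (Rabs (Cmod (f y) - Cmod (f t)) < e).
    apply Rle_lt_trans with (2 := Hy). apply Rabs_le_between.
    generalize (Cmod_le_minus (f t) (f y)) (Cmod_le_minus (f y) (f t)).
    rewrite (Cmod_minus_sym (f t)). lra.
  - exists (Cmod (f m)). exact Hm.
Qed.

(** * Derivatives of curves and of means depending on a parameter *)

Definition rderiv (g : R -> C) (t : R) (v : C) : Prop :=
  cderiv_within (fun h => Im h = 0) (fun z => g (Re z)) t v.

Lemma rderiv_iff (g : R -> C) (t : R) (v : C) :
  rderiv g t v <-> forall eps, 0 < eps -> exists r, 0 < r /\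
    forall h : R, Rabs h < r -> Cmod (g (t + h) - g t - v * h) <= eps * Rabs h.
Proof.
  split; intros H eps He; destruct (H eps He) as [r [Hr Hh]]; exists r; split; auto.
  - intros h Hl. specialize (Hh (RtoC h)). rewrite Cmod_R in Hh.
    now apply Hh.
  - intros [h k] Hk Hl. unfold Im in Hk; simpl in Hk. subst k.
    change (h, 0) with (RtoC h) in *. rewrite Cmod_R in *. now apply (Hh h).
Qed.

Lemma rderiv_comp (f : C -> C) (g : R -> C) (t : R) (d v : C) :
  cderiv f (g t) d -> rderiv g t v -> rderiv (fun t => f (g t)) t (d * v).
Proof. intros Hf Hg. now apply cderiv_within_comp with (f := f). Qed.

Lemma rderiv_pair (u v : R -> R) (t a b : R) :
  is_derive u t a -> is_derive v t b -> rderiv (fun s => (u s, v s)) t (a, b).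
Proof.
  intros Hu Hv. apply rderiv_iff. intros eps He.
  apply is_derive_Reals in Hu, Hv.
  destruct (Hu (eps / 2)) as [r Hr]; [lra|].
  destruct (Hv (eps / 2)) as [s Hs]; [lra|].
  exists (Rmin r s). split; [apply Rmin_pos; apply cond_pos|].
  intros h Hh.
  destruct (Req_dec h 0) as [->|H0].
  { rewrite Rplus_0_r. rewrite Rabs_R0, Rmult_0_r.
    replace (_ - _ - _)%C with (RtoC 0) by ring. rewrite Cmod_0; lra. }
  specialize (Hr h H0 (Rlt_le_trans _ _ _ Hh (Rmin_l _ _))).
  specialize (Hs h H0 (Rlt_le_trans _ _ _ Hh (Rmin_r _ _))).
  apply Rle_trans with (1 := Cmod_le_re_im _).
  assert (Hh0 : 0 < Rabs h) by now apply Rabs_pos_lt.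
  assert (E : forall x y, x = y * h -> Rabs y < eps / 2 -> Rabs x <= eps / 2 * Rabs h).
  { intros x y -> Hy. rewrite Rabs_mult. apply Rmult_le_compat_r; lra. }
  apply E with (x := Re ((u (t + h), v (t + h)) - (u t, v t) - (a, b) * h)) in Hr.
  2:{ unfold Re; simpl. field; auto. }
  apply E with (x := Im ((u (t + h), v (t + h)) - (u t, v t) - (a, b) * h)) in Hs.
  2:{ unfold Im; simpl. field; auto. }
  lra.
Qed.

Lemma rderiv_is_derive (g : R -> C) (t : R) (v : C) :
  rderiv g t v ->
  is_derive (fun s => Re (g s)) t (Re v) /\ is_derive (fun s => Im (g s)) t (Im v).
Proof.
  intros H. rewrite rderiv_iff in H.
  assert (E : forall p : C -> R, (forall a b : C, p (a - b)%C = p a - p b) ->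
     (forall (a : C) (x : R), p (a * x)%C = p a * x) ->
     (forall c, Rabs (p c) <= Cmod c) ->
     is_derive (fun s => p (g s)) t (p v)).
  { intros p Hm Hs Hp. apply is_derive_Reals. intros eps He.
    destruct (H (eps / 2)) as [r [Hr Hh]]; [lra|].
    exists (mkposreal r Hr). simpl. intros h H0 Hl. specialize (Hh h Hl).
    assert (Hh0 : 0 < Rabs h) by now apply Rabs_pos_lt.
    replace ((p (g (t + h)) - p (g t)) / h - p v) with
      (p (g (t + h)%R - g t - v * h)%C / h).
    2:{ rewrite !Hm, Hs. field; auto. }
    unfold Rdiv. rewrite Rabs_mult, Rabs_inv.
    apply Rle_lt_trans with (eps / 2); [|lra].
    apply Rmult_le_reg_r with (Rabs h); auto.
    rewrite Rmult_assoc, Rinv_l, Rmult_1_r by lra.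
    apply Rle_trans with (2 := Hh). apply Hp. }
  split; apply E.
  - apply Re_minus.
  - intros a x. unfold Re; simpl. ring.
  - apply re_le_Cmod.
  - apply Im_minus.
  - intros a x. unfold Im; simpl. ring.
  - apply im_le_Cmod.
Qed.

Lemma rderiv_eq (g : R -> C) (t : R) (v w : C) : rderiv g t v -> v = w -> rderiv g t w.
Proof. now intros H <-. Qed.

Lemma rderiv_cis (t : R) : rderiv cis t (Ci * cis t).
Proof.
  apply rderiv_eq with (- sin t, cos t).
  - apply rderiv_pair; [apply is_derive_cos|apply is_derive_sin].
  - unfold cis, Ci, Cmult; simpl. f_equal; ring.
Qed.

Lemma cmean_rderiv (g g' : R -> C) :
  (forall t, rderiv g t (g' t)) -> ccont g' -> g (2 * PI) = g 0 -> cmean g' = 0.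
Proof.
  intros Hd Hc Hg. unfold cmean.
  assert (E : forall p : C -> R, (forall t, is_derive (fun s => p (g s)) t (p (g' t))) ->
    (forall t, continuous (fun s => p (g' s)) t) ->
    RInt (fun t => p (g' t)) 0 (2 * PI) = 0).
  { intros p H1 H2. apply is_RInt_unique.
    replace 0 with (minus (p (g (2 * PI))) (p (g 0))) at 2.
    - apply (is_RInt_derive (V := R_CompleteNormedModule) (fun s => p (g s)) (fun s => p (g' s))); auto.
    - rewrite Hg. unfold minus, plus, opp; simpl. ring. }
  rewrite (E Re), (E Im).
  - unfold RtoC. f_equal; unfold Rdiv; ring.
  - intros t. now apply rderiv_is_derive.
  - intros t. now apply continuous_Im.
  - intros t. now apply rderiv_is_derive.
  - intros t. now apply continuous_Re.
Qed.

(** Differentiation under the integral sign: the mean of [F u] has the mean of [F' u] as derivative,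
    which is 0. The hypotheses range over all real [u], so the endpoints [a] and [b] need no
    one-sided derivatives. *)
Lemma cmean_param_const (F F' : R -> R -> C) (a b : R) : a < b ->
  (forall u, ccont (F u)) ->
  (forall u t, rderiv (fun v => F v t) u (F' u t)) ->
  (forall u t, continuous (T := prod_UniformSpace R_UniformSpace R_UniformSpace)
     (U := C_UniformSpace) (fun p => F' (fst p) (snd p)) (u, t)) ->
  (forall u, cmean (F' u) = 0) -> cmean (F a) = cmean (F b).
Proof.
  intros Hab Hc Hd Hcd H0. assert (HP := two_PI_pos).
  assert (E : forall p : C -> R,
    (forall u t, is_derive (fun v => p (F v t)) u (p (F' u t))) ->
    (forall u, ex_RInt (fun t => p (F u t)) 0 (2 * PI)) ->
    (forall u t, continuous (T := prod_UniformSpace R_UniformSpace R_UniformSpace)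
      (fun q => p (F' (fst q) (snd q))) (u, t)) ->
    (forall u, RInt (fun t => p (F' u t)) 0 (2 * PI) = 0) ->
    RInt (fun t => p (F a t)) 0 (2 * PI) = RInt (fun t => p (F b t)) 0 (2 * PI)).
  { intros p H1 H2 H3 H4.
    apply (eq_is_derive (V := R_NormedModule) (fun u => RInt (fun t => p (F u t)) 0 (2 * PI))); auto.
    intros u _.
    replace (@zero R_NormedModule) with
      (RInt (fun t => Derive (fun v => p (F v t)) u) 0 (2 * PI)).
    - apply (is_derive_RInt_param (fun u t => p (F u t))).
      + apply filter_forall. intros v t _. now exists (p (F' v t)).
      + intros t _. apply continuity_2d_pt_filterlim.
        apply (filterlim_ext (fun q : R * R => p (F' (fst q) (snd q)))).
        * intros q. symmetry. apply is_derive_unique, H1.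
        * replace (Derive (fun z => p (F z t)) u) with (p (F' u t)).
          -- apply (H3 u t).
          -- symmetry. apply is_derive_unique, H1.
      + apply filter_forall. intros v. apply H2.
    - transitivity (RInt (fun t => p (F' u t)) 0 (2 * PI)); [|apply H4].
      apply RInt_ext. intros t _. apply is_derive_unique, H1. }
  assert (H0' : forall u, RInt (fun t => Re (F' u t)) 0 (2 * PI) = 0
     /\ RInt (fun t => Im (F' u t)) 0 (2 * PI) = 0).
  { intros u. specialize (H0 u). unfold cmean, RtoC in H0. injection H0 as H1 H2.
    split; apply Rmult_eq_reg_r with (/ (2 * PI)); try (rewrite Rmult_0_l; assumption);
      apply Rinv_neq_0_compat; lra. }
  unfold cmean. f_equal; f_equal.
  - apply E.
    + intros u t. now apply (rderiv_is_derive (fun v => F v t)).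
    + intros u. now apply ex_RInt_Re.
    + intros u t. now apply continuous_Re.
    + intros u; exact (proj1 (H0' u)).
  - apply E.
    + intros u t. now apply (rderiv_is_derive (fun v => F v t)).
    + intros u. now apply ex_RInt_Im.
    + intros u t. now apply continuous_Im.
    + intros u; exact (proj2 (H0' u)).
Qed.

(** * Cauchy's formula and Taylor expansions *)

Lemma cderiv_affine (a b z : C) : cderiv (fun y => a + b * y)%C z b.
Proof.
  intros eps He. exists 1. split; [lra|]. intros h _.
  replace (a + b * (z + h) - (a + b * z) - b * h)%C with (RtoC 0) by ring. rewrite Cmod_0.
  apply Rmult_le_pos; [lra|apply Cmod_ge_0].
Qed.

Lemma cderiv_pow (n : nat) (z : C) : cderiv (fun y => y ^ n)%C z (INR n * z ^ pred n).
Proof.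
  induction n as [|n IH].
  - apply cderiv_eq with (RtoC 0); [exact (cderiv_const 1 z)|simpl; ring].
  - apply cderiv_eq with (1 * z ^ n + z * (INR n * z ^ pred n))%C.
    + apply (cderiv_mult (fun y => y)); auto using cderiv_id.
    + rewrite S_INR, RtoC_plus. destruct n as [|n]; simpl; ring.
Qed.

Lemma Ci_neq_0 : Ci <> 0.
Proof. apply Cmod_gt_0. rewrite Cmod_Ci. lra. Qed.

Lemma RtoC_neq_0 (x : R) : x <> 0 -> RtoC x <> 0.
Proof. intros H E. apply H. now apply RtoC_inj in E. Qed.

(** Along the circle, [cis ^ (k + 1)] is its own derivative up to the factor [(k + 1) i], and it
    takes the same value at 0 and [2 PI]. *)
Lemma cmean_cis_pow (k : nat) : cmean (fun t => cis t ^ S k)%C = 0.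
Proof.
  assert (Hk : RtoC (INR (S k)) <> 0) by (apply RtoC_neq_0, not_0_INR; lia).
  assert (Hi := Ci_neq_0).
  rewrite (cmean_ext _ (fun t => / (INR (S k) * Ci) * (INR (S k) * cis t ^ k * (Ci * cis t)))%C).
  2:{ intros t _. rewrite Cpow_S. field; auto. }
  assert (Hc : ccont (fun t => INR (S k) * cis t ^ k * (Ci * cis t))%C).
  { ccont_tac. }
  rewrite cmean_scal by auto.
  rewrite (cmean_rderiv (fun t => cis t ^ S k)%C) with (2 := Hc).
  - ring.
  - intros t. apply (rderiv_comp (fun y => y ^ S k)%C cis); [apply cderiv_pow|apply rderiv_cis].
  - now rewrite cis_2PI, cis_0.
Qed.

Lemma cmean_conj_cis_pow (k : nat) : cmean (fun t => Cconj (cis t) ^ S k)%C = 0.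
Proof.
  rewrite (cmean_ext _ (fun t => Cconj (cis t ^ S k))%C) by (intros; now rewrite Cpow_conj).
  rewrite cmean_conj, cmean_cis_pow by (apply ccont_pow, ccont_cis).
  unfold Cconj, RtoC; simpl. f_equal; ring.
Qed.

Lemma csum_geom (q : C) n : ((1 - q) * csum (fun k => q ^ k) n = 1 - q ^ n)%C.
Proof.
  induction n as [|n IH]; simpl; [ring|].
  rewrite Cmult_plus_distr_l, IH. ring.
Qed.

(** Cauchy's kernel: with [x = r cis t], the form [dx / (2 PI i (x - z))] becomes
    [ckernel r z t dt / (2 PI)]. *)
Definition ckernel (r : R) (z : C) (t : R) : C := (r * cis t / (r * cis t - z))%C.

Lemma circle_minus_neq_0 (r : R) (z : C) (t : R) : Cmod z < r -> (r * cis t - z)%C <> 0.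
Proof.
  intros Hz E. apply (f_equal Cmod) in E. rewrite Cmod_0 in E.
  generalize (Cmod_le_minus (r * cis t) z). rewrite E, Cmod_mult, Cmod_cis, Cmod_R.
  generalize (Rle_abs r). lra.
Qed.

Lemma ccont_circle (r : R) : ccont (fun t => r * cis t)%C.
Proof. apply ccont_mult; [apply ccont_const|apply ccont_cis]. Qed.

Lemma ccont_ckernel (r : R) (z : C) : Cmod z < r -> ccont (ckernel r z).
Proof.
  intros Hz. apply ccont_mult; [apply ccont_circle|].
  apply ccont_inv.
  - apply ccont_minus; auto using ccont_const, ccont_circle.
  - intros t. now apply circle_minus_neq_0.
Qed.

Lemma Cmod_circle (r : R) t : 0 <= r -> Cmod (r * cis t) = r.
Proof. intros Hr. rewrite Cmod_mult, Cmod_cis, Cmod_R, Rabs_pos_eq by auto. ring. Qed.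

(** The kernel is a geometric series in [q t = z / (r cis t)], whose [n]-th remainder [q ^ n] times
    the kernel is uniformly small in [t]. Here [F] is any continuous function: [F = 1] gives the
    mean of the kernel, which Cauchy's formula uses, and boundary values of [f] give the Taylor
    expansion. *)
Lemma ckernel_series (F : R -> C) (r : R) (z : C) :
  ccont F -> Cmod z < r ->
  pseries (fun k => cmean (fun t => F t * Cconj (cis t) ^ k) / r ^ k)%C z
    (cmean (fun t => F t * ckernel r z t)%C).
Proof.
  intros HF Hz. assert (Hz0 := Cmod_ge_0 z).
  assert (Hr : RtoC r <> 0) by (apply RtoC_neq_0; lra).
  destruct (ccont_bounded F (2 * PI)) as [B HB]; auto.
  { generalize two_PI_pos; lra. }
  assert (Hcc : ccont (fun t => Cconj (cis t))) by (apply ccont_conj, ccont_cis).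
  set (q := fun t => (z / r * Cconj (cis t))%C).
  assert (Hq : ccont q) by (apply ccont_mult; auto using ccont_const).
  assert (Hk : ccont (ckernel r z)) by now apply ccont_ckernel.
  apply clim_le with (fun n => (B * (r / (r - Cmod z))) * (Cmod z / r) ^ n).
  - intros n.
    replace (csum _ n) with (cmean (fun t => csum (fun k => F t * q t ^ k) n)%C).
    2:{ rewrite (cmean_csum (fun k t => F t * q t ^ k)%C).
        - apply csum_ext. intros k _.
          rewrite (cmean_ext _ (fun t => (z / r) ^ k * (F t * Cconj (cis t) ^ k))%C).
          + rewrite cmean_scal by (apply ccont_mult; auto using ccont_pow).
            unfold Cdiv. rewrite Cpow_mult_l, Cpow_inv by auto. ring.
          + intros t _. unfold q. rewrite Cpow_mult_l. ring.
        - intros k. apply ccont_mult; auto using ccont_pow. }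
    rewrite <- cmean_minus.
    2:{ apply (ccont_csum (fun k t => F t * q t ^ k)%C).
        intros k. apply ccont_mult; auto using ccont_pow. }
    2:{ now apply ccont_mult. }
    rewrite (cmean_ext _ (fun t => F t * ((- (1)) * (q t ^ n * ckernel r z t)))%C).
    + apply cmean_bound.
      { ccont_tac. }
      intros t Ht.
      assert (HBt := HB t Ht).
      rewrite !Cmod_mult, Cmod_m1, Rmult_1_l, Cmod_pow.
      replace (Cmod (q t)) with (Cmod z / r).
      2:{ unfold q. rewrite Cmod_mult, Cmod_div, Cmod_conj, Cmod_cis, Cmod_R, Rabs_pos_eq; auto; lra. }
      assert (Hp : 0 <= (Cmod z / r) ^ n).
      { apply pow_le. apply Rmult_le_pos; auto. apply Rlt_le, Rinv_0_lt_compat; lra. }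
      assert (Hkb : Cmod (ckernel r z t) <= r / (r - Cmod z)).
      { unfold ckernel. rewrite Cmod_div by now apply circle_minus_neq_0.
        rewrite Cmod_circle by lra.
        apply Rmult_le_compat_l; [lra|]. apply Rinv_le_contravar; [lra|].
        generalize (Cmod_le_minus (r * cis t) z). rewrite Cmod_circle by lra. lra. }
      rewrite Rmult_assoc, (Rmult_comm (r / _)).
      apply Rmult_le_compat; auto using Cmod_ge_0.
      * apply Rmult_le_pos; auto using Cmod_ge_0.
      * apply Rmult_le_compat_l; auto.
    + intros t _. rewrite csum_scal.
      assert (Hd := circle_minus_neq_0 r z t Hz).
      assert (Hc := cis_neq_0 t).
      assert (Hkq : (ckernel r z t * (1 - q t) = 1)%C).
      { unfold ckernel, q.
        replace (Cconj (cis t)) with (/ cis t)%C.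
        - field; auto.
        - rewrite <- (Cmult_1_l (Cconj _)), <- (Cinv_l (cis t)) at 1 by auto.
          rewrite <- Cmult_assoc, cis_conj. ring. }
      assert (Hg : csum (Cpow (q t)) n = (ckernel r z t * (1 - q t ^ n))%C).
      { rewrite <- (csum_geom (q t) n), Cmult_assoc, Hkq, Cmult_1_l. reflexivity. }
      rewrite Hg. ring.
  - apply is_lim_seq_0_scal, is_lim_seq_0_pow. split.
    + apply Rmult_le_pos; auto. apply Rlt_le, Rinv_0_lt_compat; lra.
    + apply Rmult_lt_reg_r with r; [lra|]. unfold Rdiv.
      rewrite Rmult_assoc, Rinv_l; lra.
Qed.

Lemma cmean_ckernel (r : R) (z : C) : Cmod z < r -> cmean (ckernel r z) = 1.
Proof.
  intros Hz.
  assert (H := ckernel_series (fun _ => 1) r z (ccont_const 1) Hz).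
  rewrite (cmean_ext (ckernel r z) (fun t => 1 * ckernel r z t)%C) by (intros; ring).
  apply (clim_unique _ _ _ H). apply clim_shift.
  apply clim_ext with (fun _ => RtoC 1); [|apply clim_const].
  intros n. rewrite csum_shift.
  rewrite (csum_ext _ (fun _ => 0 * 0)%C), csum_scal.
  - rewrite (cmean_ext _ (fun _ => RtoC 1)) by (intros; simpl; ring).
    rewrite cmean_const. simpl. field.
  - intros k _. rewrite (cmean_ext _ (fun t => Cconj (cis t) ^ S k)%C) by (intros; ring).
    rewrite cmean_conj_cis_pow. unfold Cdiv. ring.
Qed.

(* The circle of radius [r] is contracted to [z] along the homotopy
   [z + s (r e^(it) - z)]; the parameter [s = (1 - cos u) / 2] stays in [0, 1]
   for every real [u]. *)
Lemma Cauchy_formula (R0 r : R) (f : C -> C) (z : C) :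
  holo (ballC R0) f -> r < R0 -> Cmod z < r ->
  cmean (fun t => f (r * cis t)%C * ckernel r z t)%C = f z.
Proof.
  intros Hf0 Hr Hz. generalize Hf0; intros [f' Hf].
  assert (Hz0 := Cmod_ge_0 z).
  set (s := fun u => (1 - cos u) / 2).
  assert (Hs : forall u, 0 <= s u <= 1) by (intros u; unfold s; generalize (COS_bound u); lra).
  set (P := fun u t => (z + (r * cis t - z) * s u)%C).
  assert (HP : forall u t, ballC R0 (P u t)).
  { intros u t. unfold ballC, P.
    replace (z + (r * cis t - z) * s u)%C with ((1 - s u)%R * z + s u * (r * cis t))%C
      by (rewrite RtoC_minus; ring).
    apply Rle_lt_trans with (1 := Cmod_triangle _ _).
    rewrite (Cmod_mult (1 - s u)%R), (Cmod_mult (s u)), Cmod_circle, !Cmod_R by lra.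
    specialize (Hs u). rewrite !Rabs_pos_eq by lra. nra. }
  assert (HPt : forall u, ccont (P u)).
  { intros u. apply ccont_plus; [apply ccont_const|].
    apply ccont_mult; [|apply ccont_const].
    apply ccont_minus; [apply ccont_circle|apply ccont_const]. }
  set (F := fun u t => (ckernel r z t * f (P u t))%C).
  (* Differentiating [P] in [u] brings out the factor [r cis t - z], which cancels the denominator
     of the kernel. *)
  set (F' := fun u t => (f' (P u t) * (sin u / 2)%R * (r * cis t))%C).
  assert (HF : forall u, ccont (F u)).
  { intros u. apply ccont_mult; [now apply ccont_ckernel|].
    now apply (ccont_comp (ballC R0)). }
  assert (Hds : forall u, rderiv (fun v => RtoC (s v)) u (sin u / 2)%R).
  { intros u. apply rderiv_pair; [|apply (is_derive_const (V := R_NormedModule))].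
    unfold s. auto_derive; auto. field. }
  assert (E : cmean (F 0) = cmean (F PI)).
  { apply (cmean_param_const F F' 0 PI PI_RGT_0 HF).
    - intros u t.
      apply rderiv_eq with (ckernel r z t * f' (P u t) * ((r * cis t - z) * (sin u / 2)%R))%C.
      + apply (rderiv_comp (fun y => ckernel r z t * f y)%C (fun u => P u t)).
        * apply cderiv_scal. now apply Hf.
        * apply (rderiv_comp (fun y => z + (r * cis t - z) * y)%C (fun u => RtoC (s u))); auto.
          apply cderiv_affine.
      + unfold F', ckernel. field. now apply circle_minus_neq_0.
    - intros u t. unfold F'.
      assert (Hc2 : continuous (T := prod_UniformSpace R_UniformSpace R_UniformSpace)
         (U := C_UniformSpace) (fun p => cis (snd p)) (u, t)).
      { apply (continuous_comp (V := R_UniformSpace) (W := C_UniformSpace) snd cis).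
        - apply continuous_snd.
        - apply ccont_cis. }
      assert (Hcos : forall g : R -> R, (forall v, continuous g v) ->
         continuous (T := prod_UniformSpace R_UniformSpace R_UniformSpace)
         (U := C_UniformSpace) (fun p => RtoC (g (fst p))) (u, t)).
      { intros g Hg. apply continuous_RtoC.
        apply (continuous_comp (V := R_UniformSpace) (W := R_UniformSpace) fst g); auto.
        apply continuous_fst. }
      apply continuous_Cmult; [apply continuous_Cmult|].
      + apply (continuous_comp (V := C_UniformSpace) (W := C_UniformSpace)
          (fun p : R * R => P (fst p) (snd p)) f').
        * apply continuous_Cplus; [apply continuous_const|].
          apply continuous_Cmult.
          -- apply continuous_Cminus; [|apply continuous_const].
             apply continuous_Cmult; [apply continuous_const|exact Hc2].
          -- apply (Hcos s). intros v. apply (ex_derive_continuous (V := R_NormedModule)).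
             unfold s. auto_derive. auto.
        * apply Hf, HP.
      + apply (Hcos (fun v => sin v / 2)). intros v.
        apply (ex_derive_continuous (V := R_NormedModule)). auto_derive. auto.
      + apply continuous_Cmult; [apply continuous_const|exact Hc2].
    (* If [s u] is not 0, [F' u] is a constant times the [t]-derivative of the closed curve
       [f (P u t)]. If it is 0, the path sits at [z] and only the mean of [cis] is left. *)
    - intros u. destruct (Req_dec (s u) 0) as [H0|H0].
      + rewrite (cmean_ext _ (fun t => f' z * (sin u / 2)%R * r * cis t ^ 1)%C).
        * rewrite cmean_scal, cmean_cis_pow by apply ccont_pow, ccont_cis. ring.
        * intros t _. unfold F', P. rewrite H0, Cmult_0_r, Cplus_0_r. simpl. ring.
      + assert (Hs0 := RtoC_neq_0 _ H0). assert (Hi := Ci_neq_0).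
        rewrite (cmean_ext _ (fun t => (sin u / 2)%R / (s u * Ci) *
           (f' (P u t) * (s u * r * (Ci * cis t))))%C).
        2:{ intros t _. unfold F'. field; auto. }
        assert (Hc : ccont (fun t => f' (P u t) * (s u * r * (Ci * cis t)))%C).
        { apply ccont_mult.
          - intros t. apply (continuous_comp (V := C_UniformSpace) (W := C_UniformSpace) (P u) f').
            + apply HPt.
            + apply Hf, HP.
          - ccont_tac. }
        rewrite cmean_scal by exact Hc.
        rewrite (cmean_rderiv (fun t => f (P u t))) with (2 := Hc); [ring| |].
        * intros t. apply (rderiv_comp f (P u)); [now apply Hf|].
          apply rderiv_comp with (f := fun y => (z + (r * y - z) * s u)%C).
          -- apply cderiv_ext_loc with (fun y => (z - z * s u) + s u * r * y)%C 1; [lra| |].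
             ++ intros; ring.
             ++ apply cderiv_affine.
          -- apply rderiv_cis.
        * unfold P. now rewrite cis_2PI, cis_0. }
  transitivity (cmean (F PI)).
  - apply cmean_ext. intros t _. unfold F, P, s. rewrite cos_PI.
    replace ((1 - -1) / 2) with 1 by field.
    replace (z + (r * cis t - z) * 1)%C with (r * cis t)%C by ring. ring.
  - rewrite <- E. rewrite (cmean_ext _ (fun t => f z * ckernel r z t)%C).
    + rewrite cmean_scal, cmean_ckernel; auto using ccont_ckernel. ring.
    + intros t _. unfold F, P, s. rewrite cos_0.
      replace ((1 - 1) / 2) with 0 by field.
      replace (z + (r * cis t - z) * 0)%C with z by ring. ring.
Qed.

Lemma Taylor_circle (R0 r : R) (f : C -> C) :
  holo (ballC R0) f -> r < R0 -> forall z, ballC r z ->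
  pseries (fun k => cmean (fun t => f (r * cis t)%C * Cconj (cis t) ^ k) / r ^ k)%C z (f z).
Proof.
  intros Hf Hr z Hz. unfold ballC in Hz. assert (Hz0 := Cmod_ge_0 z).
  rewrite <- (Cauchy_formula R0 r f z) by auto.
  apply (ckernel_series (fun t => f (r * cis t)%C)); auto.
  apply (ccont_comp (ballC R0)); auto using ccont_circle.
  intros t. unfold ballC. rewrite Cmod_circle; lra.
Qed.

Lemma Taylor (R0 : R) (f : C -> C) : 0 < R0 ->
  holo (ballC R0) f -> exists a, forall z, ballC R0 z -> pseries a z (f z).
Proof.
  intros HR Hf.
  set (a := fun (r : R) k => (cmean (fun t => f (r * cis t)%C * Cconj (cis t) ^ k) / r ^ k)%C).
  exists (a (R0 / 2)). intros z Hz. unfold ballC in Hz.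
  (* The coefficients are fixed on the circle of radius [R0 / 2], but the expansion at [z] needs a
     circle around [z]; uniqueness on the smaller disk shows that both circles give the same
     coefficients. *)
  set (r := (Rmax (Cmod z) (R0 / 2) + R0) / 2).
  assert (Hr : Cmod z < r /\ R0 / 2 < r /\ r < R0).
  { assert (Hm : Rmax (Cmod z) (R0 / 2) < R0) by (apply Rmax_lub_lt; lra).
    generalize (Rmax_l (Cmod z) (R0 / 2)) (Rmax_r (Cmod z) (R0 / 2)). unfold r. lra. }
  destruct Hr as [Hr1 [Hr2 Hr3]].
  assert (E : forall k, a (R0 / 2) k = a r k).
  { apply (pseries_coef_unique (R0 / 2) _ _ f); [lra| |].
    - intros y Hy. apply (Taylor_circle R0); auto; lra.
    - intros y Hy. apply (Taylor_circle R0); auto. unfold ballC in *; lra. }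
  apply clim_ext with (csum (fun k => a r k * z ^ k)%C).
  - intros n. apply csum_ext. intros k _. now rewrite E.
  - now apply (Taylor_circle R0).
Qed.

Lemma Taylor_coef (R0 r : R) (a : nat -> C) (f : C -> C) (k : nat) :
  (forall z, ballC R0 z -> pseries a z (f z)) -> 0 < r < R0 ->
  cmean (fun t => f (r * cis t) * Cconj (cis t) ^ k)%C = (a k * r ^ k)%C.
Proof.
  intros Ha Hr.
  rewrite (pseries_coef_unique r a
    (fun k => cmean (fun t => f (r * cis t)%C * Cconj (cis t) ^ k) / r ^ k)%C f); [|lra| |].
  - field. apply Cpow_nz, RtoC_neq_0. lra.
  - intros z Hz. apply Ha. unfold ballC in *; lra.
  - apply (Taylor_circle R0); [|lra]. now apply pseries_holo with a.
Qed.

(** * Parseval's identity, maximum modulus, disk automorphisms *)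

(* Points of the square [-1,1]^2 outside the disk get a radius that keeps their
   neighbourhoods away from the disk, so that a Lebesgue number of the square
   serves the disk. *)
Lemma closed_disk_nbhd (U : C -> Prop) :
  (forall z, Cmod z <= 1 -> exists r, 0 < r /\ forall y, Cmod (y - z) < r -> U y) ->
  exists R0, 1 < R0 /\ forall z, ballC R0 z -> U z.
Proof.
  intros H.
  (* The factor 4 leaves room for two moves: from [w] to its radial projection, by less than [d],
     and from there to a centre of the cover, by less than [2 d] because the cover consists of
     squares. *)
  assert (Hd : forall z : C, exists d : posreal,
     (Cmod z <= 1 -> forall y, Cmod (y - z) < 4 * d -> U y) /\
     (1 < Cmod z -> 4 * d = Cmod z - 1)).
  { intros z. destruct (Rle_lt_dec (Cmod z) 1) as [Hz|Hz].
    - destruct (H z Hz) as [r [Hr Hy]].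
      assert (Hr4 : 0 < r / 4) by lra.
      exists (mkposreal _ Hr4). simpl. split; [|lra].
      intros _ y Hy4. apply Hy. lra.
    - assert (Hr4 : 0 < (Cmod z - 1) / 4) by lra.
      exists (mkposreal _ Hr4). simpl. split; lra. }
  set (delta := fun x y : R => proj1_sig (constructive_indefinite_description _ (Hd (x, y)))).
  assert (Hdelta : forall x y,
     (Cmod (x, y) <= 1 -> forall w, Cmod (w - (x, y)) < 4 * delta x y -> U w) /\
     (1 < Cmod (x, y) -> 4 * delta x y = Cmod (x, y) - 1)).
  { intros x y. unfold delta. apply proj2_sig. }
  destruct (compactness_value_2d (-1) 1 (-1) 1 delta) as [d Hc].
  exists (1 + d). split; [generalize (cond_pos d); lra|].
  intros w Hw. unfold ballC in Hw.
  destruct (Rle_lt_dec (Cmod w) 1) as [Hw1|Hw1].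
  { destruct (H w Hw1) as [r [Hr Hy]]. apply Hy.
    replace (w - w)%C with (RtoC 0) by ring. now rewrite Cmod_0. }
  set (z := (w / Cmod w)%C).
  assert (Hwn : RtoC (Cmod w) <> 0) by (apply RtoC_neq_0; lra).
  assert (Hz : Cmod z = 1).
  { unfold z. rewrite Cmod_div, Cmod_R, Rabs_pos_eq by (auto; lra). field; lra. }
  assert (Hwz : Cmod (w - z) < d).
  { replace (w - z)%C with (z * (Cmod w - 1)%R)%C.
    - rewrite Cmod_mult, Hz, Cmod_R, Rabs_pos_eq; lra.
    - unfold z. rewrite RtoC_minus. field; auto. }
  assert (Hre : -1 <= Re z <= 1)
    by (apply Rabs_le_between; rewrite <- Hz; apply re_le_Cmod).
  assert (Him : -1 <= Im z <= 1)
    by (apply Rabs_le_between; rewrite <- Hz; apply im_le_Cmod).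
  destruct (NNPP _ (Hc (Re z) (Im z) Hre Him)) as [u [v [_ [_ [H1 [H2 H3]]]]]].
  destruct (Hdelta u v) as [Hin Hout].
  assert (Hzu : Cmod (z - (u, v)) < 2 * delta u v).
  { apply Rle_lt_trans with (1 := Cmod_le_re_im _). rewrite Re_minus, Im_minus.
    change (Re (u, v)) with u. change (Im (u, v)) with v. lra. }
  destruct (Rle_lt_dec (Cmod (u, v)) 1) as [Huv|Huv].
  - apply (Hin Huv). generalize (Cmod_triangle_minus w z (u, v)). lra.
  - specialize (Hout Huv). generalize (Cmod_le_minus (u, v) z).
    rewrite (Cmod_minus_sym _ z). generalize (cond_pos (delta u v)). lra.
Qed.

(* Holomorphic on a neighbourhood of the closed disk. *)
Definition hcd (f : C -> C) : Prop := exists R0, 1 < R0 /\ holo (ballC R0) f.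

Lemma ballC_mono (r s : R) (z : C) : r <= s -> ballC r z -> ballC s z.
Proof. unfold ballC; lra. Qed.

Lemma hcd_const (c : C) : hcd (fun _ => c).
Proof. exists 2. split; [lra|apply holo_const]. Qed.

Lemma hcd_id : hcd (fun z => z).
Proof. exists 2. split; [lra|apply holo_id]. Qed.

Lemma hcd_common (f g : C -> C) : hcd f -> hcd g ->
  exists R0, 1 < R0 /\ holo (ballC R0) f /\ holo (ballC R0) g.
Proof.
  intros [r [Hr Hf]] [s [Hs Hg]]. exists (Rmin r s).
  split; [now apply Rmin_glb_lt|]. split.
  - apply holo_subset with (2 := Hf). intros z. apply ballC_mono, Rmin_l.
  - apply holo_subset with (2 := Hg). intros z. apply ballC_mono, Rmin_r.
Qed.

Lemma hcd_plus (f g : C -> C) : hcd f -> hcd g -> hcd (fun z => f z + g z)%C.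
Proof.
  intros Hf Hg. destruct (hcd_common _ _ Hf Hg) as [r [Hr [H1 H2]]].
  exists r. split; auto. now apply holo_plus.
Qed.

Lemma hcd_minus (f g : C -> C) : hcd f -> hcd g -> hcd (fun z => f z - g z)%C.
Proof.
  intros Hf Hg. destruct (hcd_common _ _ Hf Hg) as [r [Hr [H1 H2]]].
  exists r. split; auto. now apply holo_minus.
Qed.

Lemma hcd_mult (f g : C -> C) : hcd f -> hcd g -> hcd (fun z => f z * g z)%C.
Proof.
  intros Hf Hg. destruct (hcd_common _ _ Hf Hg) as [r [Hr [H1 H2]]].
  exists r. split; auto. now apply holo_mult.
Qed.

Lemma hcd_pow (f : C -> C) n : hcd f -> hcd (fun z => f z ^ n)%C.
Proof. intros [r [Hr Hf]]. exists r. split; auto. now apply holo_pow. Qed.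

Lemma hcd_csum (f : nat -> C -> C) n :
  (forall k, hcd (f k)) -> hcd (fun z => csum (fun k => f k z) n).
Proof.
  intros Hf. induction n as [|n IH]; simpl; [apply hcd_const|now apply hcd_plus].
Qed.

Lemma hcd_continuous (f : C -> C) (z : C) : hcd f -> Cmod z <= 1 ->
  forall eps, 0 < eps -> exists d, 0 < d /\
    forall y, Cmod (y - z) < d -> Cmod (f y - f z) < eps.
Proof.
  intros [r [Hr Hf]] Hz. apply continuous_C_eps.
  apply (holo_continuous (ballC r)); auto. unfold ballC; lra.
Qed.

(** Near each point of the closed disk, [g] takes values in the larger ball on which [f] is
    holomorphic; compactness provides a common radius above 1. *)
Lemma hcd_comp (f g : C -> C) : hcd f -> hcd g ->
  (forall z, Cmod z <= 1 -> Cmod (g z) <= 1) -> hcd (fun z => f (g z)).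
Proof.
  intros [r [Hr Hf]] Hg Hm. generalize Hg. intros [s [Hs Hgs]].
  destruct (closed_disk_nbhd (fun z => ballC s z /\ ballC r (g z))) as [R0 [HR H]].
  - intros z Hz. destruct (hcd_continuous g z Hg Hz (r - 1)) as [d [Hd Hy]]; [lra|].
    exists (Rmin d (s - 1)). split; [apply Rmin_pos; lra|].
    intros y Hyd. specialize (Hm z Hz). unfold ballC. split.
    + generalize (Cmod_le_minus y z) (Rmin_r d (s - 1)). lra.
    + specialize (Hy y (Rlt_le_trans _ _ _ Hyd (Rmin_l _ _))).
      generalize (Cmod_le_minus (g y) (g z)). lra.
  - exists R0. split; auto. apply holo_comp with (ballC r); auto.
    + apply holo_subset with (2 := Hgs). intros z Hz; now apply H.
    + intros z Hz; now apply H.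
Qed.

Lemma hcd_nonvanishing (f : C -> C) : hcd f -> (forall z, Cmod z <= 1 -> f z <> 0) ->
  exists R0, 1 < R0 /\ holo (ballC R0) f /\ forall z, ballC R0 z -> f z <> 0.
Proof.
  intros Hf Hnz. generalize Hf. intros [s [Hs Hfs]].
  destruct (closed_disk_nbhd (fun z => ballC s z /\ f z <> 0)) as [R0 [HR H]].
  - intros z Hz. assert (Hm := proj1 (Cmod_gt_0 _) (Hnz z Hz)).
    destruct (hcd_continuous f z Hf Hz (Cmod (f z)) Hm) as [d [Hd Hy]].
    exists (Rmin d (s - 1)). split; [apply Rmin_pos; lra|].
    intros y Hyd. split.
    + unfold ballC. generalize (Cmod_le_minus y z) (Rmin_r d (s - 1)). lra.
    + specialize (Hy y (Rlt_le_trans _ _ _ Hyd (Rmin_l _ _))). intros E.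
      rewrite E in Hy. replace (0 - f z)%C with (- f z)%C in Hy by ring.
      rewrite Cmod_opp in Hy. lra.
  - exists R0. split; auto. split.
    + apply holo_subset with (2 := Hfs). intros z Hz; now apply H.
    + intros z Hz; now apply H.
Qed.

Lemma hcd_inv (f : C -> C) : hcd f -> (forall z, Cmod z <= 1 -> f z <> 0) ->
  hcd (fun z => / f z)%C.
Proof.
  intros Hf Hnz. destruct (hcd_nonvanishing f Hf Hnz) as [R0 [HR [H1 H2]]].
  exists R0. split; auto. now apply holo_inv.
Qed.

Lemma hcd_of_analytic (f : C -> C) : analytic_on_closed_disk f -> hcd f.
Proof.
  intros [U [HU [Hsub Han]]].
  destruct (closed_disk_nbhd U) as [R0 [HR H]].
  - intros z Hz. apply locally_Cmod. now apply HU, Hsub.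
  - exists R0. split; auto. apply holo_local. intros z Hz.
    destruct (Han z (H z Hz)) as [a [r [Hr Ha]]]. exists r. split; auto.
    assert (Hh : holo (ballC r) (fun w => f (z + w)%C)).
    { apply pseries_holo with a. intros w Hw. apply is_pseries_pseries.
      assert (Hzw := Ha (z + w)%C).
      replace (z + w - z)%C with w in Hzw by ring. now apply Hzw. }
    replace f with (fun y => f (z + (y - z))%C).
    + apply (holo_comp _ (ballC r) (fun w => f (z + w)%C) (fun y => y - z)%C); auto.
      apply holo_minus; [apply holo_id|apply holo_const].
    + apply functional_extensionality. intros y. f_equal. ring.
Qed.

(* The Taylor coefficients at 0, when [hcd f]. *)
Definition tcoef (f : C -> C) (k : nat) : C :=
  cmean (fun t => f (cis t) * Cconj (cis t) ^ k)%C.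

Lemma hcd_ccont (f : C -> C) : hcd f -> ccont (fun t => f (cis t)).
Proof.
  intros [r [Hr Hf]]. apply (ccont_comp (ballC r)); auto using ccont_cis.
  intros t. unfold ballC. rewrite Cmod_cis. lra.
Qed.

Lemma tcoef_eq (f : C -> C) (a : nat -> C) (R0 : R) : 1 < R0 ->
  (forall z, ballC R0 z -> pseries a z (f z)) -> forall k, tcoef f k = a k.
Proof.
  intros HR Ha k.
  assert (H := Taylor_coef R0 1 a f k Ha (conj Rlt_0_1 HR)).
  rewrite Cpow_1_l, Cmult_1_r in H. rewrite <- H.
  apply cmean_ext. intros t _. now rewrite Cmult_1_l.
Qed.

Lemma hcd_pseries (f : C -> C) : hcd f ->
  exists R0, 1 < R0 /\ forall z, ballC R0 z -> pseries (tcoef f) z (f z).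
Proof.
  intros [r [Hr Hf]]. destruct (Taylor r f) as [a Ha]; [lra|auto|].
  exists r. split; auto. intros z Hz.
  apply clim_ext with (csum (fun k => a k * z ^ k)%C); [|now apply Ha].
  intros n. apply csum_ext. intros k _. now rewrite (tcoef_eq f a r).
Qed.

Lemma tcoef_0 (f : C -> C) : hcd f -> tcoef f 0 = f 0.
Proof.
  intros Hf. destruct (hcd_pseries f Hf) as [r [Hr H]].
  apply (clim_unique (csum (fun k => tcoef f k * 0 ^ k)%C)).
  - apply pseries_at_0.
  - apply H. unfold ballC. rewrite Cmod_0; lra.
Qed.

Lemma tcoef_decay (f : C -> C) : hcd f ->
  exists q K, 0 < q < 1 /\ 0 <= K /\ forall k, Cmod (tcoef f k) <= K * q ^ k.
Proof.
  intros Hf. destruct (hcd_pseries f Hf) as [r [Hr H]].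
  set (s := (1 + r) / 2). assert (Hs : 1 < s < r) by (unfold s; lra).
  destruct (pseries_coef_bound (tcoef f) s (f s)) as [K [HK0 HK]]; [lra| |].
  { apply H. unfold ballC. rewrite Cmod_R, Rabs_pos_eq; lra. }
  exists (/ s), K. split; [|split; auto].
  - split; [apply Rinv_0_lt_compat; lra|].
    rewrite <- Rinv_1. apply Rinv_lt_contravar; lra.
  - intros k. assert (Hk : 0 < s ^ k) by (apply pow_lt; lra).
    apply Rmult_le_reg_r with (s ^ k); auto. rewrite pow_inv.
    rewrite Rmult_assoc, Rinv_l by lra. rewrite Rmult_1_r. apply HK.
Qed.

Lemma pseries_remainder (a : nat -> C) (z l : C) (q K : R) :
  0 < q < 1 -> (forall k, Cmod (a k) <= K * q ^ k) -> Cmod z <= 1 -> pseries a z l ->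
  forall n, Cmod (l - csum (fun k => a k * z ^ k)%C n) <= K / (1 - q) * q ^ n.
Proof.
  intros Hq HK Hz Hl n.
  assert (HK0 : 0 <= K).
  { specialize (HK O). rewrite Rmult_1_r in HK. apply Rle_trans with (2 := HK), Cmod_ge_0. }
  (* The factor [1 - q ^ m] records the partial geometric sum, which is what lets the induction on
     [m] close. *)
  assert (Hm : forall m, Cmod (csum (fun k => a k * z ^ k)%C (m + n) - csum (fun k => a k * z ^ k)%C n)
     <= K / (1 - q) * q ^ n * (1 - q ^ m)).
  { induction m as [|m IH]; simpl.
    - replace (_ - _)%C with (RtoC 0) by ring. rewrite Cmod_0. right; ring.
    - replace (_ + _ - _)%C with ((csum (fun k => a k * z ^ k)%C (m + n) - csum (fun k => a k * z ^ k)%C n)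
        + a (m + n)%nat * z ^ (m + n))%C by ring.
      apply Rle_trans with (1 := Cmod_triangle _ _).
      apply Rle_trans with (K / (1 - q) * q ^ n * (1 - q ^ m) + K * q ^ (m + n)).
      + apply Rplus_le_compat; auto. rewrite Cmod_mult, Cmod_pow.
        rewrite <- (Rmult_1_r (K * _)). apply Rmult_le_compat; auto using Cmod_ge_0.
        * apply pow_le, Cmod_ge_0.
        * rewrite <- (pow1 (m + n)). apply pow_incr. split; auto using Cmod_ge_0.
      + right. rewrite pow_add. field. lra. }
  assert (Hl' : clim (fun m => csum (fun k => a k * z ^ k)%C (m + n) - csum (fun k => a k * z ^ k)%C n)%C
     (l - csum (fun k => a k * z ^ k)%C n)).
  { apply clim_minus; [|apply clim_const].
    apply (is_lim_seq_incr_n (fun k => Cmod (csum (fun k => a k * z ^ k)%C k - l)) n). exact Hl. }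
  apply clim_bound with (1 := Hl'). intros m. apply Rle_trans with (1 := Hm m).
  rewrite <- (Rmult_1_r (K / (1 - q) * q ^ n)) at 2.
  apply Rmult_le_compat_l.
  - apply Rmult_le_pos; [|apply pow_le; lra].
    apply Rmult_le_pos; auto. apply Rlt_le, Rinv_0_lt_compat; lra.
  - assert (0 <= q ^ m) by (apply pow_le; lra). lra.
Qed.

(** Only [f] is expanded. Its partial sums converge uniformly on the circle, and the mean of
    [cis ^ k] against the conjugate of [g] is the conjugate of the [k]-th coefficient of [g]. *)
Lemma Parseval (f g : C -> C) : hcd f -> hcd g ->
  clim (csum (fun k => tcoef f k * Cconj (tcoef g k))%C)
       (cmean (fun t => f (cis t) * Cconj (g (cis t)))%C).
Proof.
  intros Hf Hg.
  assert (Hfc := hcd_ccont f Hf). assert (Hgc := hcd_ccont g Hg).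
  destruct (ccont_bounded (fun t => g (cis t)) (2 * PI)) as [B HB]; auto.
  { generalize two_PI_pos; lra. }
  destruct (hcd_pseries f Hf) as [r [Hr Hs]].
  destruct (tcoef_decay f Hf) as [q [K [Hq [HK0 HK]]]].
  apply clim_le with (fun n => K / (1 - q) * B * q ^ n).
  2:{ apply is_lim_seq_0_scal, is_lim_seq_0_pow. lra. }
  intros n. rewrite Cmod_minus_sym.
  assert (Hp : ccont (fun t => csum (fun k => tcoef f k * cis t ^ k)%C n)).
  { apply (ccont_csum (fun k t => tcoef f k * cis t ^ k)%C). intros k. ccont_tac. }
  replace (csum _ n) with
    (cmean (fun t => csum (fun k => tcoef f k * cis t ^ k)%C n * Cconj (g (cis t)))%C).
  - rewrite <- cmean_minus by ccont_tac.
    apply cmean_bound; [ccont_tac|]. intros t Ht.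
    replace (_ - _)%C with ((f (cis t) - csum (fun k => tcoef f k * cis t ^ k)%C n)
       * Cconj (g (cis t)))%C by ring.
    rewrite Cmod_mult, Cmod_conj.
    replace (K / (1 - q) * B * q ^ n) with (K / (1 - q) * q ^ n * B) by ring.
    apply Rmult_le_compat; auto using Cmod_ge_0.
    apply pseries_remainder; auto.
    + rewrite Cmod_cis; lra.
    + apply Hs. unfold ballC. rewrite Cmod_cis; lra.
  - rewrite (cmean_ext _ (fun t => csum (fun k => tcoef f k * (cis t ^ k * Cconj (g (cis t))))%C n)).
    + rewrite (cmean_csum (fun k t => tcoef f k * (cis t ^ k * Cconj (g (cis t))))%C).
      2:{ intros k. ccont_tac. }
      apply csum_ext. intros k _. rewrite cmean_scal by ccont_tac. f_equal.
      unfold tcoef. rewrite <- cmean_conj by ccont_tac.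
      apply cmean_ext. intros t _. rewrite Cmult_conj, Cpow_conj, Cconj_conj. ring.
    + intros t _. rewrite Cmult_comm, <- csum_scal. apply csum_ext. intros; ring.
Qed.

Lemma Parseval_norm (f : C -> C) : hcd f ->
  is_lim_seq (rsum (fun k => Cmod (tcoef f k) ^ 2))
    (Re (cmean (fun t => f (cis t) * Cconj (f (cis t)))%C)).
Proof.
  intros Hf. generalize (Parseval f f Hf Hf). intros H.
  apply clim_re_im in H. destruct H as [H _].
  apply is_lim_seq_ext with (2 := H). intros n. rewrite Re_csum.
  apply rsum_ext. intros k _. rewrite <- Cmod2_conj. reflexivity.
Qed.

Lemma tcoef_square_sum_le (f : C -> C) (B : R) : hcd f ->
  (forall z, Cmod z = 1 -> Cmod (f z) <= B) ->
  forall n, rsum (fun k => Cmod (tcoef f k) ^ 2) n <= B ^ 2.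
Proof.
  intros Hf HB n.
  assert (Hpos : forall k, 0 <= Cmod (tcoef f k) ^ 2) by (intros; apply pow2_ge_0).
  apply Rle_trans with (Re (cmean (fun t => f (cis t) * Cconj (f (cis t)))%C)).
  - apply (is_lim_seq_incr_compare _ _ (Parseval_norm f Hf)).
    intros k. simpl. specialize (Hpos k). simpl in Hpos. lra.
  - apply Rle_trans with (1 := Rle_abs _). apply Rle_trans with (1 := re_le_Cmod _).
    assert (Hc := hcd_ccont f Hf).
    apply cmean_bound; [ccont_tac|]. intros t _. rewrite Cmod_mult, Cmod_conj.
    assert (H := HB (cis t) (Cmod_cis t)).
    replace (Cmod (f (cis t)) * Cmod (f (cis t))) with (Cmod (f (cis t)) ^ 2) by ring.
    apply pow_incr. split; auto. apply Cmod_ge_0.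
Qed.

(** For [|a| < 1] this is the disk automorphism taking [a] to 0, with inverse [bfactor (- a)]. It
    serves both as a Blaschke factor and as a change of base point. *)
Definition bfactor (a z : C) : C := ((z - a) / (1 - Cconj a * z))%C.

Lemma bfactor_den (a z : C) : Cmod a * Cmod z < 1 -> (1 - Cconj a * z)%C <> 0.
Proof.
  intros H E. apply (f_equal Cmod) in E. rewrite Cmod_0 in E.
  generalize (Cmod_le_minus 1 (Cconj a * z)). rewrite E, Cmod_1, Cmod_mult, Cmod_conj. lra.
Qed.

Lemma disk_mult_lt_1 (a z : C) : Cmod a < 1 -> Cmod z <= 1 -> Cmod a * Cmod z < 1.
Proof. intros Ha Hz. generalize (Cmod_ge_0 a) (Cmod_ge_0 z). nra. Qed.

Lemma bfactor_identity (a z : C) :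
  Cmod (1 - Cconj a * z) ^ 2 - Cmod (z - a) ^ 2 = (1 - Cmod a ^ 2) * (1 - Cmod z ^ 2).
Proof.
  rewrite !Cmod2_alt. destruct a as [a1 a2], z as [z1 z2].
  unfold Re, Im, Cconj, Cminus, Cplus, Copp, Cmult, RtoC; simpl. ring.
Qed.

Lemma bfactor_mod (a z : C) : Cmod a < 1 -> Cmod z <= 1 ->
  1 - Cmod (bfactor a z) ^ 2
  = (1 - Cmod a ^ 2) * (1 - Cmod z ^ 2) / Cmod (1 - Cconj a * z) ^ 2.
Proof.
  intros Ha Hz. assert (Hd := bfactor_den a z (disk_mult_lt_1 a z Ha Hz)).
  rewrite <- bfactor_identity. unfold bfactor. rewrite Cmod_div by auto.
  assert (H : Cmod (1 - Cconj a * z) <> 0).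
  { apply Cmod_gt_0 in Hd. lra. }
  field. auto.
Qed.

Lemma sqr_lt_1 (x : R) : 0 <= x < 1 -> 0 < 1 - x ^ 2.
Proof. intros H. nra. Qed.

Lemma bfactor_circle (a z : C) : Cmod a < 1 -> Cmod z = 1 -> Cmod (bfactor a z) = 1.
Proof.
  intros Ha Hz. assert (H := bfactor_mod a z Ha (Req_le _ _ Hz)).
  rewrite Hz in H. replace (1 - 1 ^ 2) with 0 in H by ring.
  rewrite Rmult_0_r in H. unfold Rdiv in H. rewrite Rmult_0_l in H.
  generalize (Cmod_ge_0 (bfactor a z)). nra.
Qed.

Lemma bfactor_disk (a z : C) : Cmod a < 1 -> Cmod z < 1 -> Cmod (bfactor a z) < 1.
Proof.
  intros Ha Hz. assert (H := bfactor_mod a z Ha (Rlt_le _ _ Hz)).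
  assert (Hd := bfactor_den a z (disk_mult_lt_1 a z Ha (Rlt_le _ _ Hz))).
  apply Cmod_gt_0 in Hd.
  assert (0 < 1 - Cmod (bfactor a z) ^ 2).
  { rewrite H. apply Rdiv_lt_0_compat; [|now apply pow_lt].
    apply Rmult_lt_0_compat; apply sqr_lt_1; split; auto using Cmod_ge_0. }
  generalize (Cmod_ge_0 (bfactor a z)). nra.
Qed.

Lemma bfactor_closed_disk (a z : C) : Cmod a < 1 -> Cmod z <= 1 -> Cmod (bfactor a z) <= 1.
Proof.
  intros Ha [Hz|Hz]; [apply Rlt_le; now apply bfactor_disk|right; now apply bfactor_circle].
Qed.

Lemma bfactor_inv (a z : C) : Cmod a < 1 -> Cmod z <= 1 ->
  bfactor (- a) (bfactor a z) = z.
Proof.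
  intros Ha Hz. assert (Hd := bfactor_den a z (disk_mult_lt_1 a z Ha Hz)).
  assert (Ha2 : (1 - Cconj a * a)%C <> 0)
    by (apply bfactor_den, disk_mult_lt_1; auto; lra).
  unfold bfactor. rewrite Copp_conj. field. split; auto.
  intros E. apply Ha2. rewrite <- E. ring.
Qed.

Lemma bfactor_0 (a : C) : bfactor a 0 = (- a)%C.
Proof.
  unfold bfactor. field.
Qed.

Lemma bfactor_self (a : C) : bfactor a a = 0.
Proof. unfold bfactor. unfold Cdiv. ring. Qed.

Lemma hcd_bfactor (a : C) : Cmod a < 1 -> hcd (bfactor a).
Proof.
  intros Ha. apply hcd_mult.
  - apply hcd_minus; [apply hcd_id|apply hcd_const].
  - apply hcd_inv.
    + apply hcd_minus; [apply hcd_const|].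
      apply hcd_mult; [apply hcd_const|apply hcd_id].
    + intros z Hz. now apply bfactor_den, disk_mult_lt_1.
Qed.

Lemma hcd_comp_bfactor (f : C -> C) (a : C) : hcd f -> Cmod a < 1 ->
  hcd (fun z => f (bfactor a z)).
Proof.
  intros Hf Ha. apply hcd_comp; auto using hcd_bfactor.
  intros z. now apply bfactor_closed_disk.
Qed.

Lemma maximum_modulus_center (f : C -> C) : hcd f ->
  (forall z, Cmod z = 1 -> Cmod (f z) <= 1) -> Cmod (f 0) <= 1.
Proof.
  intros Hf Hb. assert (Hc := hcd_ccont f Hf). rewrite <- tcoef_0 by auto.
  apply cmean_bound.
  - ccont_tac.
  - intros t _. simpl. rewrite Cmult_1_r. apply Hb, Cmod_cis.
Qed.

(** [bfactor (- z)] takes 0 to [z] and preserves the circle, so the mean value property at the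
    centre suffices. *)
Lemma maximum_modulus (f : C -> C) : hcd f ->
  (forall z, Cmod z = 1 -> Cmod (f z) <= 1) ->
  forall z, Cmod z <= 1 -> Cmod (f z) <= 1.
Proof.
  intros Hf Hb z [Hz|Hz]; auto.
  assert (Hz' : Cmod (- z) < 1) by now rewrite Cmod_opp.
  replace (f z) with ((fun w => f (bfactor (- z) w)) 0).
  - apply (maximum_modulus_center (fun w => f (bfactor (- z) w))).
    + now apply hcd_comp_bfactor.
    + intros w Hw. apply Hb. now apply bfactor_circle.
  - cbv beta. rewrite bfactor_0. f_equal. ring.
Qed.

(** The squares of the coefficients sum to at most 1, and the constant coefficient already uses all
    of it. *)
Lemma maximum_modulus_center_strict (f : C -> C) : hcd f ->
  (forall z, Cmod z = 1 -> Cmod (f z) <= 1) -> Cmod (f 0) = 1 ->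
  forall z, Cmod z <= 1 -> f z = f 0.
Proof.
  intros Hf Hb H0 z Hz. destruct (hcd_pseries f Hf) as [r [Hr Hs]].
  assert (Hk : forall k, tcoef f (S k) = 0).
  { intros k. apply Cmod_eq_0.
    assert (H := tcoef_square_sum_le f 1 Hf Hb (S (S k))).
    assert (H1 : Cmod (tcoef f 0) ^ 2 <= rsum (fun k => Cmod (tcoef f k) ^ 2) (S k)).
    { apply (rsum_term_le (fun k => Cmod (tcoef f k) ^ 2)); [intros; apply pow2_ge_0|lia]. }
    rewrite tcoef_0, H0 in H1 by auto.
    change (rsum (fun k => Cmod (tcoef f k) ^ 2) (S k) + Cmod (tcoef f (S k)) ^ 2 <= 1 ^ 2) in H.
    generalize (Cmod_ge_0 (tcoef f (S k))). nra. }
  apply (clim_unique (csum (fun k => tcoef f k * z ^ k)%C)).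
  - apply Hs. unfold ballC; lra.
  - apply clim_shift. apply clim_ext with (fun _ => f 0); [|apply clim_const].
    intros n. rewrite csum_shift, tcoef_0 by auto.
    rewrite (csum_ext _ (fun _ => 0 * 0)%C), csum_scal; [simpl; ring|].
    intros k _. rewrite Hk. ring.
Qed.

Lemma maximum_modulus_strict (f : C -> C) (z0 : C) : hcd f ->
  (forall z, Cmod z = 1 -> Cmod (f z) <= 1) -> Cmod z0 < 1 -> Cmod (f z0) = 1 ->
  forall z, Cmod z <= 1 -> f z = f z0.
Proof.
  intros Hf Hb Hz0 H0 z Hz.
  assert (Hz' : Cmod (- z0) < 1) by now rewrite Cmod_opp.
  set (g := fun w => f (bfactor (- z0) w)).
  assert (Hg0 : g 0 = f z0).
  { unfold g. rewrite bfactor_0. f_equal. ring. }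
  rewrite <- Hg0. rewrite <- (bfactor_inv z0 z) by auto.
  apply (maximum_modulus_center_strict g).
  - now apply hcd_comp_bfactor.
  - intros w Hw. apply Hb. now apply bfactor_circle.
  - now rewrite Hg0.
  - now apply bfactor_closed_disk.
Qed.

(** * From an arc to a Blaschke product *)

Lemma bfactor_eq_0 (a z : C) : Cmod a < 1 -> Cmod z <= 1 -> bfactor a z = 0 -> z = a.
Proof.
  intros Ha Hz E. rewrite <- (bfactor_inv a z), E, bfactor_0 by auto. ring.
Qed.

Lemma pseries_zero (a : nat -> C) (z l : C) :
  (forall k, a k = 0) -> pseries a z l -> l = 0.
Proof.
  intros Ha Hl. apply (clim_unique _ _ _ Hl).
  apply clim_ext with (fun _ => RtoC 0); [|apply clim_const].
  intros n. rewrite (csum_ext _ (fun _ => 0 * 0)%C), csum_scal; [ring|].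
  intros k _. rewrite Ha. ring.
Qed.

Lemma holo_zero (R0 : R) (f : C -> C) : 0 < R0 -> holo (ballC R0) f ->
  (forall d, 0 < d -> exists z, 0 < Cmod z < d /\ f z = 0) ->
  forall z, ballC R0 z -> f z = 0.
Proof.
  intros HR Hf H z Hz. destruct (Taylor R0 f HR Hf) as [a Ha].
  apply (pseries_zero a z); auto.
  intros k. now apply (pseries_zeros R0 k HR a f).
Qed.

Definition nonconstant (f : C -> C) : Prop :=
  exists z1 z2, Cmod z1 <= 1 /\ Cmod z2 <= 1 /\ f z1 <> f z2.

Lemma hcd_locally_constant (f : C -> C) (c : C) (d : R) : hcd f -> 0 < d ->
  (forall z, Cmod z < d -> f z = c) -> ~ nonconstant f.
Proof.
  intros [r [Hr Hf]] Hd Hc [z1 [z2 [H1 [H2 H]]]].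
  assert (E : forall z, ballC r z -> (f z - c)%C = 0).
  { apply holo_zero; [lra| |].
    - apply holo_minus; auto. apply holo_const.
    - intros e He. exists (RtoC (Rmin d e / 2)).
      assert (Hm : 0 < Rmin d e) by now apply Rmin_pos.
      assert (Hd' := Rmin_l d e). assert (He' := Rmin_r d e).
      assert (Ht : Cmod (RtoC (Rmin d e / 2)) = Rmin d e / 2)
        by (rewrite Cmod_R, Rabs_pos_eq; lra).
      rewrite Ht. split; [lra|]. rewrite Hc; [ring|]. rewrite Ht; lra. }
  assert (E' : forall z, Cmod z <= 1 -> f z = c).
  { intros z Hz. apply Cminus_eq_0. rewrite E; [apply Cmod_0|]. unfold ballC; lra. }
  apply H. now rewrite !E'.
Qed.

Lemma self_map_disk (f : C -> C) : hcd f -> nonconstant f ->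
  (forall z, Cmod z = 1 -> Cmod (f z) <= 1) ->
  forall z, Cmod z < 1 -> Cmod (f z) < 1.
Proof.
  intros Hf Hn Hb z Hz.
  destruct (maximum_modulus f Hf Hb z (Rlt_le _ _ Hz)) as [H|H]; auto.
  exfalso. apply (hcd_locally_constant f (f z) 1 Hf Rlt_0_1); auto.
  intros y Hy. apply maximum_modulus_strict; auto. lra.
Qed.

(** Composition with a nonconstant [f] is injective. It is enough that values of [f] accumulate at
    [f 0]: otherwise continuity would make [f] constant near 0. Moving [f 0] to the origin by an
    automorphism brings the identity theorem into its form at 0. *)
Lemma identity_composition (f d : C -> C) : hcd f -> nonconstant f ->
  (forall z, Cmod z <= 1 -> Cmod (f z) <= 1) ->
  (forall z, Cmod z < 1 -> Cmod (f z) < 1) -> holo (ballC 1) d ->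
  (forall z, Cmod z < 1 -> d (f z) = 0) -> forall z, Cmod z < 1 -> d z = 0.
Proof.
  intros Hf Hn Hcl Hm Hd H0 z Hz.
  assert (Hp : Cmod (f 0) < 1) by (apply Hm; rewrite Cmod_0; lra).
  set (p := f 0) in *.
  assert (Hp' : Cmod (- p) < 1) by now rewrite Cmod_opp.
  set (g := fun w => d (bfactor (- p) w)).
  assert (Hg : holo (ballC 1) g).
  { apply (holo_comp (ballC 1) (ballC 1) d (bfactor (- p))); auto.
    - destruct (hcd_bfactor (- p) Hp') as [r [Hr Hh]].
      apply holo_subset with (2 := Hh). intros w. apply ballC_mono; lra.
    - intros w Hw. now apply bfactor_disk. }
  assert (Hacc : forall e, 0 < e -> exists w, 0 < Cmod w < e /\ g w = 0).
  { intros e He. apply NNPP. intros Hno.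
    assert (Hb : hcd (fun y => bfactor p (f y))).
    { apply hcd_comp; auto using hcd_bfactor. }
    destruct (hcd_continuous _ 0 Hb) with (eps := e) as [r [Hr Hc]]; auto.
    { rewrite Cmod_0; lra. }
    apply (hcd_locally_constant f p (Rmin r 1) Hf); auto.
    { apply Rmin_pos; lra. }
    intros y Hy.
    assert (Hyr : Cmod y < r) by (apply Rlt_le_trans with (1 := Hy), Rmin_l).
    assert (Hy1 : Cmod y < 1) by (apply Rlt_le_trans with (1 := Hy), Rmin_r).
    apply (bfactor_eq_0 p (f y)); auto using Rlt_le.
    apply NNPP. intros Hny. apply Hno. exists (bfactor p (f y)). split.
    - split; [now apply Cmod_gt_0|].
      specialize (Hc y). fold p in Hc. rewrite bfactor_self in Hc.
      replace (bfactor p (f y) - 0)%C with (bfactor p (f y)) in Hc by ring.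
      replace (y - 0)%C with y in Hc by ring. auto.
    - unfold g. rewrite bfactor_inv; auto using Rlt_le. }
  rewrite <- (bfactor_inv p z) by auto using Rlt_le.
  apply (holo_zero 1 g Rlt_0_1 Hg Hacc). now apply bfactor_disk.
Qed.

(** * Reflection in the circle and propagation from an arc *)

Lemma cis_lipschitz (s t : R) : Cmod (cis s - cis t) <= 2 * Rabs (s - t).
Proof.
  apply Rle_trans with (1 := Cmod_le_re_im _). rewrite Re_minus, Im_minus.
  assert (H1 : Rabs (cos s - cos t) <= 1 * Rabs (s - t)).
  { apply bounded_variation with (fun x => - sin x). intros x _. split.
    - apply is_derive_cos.
    - rewrite Rabs_Ropp. apply Rabs_le. apply SIN_bound. }
  assert (H2 : Rabs (sin s - sin t) <= 1 * Rabs (s - t)).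
  { apply bounded_variation with cos. intros x _. split.
    - apply is_derive_sin.
    - apply Rabs_le. apply COS_bound. }
  unfold cis, Re, Im; simpl. lra.
Qed.

Lemma circle_cis (z : C) : Cmod z = 1 -> exists t, - PI <= t <= PI /\ z = cis t.
Proof.
  destruct z as [x y]. intros H.
  assert (H2 : x ^ 2 + y ^ 2 = 1).
  { generalize (Cmod2_alt (x, y)). rewrite H. unfold Re, Im; simpl. lra. }
  assert (Hx : -1 <= x <= 1) by nra.
  assert (Hb := acos_bound x).
  assert (Hs : sqrt (1 - Rsqr x) = Rabs y).
  { replace (1 - Rsqr x) with (Rsqr y) by (unfold Rsqr; lra). apply sqrt_Rsqr_abs. }
  destruct (Rle_lt_dec 0 y) as [Hy|Hy].
  - exists (acos x). split; [lra|]. unfold cis.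
    rewrite cos_acos, sin_acos, Hs, Rabs_pos_eq; auto.
  - exists (- acos x). split; [lra|]. unfold cis.
    rewrite cos_neg, sin_neg, cos_acos, sin_acos, Hs, Rabs_left; auto.
    f_equal. ring.
Qed.

Lemma cis_inj_small (s t : R) : Rabs (s - t) <= 1 -> cis s = cis t -> s = t.
Proof.
  intros H E. injection E as Ec Es.
  assert (H1 : cos (Rabs (s - t)) = cos 0).
  { rewrite cos_0. unfold Rabs. destruct (Rcase_abs (s - t)).
    - rewrite cos_neg, cos_minus, Ec, Es. generalize (sin2_cos2 t). unfold Rsqr; lra.
    - rewrite cos_minus, Ec, Es. generalize (sin2_cos2 t). unfold Rsqr; lra. }
  destruct (Rabs_pos (s - t)) as [Hp|Hp].
  - exfalso. assert (HPI := PI_RGT_0). assert (HP2 := PI2_1).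
    assert (cos (Rabs (s - t)) < cos 0) by (apply cos_decreasing_1; lra). lra.
  - symmetry in Hp. apply Rabs_eq_0 in Hp. lra.
Qed.

Lemma cderiv_conj (f : C -> C) (z d : C) :
  cderiv f (Cconj z) d -> cderiv (fun y => Cconj (f (Cconj y))) z (Cconj d).
Proof.
  intros H eps He. destruct (H eps He) as [r [Hr Hh]]. exists r. split; auto.
  intros h Hl. specialize (Hh (Cconj h)). rewrite Cmod_conj in Hh.
  rewrite <- Cmod_conj, !Cminus_conj, Cmult_conj, !Cconj_conj, Cplus_conj. auto.
Qed.

Lemma holo_conj (R0 : R) (f : C -> C) : holo (ballC R0) f ->
  holo (ballC R0) (fun y => Cconj (f (Cconj y))).
Proof.
  intros [f' Hf]. exists (fun y => Cconj (f' (Cconj y))). intros z Hz.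
  assert (Hz' : ballC R0 (Cconj z)) by (unfold ballC; now rewrite Cmod_conj).
  destruct (Hf _ Hz') as [H1 H2]. split.
  - now apply cderiv_conj.
  - apply continuous_Cconj.
    apply (continuous_comp (V := C_UniformSpace) (W := C_UniformSpace) Cconj f'); auto.
    apply continuous_Cconj, continuous_id.
Qed.

(* Holomorphic near the circle, on which it equals [|f|^2]. *)
Definition reflect (f : C -> C) (z : C) : C := (f z * Cconj (f (Cconj (/ z))))%C.

Lemma reflect_circle (f : C -> C) (z : C) : Cmod z = 1 ->
  reflect f z = RtoC (Cmod (f z) ^ 2).
Proof.
  intros Hz. assert (Hz0 : z <> 0) by (apply Cmod_gt_0; lra).
  unfold reflect. replace (/ z)%C with (Cconj z).
  - now rewrite Cconj_conj, <- Cmod2_conj.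
  - assert (E := Cmod2_conj z). rewrite Hz in E.
    replace (RtoC (1 ^ 2)) with (RtoC 1) in E by (f_equal; ring).
    rewrite <- (Cmult_1_l (/ z)), E. field; auto.
Qed.

(** [reflect f] lives on the annulus [/ r < |z| < r]. The radius [1 - / r] is the distance from the
    unit circle to its inner edge, and it does not exceed the distance [r - 1] to the outer one. *)
Lemma reflect_translate_holo (f : C -> C) (r : R) (zeta : C) :
  1 < r -> holo (ballC r) f -> Cmod zeta = 1 ->
  holo (ballC (1 - / r)) (fun w => reflect f (zeta + w)%C).
Proof.
  intros Hr Hf Hz.
  assert (Hr' : 0 < / r < 1).
  { split; [apply Rinv_0_lt_compat; lra|].
    rewrite <- Rinv_1. apply Rinv_lt_contravar; lra. }
  assert (Hlow : forall w, ballC (1 - / r) w -> / r < Cmod (zeta + w)).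
  { intros w Hw. unfold ballC in Hw. generalize (Cmod_le_minus zeta (- w)).
    rewrite Cmod_opp. replace (zeta - - w)%C with (zeta + w)%C by ring. lra. }
  assert (Hshift : holo (ballC (1 - / r)) (fun w => zeta + w)%C)
    by (apply holo_plus; [apply holo_const|apply holo_id]).
  assert (Hne : forall w, ballC (1 - / r) w -> (zeta + w)%C <> 0).
  { intros w Hw. apply Cmod_gt_0. specialize (Hlow w Hw). lra. }
  apply holo_mult.
  - apply holo_comp with (ballC r); auto. intros w Hw. unfold ballC in *.
    apply Rle_lt_trans with (1 := Cmod_triangle _ _).
    assert (1 - / r <= r - 1).
    { apply Rmult_le_reg_r with r; [lra|].
      rewrite Rmult_minus_distr_r, Rinv_l by lra. nra. }
    lra.
  - apply (holo_comp _ (ballC r) (fun y => Cconj (f (Cconj y))) (fun w => / (zeta + w))%C).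
    + now apply holo_conj.
    + now apply holo_inv.
    + intros w Hw. unfold ballC. rewrite Cmod_inv by auto.
      rewrite <- (Rinv_inv r). apply Rinv_lt_contravar; auto.
      apply Rmult_lt_0_compat; [lra|]. specialize (Hlow w Hw). lra.
Qed.

(** The identity theorem is carried around the circle along overlapping disks of the fixed radius
    [d = 1 - / r], so boundedly many steps reach any angle. *)
Lemma reflect_propagate (f : C -> C) (r : R) : 1 < r -> holo (ballC r) f ->
  forall t0, (forall d, 0 < d -> exists w, 0 < Cmod w < d /\ reflect f (cis t0 + w)%C = 1) ->
  forall t w, ballC (1 - / r) w -> reflect f (cis t + w)%C = 1.
Proof.
  intros Hr Hf t0 H0.
  assert (Hr' : 0 < / r < 1).
  { split; [apply Rinv_0_lt_compat; lra|].
    rewrite <- Rinv_1. apply Rinv_lt_contravar; lra. }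
  set (d := 1 - / r).
  assert (Hd : 0 < d) by (unfold d; lra).
  assert (Hacc : forall t, (forall e, 0 < e -> exists w, 0 < Cmod w < e /\
      reflect f (cis t + w)%C = 1) -> forall w, ballC d w -> reflect f (cis t + w)%C = 1).
  { intros t Ht w Hw. apply Cminus_eq_0.
    rewrite (holo_zero d (fun w => reflect f (cis t + w) - 1)%C); auto using Cmod_0.
    - apply holo_minus; [|apply holo_const].
      apply reflect_translate_holo; auto using Cmod_cis.
    - intros e He. destruct (Ht e He) as [y [Hy E]]. exists y. split; auto.
      rewrite E. ring. }
  (* An angle of [d / 4] moves the centre by at most [d / 2], and points within [d / 4] of the new
     centre still lie in the old disk; they accumulate at the new centre. *)
  assert (Hstep : forall s t, Rabs (t - s) <= d / 4 ->
     (forall w, ballC d w -> reflect f (cis s + w)%C = 1) ->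
     forall w, ballC d w -> reflect f (cis t + w)%C = 1).
  { intros s t Hst Hs. apply Hacc. intros e He.
    set (x := Rmin e (d / 2) / 2).
    assert (Hx : 0 < x < e /\ x <= d / 4).
    { assert (0 < Rmin e (d / 2)) by (apply Rmin_pos; lra).
      generalize (Rmin_l e (d / 2)) (Rmin_r e (d / 2)). unfold x; lra. }
    exists (RtoC x). rewrite Cmod_R, Rabs_pos_eq by lra. split; [lra|].
    replace (cis t + x)%C with (cis s + (cis t - cis s + x))%C by ring.
    apply Hs. unfold ballC. apply Rle_lt_trans with (1 := Cmod_triangle _ _).
    rewrite Cmod_R, Rabs_pos_eq by lra. generalize (cis_lipschitz t s). lra. }
  assert (Hind : forall n t, Rabs (t - t0) <= INR n * (d / 4) ->
     forall w, ballC d w -> reflect f (cis t + w)%C = 1).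
  { induction n as [|n IH]; intros t Ht.
    - simpl in Ht. rewrite Rmult_0_l in Ht.
      replace t with t0; auto.
      assert (E : t - t0 = 0); [|lra]. apply Rabs_eq_0. apply Rle_antisym; auto. apply Rabs_pos.
    - rewrite S_INR in Ht. assert (Hn := pos_INR n).
      (* The angle is cut into [n + 1] equal steps, and [s] is the last but one point. *)
      set (s := t0 + (t - t0) * (INR n / (INR n + 1))).
      apply (Hstep s).
      + replace (t - s) with ((t - t0) * / (INR n + 1)) by (unfold s; field; lra).
        rewrite Rabs_mult, (Rabs_pos_eq (/ _)) by (apply Rlt_le, Rinv_0_lt_compat; lra).
        apply Rmult_le_reg_r with (INR n + 1); [lra|].
        rewrite Rmult_assoc, Rinv_l by lra. lra.
      + apply IH.
        replace (s - t0) with ((t - t0) * (INR n / (INR n + 1))) by (unfold s; ring).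
        assert (Hq : 0 <= INR n / (INR n + 1)).
        { apply Rmult_le_pos; auto. apply Rlt_le, Rinv_0_lt_compat; lra. }
        rewrite Rabs_mult, (Rabs_pos_eq (_ / _)) by auto.
        apply Rle_trans with ((INR n + 1) * (d / 4) * (INR n / (INR n + 1))).
        * now apply Rmult_le_compat_r.
        * right. field. lra. }
  intros t. destruct (INR_unbounded (Rabs (t - t0) / (d / 4))) as [n Hn].
  apply (Hind n). apply Rlt_le in Hn.
  apply Rmult_le_compat_r with (r := d / 4) in Hn; [|lra].
  unfold Rdiv at 1 in Hn. rewrite Rmult_assoc, Rinv_l in Hn by lra. lra.
Qed.

(** Infinitely many distinct points of the arc have preimages on the circle, and the angles of these
    have a limit point by compactness of [[- PI, PI]]. At each preimage [f], hence [reflect f], has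
    modulus 1. *)
Lemma arc_accumulation (f : C -> C) (A : C -> Prop) : arc A ->
  (forall y, A y -> image f circle y) ->
  exists t0, forall d, 0 < d -> exists w, 0 < Cmod w < d /\ reflect f (cis t0 + w)%C = 1.
Proof.
  intros [a [b [Hab HA]]] Himg.
  (* Length at most 1 keeps the sampled angles in the range where [cis] is injective. *)
  set (L := Rmin (b - a) 1).
  assert (HL : 0 < L <= 1 /\ L <= b - a).
  { unfold L. split; [split|].
    - apply Rmin_pos; lra.
    - apply Rmin_r.
    - apply Rmin_l. }
  set (th := fun n : nat => a + L * / (INR n + 1)).
  assert (Hth : forall n, 0 < / (INR n + 1) <= 1).
  { intros n. assert (Hn := pos_INR n). split; [apply Rinv_0_lt_compat; lra|].
    rewrite <- Rinv_1. apply Rinv_le_contravar; lra. }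
  assert (Hpre : forall n, exists t, - PI <= t <= PI /\ f (cis t) = cis (th n)).
  { intros n. destruct (Himg (cis (th n))) as [z [Hz E]].
    - apply HA. exists (th n). split; auto. specialize (Hth n). unfold th. nra.
    - destruct (circle_cis z Hz) as [t [Ht ->]]. now exists t. }
  set (u := fun n => proj1_sig (constructive_indefinite_description _ (Hpre n))).
  assert (Hu : forall n, - PI <= u n <= PI /\ f (cis (u n)) = cis (th n))
    by (intros n; unfold u; apply proj2_sig).
  assert (Hinj : forall n m, n <> m -> cis (th n) <> cis (th m)).
  { intros n m Hnm E. apply Hnm. apply INR_eq.
    assert (Hn := Hth n). assert (Hm := Hth m).
    assert (E' : th n = th m).
    { apply cis_inj_small; auto. unfold th.
      replace (a + L * / (INR n + 1) - (a + L * / (INR m + 1))) with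
        (L * (/ (INR n + 1) - / (INR m + 1))) by ring.
      rewrite Rabs_mult, Rabs_pos_eq by lra.
      assert (Rabs (/ (INR n + 1) - / (INR m + 1)) <= 1) by (apply Rabs_le; lra).
      generalize (Rabs_pos (/ (INR n + 1) - / (INR m + 1))). nra. }
    unfold th in E'. apply Rplus_eq_reg_l, Rmult_eq_reg_l in E'; [|lra].
    apply (f_equal Rinv) in E'. rewrite !Rinv_inv in E'. lra. }
  destruct (Bolzano_Weierstrass u _ (compact_P3 (- PI) PI)) as [l Hl].
  { intros n. apply Hu. }
  exists l. intros d Hd.
  assert (Hd4 : 0 < d / 4) by lra.
  assert (Hnear : forall N, exists p, (N <= p)%nat /\ Cmod (cis (u p) - cis l) < d).
  { intros N. destruct (Hl (fun x => Rabs (x - l) < d / 4) N) as [p [Hp Hpl]].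
    - exists (mkposreal _ Hd4). intros x Hx. exact Hx.
    - exists p. split; auto. generalize (cis_lipschitz (u p) l). lra. }
  assert (Hgood : forall p, cis (u p) <> cis l -> Cmod (cis (u p) - cis l) < d ->
     exists w, 0 < Cmod w < d /\ reflect f (cis l + w)%C = 1).
  { intros p Hp Hpd. exists (cis (u p) - cis l)%C. split.
    - split; auto. apply Cmod_gt_0. intros E. apply Hp.
      apply Cminus_eq_0. now rewrite E, Cmod_0.
    - replace (cis l + (cis (u p) - cis l))%C with (cis (u p)) by ring.
      rewrite reflect_circle by apply Cmod_cis.
      rewrite (proj2 (Hu p)), Cmod_cis. f_equal. ring. }
  destruct (Hnear O) as [p [_ Hp]].
  (* A preimage near the limit may be the limit itself. A second one with another index cannot be,
     since their images under [f] differ. *)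
  destruct (classic (cis (u p) = cis l)) as [E|E]; [|now apply (Hgood p)].
  destruct (Hnear (S p)) as [p' [Hpp' Hp']].
  apply (Hgood p'); auto. intros E'.
  apply (Hinj p' p); [lia|]. rewrite <- (proj2 (Hu p)), <- (proj2 (Hu p')). congruence.
Qed.

(** Where [reflect f] equals 1, [f] cannot vanish. This holds on disks around all points of the
    circle, hence also on a ring inside it, which keeps the zeros of [f] away from the circle. *)
Lemma unimodular_of_arc (f : C -> C) (A : C -> Prop) : hcd f -> arc A ->
  (forall y, A y -> image f circle y) ->
  (forall z, Cmod z = 1 -> Cmod (f z) = 1) /\
  exists r0, 0 < r0 < 1 /\ forall z, r0 <= Cmod z <= 1 -> f z <> 0.
Proof.
  intros [r [Hr Hf]] HA Himg.
  destruct (arc_accumulation f A HA Himg) as [t0 Ht0].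
  assert (H := reflect_propagate f r Hr Hf t0 Ht0).
  assert (Hr' : 0 < / r < 1).
  { split; [apply Rinv_0_lt_compat; lra|].
    rewrite <- Rinv_1. apply Rinv_lt_contravar; lra. }
  split.
  - intros z Hz. destruct (circle_cis z Hz) as [t [_ ->]].
    assert (E := H t 0). rewrite Cplus_0_r, reflect_circle in E by apply Cmod_cis.
    assert (E2 : Cmod (f (cis t)) ^ 2 = 1).
    { apply RtoC_inj. apply E. unfold ballC. rewrite Cmod_0; lra. }
    generalize (Cmod_ge_0 (f (cis t))). nra.
  - exists ((1 + / r) / 2). split; [lra|]. intros z Hz E.
    assert (Hm : RtoC (Cmod z) <> 0) by (apply RtoC_neq_0; lra).
    assert (Hz1 : Cmod (z / Cmod z) = 1).
    { rewrite Cmod_div, Cmod_R, Rabs_pos_eq by (auto; lra). field; lra. }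
    destruct (circle_cis _ Hz1) as [t [_ Ht]].
    assert (E' := H t (z - cis t)%C).
    replace (cis t + (z - cis t))%C with z in E' by ring.
    unfold reflect in E'. rewrite E in E'.
    assert (E2 : RtoC 0 = RtoC 1).
    { rewrite <- E'; [ring|]. unfold ballC. rewrite <- Ht.
      replace (z - z / Cmod z)%C with ((z / Cmod z) * (Cmod z - 1)%R)%C.
      - rewrite Cmod_mult, Hz1, Cmod_R, Rabs_left1; lra.
      - rewrite RtoC_minus. field; auto. }
    apply RtoC_inj in E2. lra.
Qed.

(** After an automorphism the zero is at the origin, where dividing by the variable shifts the
    Taylor coefficients. *)
Lemma bfactor_divide (f : C -> C) (a : C) : hcd f -> Cmod a < 1 -> f a = 0 ->
  exists g, hcd g /\ forall z, Cmod z <= 1 -> f z = (bfactor a z * g z)%C.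
Proof.
  intros Hf Ha Hfa.
  assert (Ha' : Cmod (- a) < 1) by now rewrite Cmod_opp.
  set (F := fun w => f (bfactor (- a) w)).
  assert (HF : hcd F) by now apply hcd_comp_bfactor.
  assert (HF0 : F 0 = 0).
  { unfold F. rewrite bfactor_0. now replace (- - a)%C with a by ring. }
  destruct (hcd_pseries F HF) as [r [Hr Hs]].
  set (h := fun w => if excluded_middle_informative (w = RtoC 0) then tcoef F 1
                     else (F w / w)%C).
  assert (Hh : hcd h).
  { exists r. split; auto. apply pseries_holo with (fun k => tcoef F (S k)).
    intros w Hw. unfold h. destruct (excluded_middle_informative (w = RtoC 0)) as [->|Hw0].
    - apply (pseries_at_0 (fun k => tcoef F (S k))).
    - replace (F w) with (F w - tcoef F 0)%C.
      + apply pseries_tail; auto.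
      + rewrite tcoef_0, HF0 by auto. ring. }
  exists (fun z => h (bfactor a z)). split.
  - now apply hcd_comp_bfactor.
  - intros z Hz.
    assert (E : F (bfactor a z) = f z) by (unfold F; now rewrite bfactor_inv).
    rewrite <- E. unfold h.
    destruct (excluded_middle_informative (bfactor a z = RtoC 0)) as [E0|E0].
    + rewrite E0, HF0. ring.
    + field; auto.
Qed.

(* Each Blaschke factor removed multiplies [|f z0|] by at least [1 / q], so their
   number is bounded. *)
Lemma Blaschke_of_unimodular (r0 q : R) (z0 : C) : Cmod z0 < 1 -> r0 <= 1 ->
  0 < q -> (forall a, Cmod a < r0 -> Cmod (bfactor a z0) <= q) ->
  forall n f, hcd f -> (forall z, Cmod z = 1 -> Cmod (f z) = 1) ->
  (forall z, r0 <= Cmod z <= 1 -> f z <> 0) -> q ^ n < Cmod (f z0) ->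
  finite_Blaschke_product f.
Proof.
  intros Hz0 Hr0 Hq0 Hq. induction n as [|n IH]; intros f Hf Hu Hnz Hn.
  { simpl in Hn. generalize (maximum_modulus f Hf) (Hu). intros H _.
    specialize (H (fun z Hz => Req_le _ _ (Hu z Hz)) z0 (Rlt_le _ _ Hz0)). lra. }
  destruct (classic (exists a, Cmod a < 1 /\ f a = 0)) as [[a [Ha Hfa]]|Hno].
  - assert (Har : Cmod a < r0).
    { apply Rnot_le_lt. intros H. apply (Hnz a); auto. lra. }
    destruct (bfactor_divide f a Hf Ha Hfa) as [g [Hg E]].
    destruct (IH g) as [c [zs [Hc [Hzs Hp]]]]; auto.
    + intros z Hz. specialize (Hu z Hz).
      rewrite (E z (Req_le _ _ Hz)), Cmod_mult, bfactor_circle in Hu by auto. lra.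
    + intros z Hz Hgz. apply (Hnz z Hz). rewrite E, Hgz by lra. ring.
    + rewrite E, Cmod_mult in Hn by lra. simpl in Hn.
      specialize (Hq a Har). assert (Hg0 := Cmod_ge_0 (g z0)).
      apply Rmult_lt_reg_l with q; auto. apply Rlt_le_trans with (1 := Hn).
      now apply Rmult_le_compat_r.
    + exists c, (a :: zs). split; [|split]; auto.
      intros z Hz. rewrite E, Hp by auto. simpl. unfold bfactor. ring.
  (* Without zeros, the maximum principle applies to [f] and to [1 / f]. Both are bounded by 1 at
     the centre, so [|f 0| = 1] and [f] is constant. *)
  - assert (Hne : forall z, Cmod z <= 1 -> f z <> 0).
    { intros z [Hz|Hz] E.
      - apply Hno. now exists z.
      - apply (f_equal Cmod) in E. rewrite Cmod_0, Hu in E by auto. lra. }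
    assert (H01 : Cmod 0 <= 1) by (rewrite Cmod_0; lra).
    assert (H1 : Cmod (f 0) <= 1).
    { apply maximum_modulus; auto. intros z Hz. apply Req_le; auto. }
    assert (H2 : Cmod (/ f 0) <= 1).
    { apply (maximum_modulus (fun z => / f z)%C); auto using hcd_inv.
      intros z Hz. rewrite Cmod_inv, Hu by (auto; apply Hne; lra). lra. }
    assert (H3 : Cmod (f 0) = 1).
    { rewrite Cmod_inv in H2 by auto.
      assert (Hp := proj1 (Cmod_gt_0 _) (Hne 0 H01)).
      apply Rmult_le_compat_r with (r := Cmod (f 0)) in H2; [|lra].
      rewrite Rinv_l in H2; lra. }
    exists (f 0), nil. split; [exact H3|]. split; [constructor|].
    intros z Hz. simpl. rewrite Cmult_1_r.
    apply maximum_modulus_center_strict; auto. intros y Hy. apply Req_le; auto.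
Qed.

Lemma Blaschke_of_arc (f : C -> C) (A : C -> Prop) : hcd f -> arc A ->
  (forall y, A y -> image f circle y) -> finite_Blaschke_product f.
Proof.
  intros Hf HA Himg.
  destruct (unimodular_of_arc f A Hf HA Himg) as [Hu [r0 [Hr0 Hnz]]].
  set (z0 := RtoC r0).
  assert (Hz0 : Cmod z0 = r0) by (unfold z0; rewrite Cmod_R; apply Rabs_pos_eq; lra).
  (* At [z0 = r0], where [f] is nonzero, a factor with [|a| < r0] satisfies [1 - |bfactor a z0|^2 =
     (1 - |a|^2)(1 - r0^2) / |1 - Cconj a z0|^2]. The numerator is at least [(1 - r0^2)^2] and the
     denominator at most 4. *)
  set (e := (1 - r0 ^ 2) ^ 2 / 4).
  assert (Hr2 : 0 < 1 - r0 ^ 2 <= 1) by nra.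
  assert (He : 0 < e < 1).
  { unfold e. assert (0 < (1 - r0 ^ 2) ^ 2) by (apply pow_lt; lra).
    assert ((1 - r0 ^ 2) ^ 2 <= 1) by nra. lra. }
  set (q := sqrt (1 - e)).
  assert (Hq2 : q ^ 2 = 1 - e) by (unfold q; apply pow2_sqrt; lra).
  assert (Hq0 : 0 < q) by (apply sqrt_lt_R0; lra).
  assert (Hq1 : q < 1) by nra.
  assert (Hpos : 0 < Cmod (f z0)) by (apply Cmod_gt_0, Hnz; lra).
  destruct (pow_lt_1_zero q) with (y := Cmod (f z0)) as [n Hn]; auto.
  { rewrite Rabs_pos_eq; lra. }
  specialize (Hn n (Nat.le_refl n)). rewrite Rabs_pos_eq in Hn by (apply pow_le; lra).
  apply (Blaschke_of_unimodular r0 q z0) with n; auto; try lra.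
  intros a Ha.
  assert (Ha0 := Cmod_ge_0 a).
  assert (Ha1 : Cmod a < 1) by lra.
  assert (Hmod := bfactor_mod a z0 Ha1).
  assert (Hd : (1 - Cconj a * z0)%C <> 0).
  { apply bfactor_den, disk_mult_lt_1; lra. }
  apply Cmod_gt_0 in Hd.
  assert (Hd2 : Cmod (1 - Cconj a * z0) <= 2).
  { apply Rle_trans with (1 := Cmod_minus_le _ _).
    rewrite Cmod_1, Cmod_mult, Cmod_conj, Hz0. nra. }
  assert (Hd4 : 0 < Cmod (1 - Cconj a * z0) ^ 2 <= 4) by nra.
  assert (Hlow : e <= 1 - Cmod (bfactor a z0) ^ 2).
  { rewrite Hmod, Hz0 by lra. unfold e.
    apply Rmult_le_reg_r with (Cmod (1 - Cconj a * z0) ^ 2); [lra|].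
    unfold Rdiv. rewrite (Rmult_assoc (_ * _)), Rinv_l, Rmult_1_r by lra.
    apply Rle_trans with ((1 - r0 ^ 2) ^ 2).
    - assert (0 <= (1 - r0 ^ 2) ^ 2) by apply pow2_ge_0. nra.
    - replace ((1 - r0 ^ 2) ^ 2) with ((1 - r0 ^ 2) * (1 - r0 ^ 2)) by ring.
      apply Rmult_le_compat_r; nra. }
  generalize (Cmod_ge_0 (bfactor a z0)). nra.
Qed.

(** * Regular weights and inner functions *)

(* A two-sided comparison that is invariant under [b -> 1/b], as the duality
   argument for the lower bound requires. *)
Definition regular (b : nat -> R) : Prop :=
  (forall n, 0 < b n) /\
  exists p : nat, forall n m, (n <= m)%nat ->
    b n * (INR n + 1) ^ p <= b m * (INR m + 1) ^ p /\
    b m * (INR n + 1) ^ p <= b n * (INR m + 1) ^ p.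

Lemma INR_1_pos (n : nat) : 0 < INR n + 1.
Proof. generalize (pos_INR n); lra. Qed.

Lemma regular_inv (b : nat -> R) : regular b -> regular (fun n => / b n).
Proof.
  intros [Hb [p Hp]]. split; [intros n; now apply Rinv_0_lt_compat|].
  exists p. intros n m Hnm. destruct (Hp n m Hnm) as [H1 H2].
  assert (E : forall x y u v, 0 < x -> 0 < y -> y * u <= x * v -> / x * u <= / y * v).
  { intros x y u v Hx Hy H. apply Rmult_le_reg_l with (x * y); [now apply Rmult_lt_0_compat|].
    replace (x * y * (/ x * u)) with (y * u) by (field; lra).
    replace (x * y * (/ y * v)) with (x * v) by (field; lra). easy. }
  split; apply E; auto.
Qed.

Lemma weight_lower_bound (w : nat -> R) : weight_sequence w ->
  exists c, 0 < c /\ forall k, (1 <= k)%nat -> c <= w k.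
Proof.
  intros [Hpos Hlim].
  assert (Hfin : forall N, exists c, 0 < c /\ forall k, (1 <= k < N)%nat -> c <= w k).
  { induction N as [|N [c [Hc H]]]; [exists 1; split; [lra|lia]|].
    destruct (Nat.eq_dec N 0) as [->|HN]; [exists 1; split; [lra|lia]|].
    exists (Rmin c (w N)). split.
    - apply Rmin_pos; auto. apply Hpos. lia.
    - intros k Hk. destruct (Nat.eq_dec k N) as [->|Hkn]; [apply Rmin_r|].
      apply Rle_trans with (1 := Rmin_l _ _). apply H. lia. }
  apply is_lim_seq_spec in Hlim. destruct (Hlim (mkposreal (/ 2) ltac:(lra))) as [N HN].
  destruct (Hfin N) as [c [Hc H]].
  exists (Rmin c (/ 2)). split; [apply Rmin_pos; lra|].
  intros k Hk. destruct (Nat.le_gt_cases N k) as [HNk|HNk].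
  - apply Rle_trans with (1 := Rmin_r _ _). specialize (HN k HNk). simpl in HN.
    apply Rabs_lt_between in HN. lra.
  - apply Rle_trans with (1 := Rmin_l _ _). apply H. lia.
Qed.

Lemma beta_pos (w : nat -> R) : weight_sequence w -> forall n, 0 < beta w n.
Proof.
  intros [Hpos _] n. induction n as [|n IH]; simpl; [lra|].
  apply Rmult_lt_0_compat; auto. apply Hpos. lia.
Qed.

Lemma beta_regular (w : nat -> R) :
  weight_sequence w -> polynomial_growth w -> regular (beta w).
Proof.
  intros Hw [M HM]. split; [now apply beta_pos|].
  destruct (weight_lower_bound w Hw) as [c [Hc Hcw]].
  (* By Bernoulli, [((k + 1) / k) ^ p >= 1 + p / k], to be compared with [|w k - 1| <= |M| / k]. The
     upper step uses [p >= |M|]; in the lower one [p / k] is multiplied by [w k >= c], hence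
     [p >= |M| / c]. *)
  destruct (INR_unbounded (Rabs M / c + Rabs M)) as [p Hp].
  assert (HMa := Rle_abs M). assert (HM0 := Rabs_pos M).
  assert (HMc : 0 <= Rabs M / c).
  { apply Rmult_le_pos; auto. apply Rlt_le, Rinv_0_lt_compat; auto. }
  assert (Hpc : Rabs M <= INR p * c).
  { apply Rle_trans with (Rabs M / c * c); [right; field; lra|].
    apply Rmult_le_compat_r; lra. }
  assert (Hstep : forall k, (1 <= k)%nat ->
     INR k ^ p <= w k * (INR k + 1) ^ p /\ w k * INR k ^ p <= (INR k + 1) ^ p).
  { intros k Hk.
    assert (Hk0 : 0 < INR k) by (apply lt_0_INR; lia).
    assert (Hkp : 0 < INR k ^ p) by now apply pow_lt.
    assert (HB : INR k ^ p * (1 + INR p / INR k) <= (INR k + 1) ^ p).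
    { replace (INR k + 1) with (INR k * (1 + / INR k)) by (field; lra).
      rewrite Rpow_mult_distr. apply Rmult_le_compat_l; [lra|].
      apply poly. now apply Rinv_0_lt_compat. }
    assert (Hwk := Hcw k Hk). specialize (HM k Hk).
    assert (Hd : Rabs (w k - 1) <= Rabs M / INR k).
    { apply Rmult_le_reg_r with (INR k); auto.
      unfold Rdiv. rewrite Rmult_assoc, Rinv_l, Rmult_1_r by lra.
      generalize (Rabs_pos (w k - 1)). nra. }
    apply Rabs_le_between in Hd.
    assert (Hi : 0 < / INR k) by now apply Rinv_0_lt_compat.
    split.
    - apply Rle_trans with (w k * (INR k ^ p * (1 + INR p / INR k))).
      + rewrite <- (Rmult_1_r (INR k ^ p)) at 1.
        rewrite <- Rmult_assoc, (Rmult_comm (w k)), Rmult_assoc.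
        apply Rmult_le_compat_l; [lra|].
        assert (Rabs M / INR k <= w k * (INR p / INR k)).
        { unfold Rdiv. rewrite <- Rmult_assoc. apply Rmult_le_compat_r; [lra|].
          apply Rle_trans with (1 := Hpc). rewrite Rmult_comm.
          apply Rmult_le_compat_r; auto using pos_INR. }
        lra.
      + apply Rmult_le_compat_l; auto. lra.
    - apply Rle_trans with (2 := HB). rewrite Rmult_comm.
      apply Rmult_le_compat_l; [lra|].
      assert (Rabs M / INR k <= INR p / INR k).
      { unfold Rdiv. apply Rmult_le_compat_r; lra. }
      lra. }
  exists p. intros n m Hnm. induction Hnm as [|m Hnm [IH1 IH2]]; [split; lra|].
  destruct (Hstep (S m)) as [H1 H2]; [lia|].
  assert (Hb := beta_pos w Hw). assert (Hbm := Hb m). assert (Hbn := Hb n).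
  rewrite S_INR in H1, H2 |- *. cbn [beta].
  assert (Hn1 : 0 < (INR n + 1) ^ p) by apply pow_lt, INR_1_pos.
  assert (Hm1 : 0 < (INR m + 1) ^ p) by apply pow_lt, INR_1_pos.
  split.
  - apply Rle_trans with (1 := IH1). rewrite Rmult_assoc. apply Rmult_le_compat_l; lra.
  - assert (Hw0 : 0 < w (S m)) by (apply Hw; lia).
    apply Rmult_le_reg_r with ((INR m + 1) ^ p); auto.
    replace (beta w m * w (S m) * (INR n + 1) ^ p * (INR m + 1) ^ p) with
      (beta w m * (INR n + 1) ^ p * (w (S m) * (INR m + 1) ^ p)) by ring.
    replace (beta w n * (INR m + 1 + 1) ^ p * (INR m + 1) ^ p) with
      (beta w n * (INR m + 1) ^ p * (INR m + 1 + 1) ^ p) by ring.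
    apply Rmult_le_compat; auto.
    + apply Rlt_le, Rmult_lt_0_compat; auto.
    + apply Rlt_le, Rmult_lt_0_compat; auto.
Qed.

Lemma regular_summable (b : nat -> R) (q : R) : regular b -> 0 <= q < 1 ->
  ex_series (fun k => (q ^ k) ^ 2 * b k ^ 2).
Proof.
  intros [Hb [p Hp]] Hq.
  apply (ex_series_le (V := R_CompleteNormedModule)) with
    (fun k => b O ^ 2 * ((INR k + 1) ^ (p * 2) * (q ^ 2) ^ k)).
  - intros k. unfold norm; simpl norm; unfold abs; simpl abs.
    rewrite Rabs_pos_eq.
    2:{ apply Rmult_le_pos; apply pow2_ge_0. }
    destruct (Hp O k) as [_ H]; [lia|]. simpl (INR 0) in H.
    rewrite Rplus_0_l, pow1, Rmult_1_r in H.
    replace (b O ^ 2 * ((INR k + 1) ^ (p * 2) * (q ^ 2) ^ k)) with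
      ((q ^ k) ^ 2 * (b O * (INR k + 1) ^ p) ^ 2).
    + apply Rmult_le_compat_l; [apply pow2_ge_0|]. apply pow_incr.
      split; auto. now apply Rlt_le.
    + rewrite Rpow_mult_distr, <- !pow_mult, (Nat.mul_comm k). ring.
  - apply (ex_series_scal (K := R_AbsRing) (V := R_NormedModule)).
    apply ex_series_poly_geom. split; [apply pow2_ge_0|]. nra.
Qed.

(** * Inner functions and the matrix of their powers *)

Definition inner (f : C -> C) : Prop :=
  hcd f /\ (forall z, Cmod z = 1 -> Cmod (f z) = 1) /\
  (forall z, Cmod z < 1 -> Cmod (f z) < 1).

Lemma inner_closed_disk (f : C -> C) (z : C) : inner f -> Cmod z <= 1 -> Cmod (f z) <= 1.
Proof.
  intros [_ [H1 H2]] [Hz|Hz]; [apply Rlt_le; auto|right; auto].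
Qed.

Lemma inner_bfactor (a : C) : Cmod a < 1 -> inner (bfactor a).
Proof.
  intros Ha. split; [now apply hcd_bfactor|].
  split; intros z Hz; [now apply bfactor_circle|now apply bfactor_disk].
Qed.

Lemma inner_comp (f g : C -> C) : inner f -> inner g -> inner (fun z => f (g z)).
Proof.
  intros Hf Hg. split.
  - apply hcd_comp; [apply Hf|apply Hg|]. intros z. now apply inner_closed_disk.
  - split; intros z Hz; apply Hf, Hg, Hz.
Qed.

Definition polyval (a : nat -> C) (N : nat) (z : C) : C := csum (fun n => a n * z ^ n)%C N.

Lemma hcd_polyval_comp (f : C -> C) (a : nat -> C) N : hcd f ->
  hcd (fun z => polyval a N (f z)).
Proof.
  intros Hf. apply (hcd_csum (fun n z => a n * f z ^ n)%C). intros n.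
  apply hcd_mult; [apply hcd_const|now apply hcd_pow].
Qed.

Lemma tcoef_polyval_comp (f : C -> C) (a : nat -> C) N m : hcd f ->
  tcoef (fun z => polyval a N (f z)) m
  = csum (fun n => a n * tcoef (fun z => f z ^ n)%C m)%C N.
Proof.
  intros Hf. assert (Hc := hcd_ccont f Hf). unfold tcoef.
  rewrite (cmean_ext _ (fun t => csum (fun n => a n * (f (cis t) ^ n * Cconj (cis t) ^ m))%C N)).
  - rewrite (cmean_csum (fun n t => a n * (f (cis t) ^ n * Cconj (cis t) ^ m))%C).
    + apply csum_ext. intros n _. apply cmean_scal. ccont_tac.
    + intros n. ccont_tac.
  - intros t _. unfold polyval. rewrite Cmult_comm, <- csum_scal.
    apply csum_ext. intros; ring.
Qed.

Definition gram (f : C -> C) (n k : nat) : C :=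
  cmean (fun t => f (cis t) ^ n * Cconj (f (cis t) ^ k))%C.

Lemma cmean_polyval_comp (f : C -> C) (a h : nat -> C) N : hcd f ->
  cmean (fun t => polyval a N (f (cis t)) * Cconj (polyval h N (f (cis t))))%C
  = csum (fun n => csum (fun k => a n * Cconj (h k) * gram f n k)%C N) N.
Proof.
  intros Hf. assert (Hc := hcd_ccont f Hf).
  rewrite (cmean_ext _ (fun t => csum (fun n => csum (fun k =>
     a n * Cconj (h k) * (f (cis t) ^ n * Cconj (f (cis t) ^ k)))%C N) N)).
  - rewrite (cmean_csum (fun n t => csum (fun k =>
      a n * Cconj (h k) * (f (cis t) ^ n * Cconj (f (cis t) ^ k)))%C N)).
    + apply csum_ext. intros n _.
      rewrite (cmean_csum (fun k t =>
        a n * Cconj (h k) * (f (cis t) ^ n * Cconj (f (cis t) ^ k)))%C).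
      * apply csum_ext. intros k _. unfold gram. rewrite <- cmean_scal by ccont_tac.
        apply cmean_ext. intros; ring.
      * intros k. ccont_tac.
    + intros n. apply (ccont_csum (fun k t =>
        a n * Cconj (h k) * (f (cis t) ^ n * Cconj (f (cis t) ^ k)))%C).
      intros k. ccont_tac.
  - intros t _. unfold polyval.
    rewrite csum_conj, Cmult_comm, <- csum_scal. apply csum_ext. intros n _.
    rewrite Cmult_comm, <- csum_scal. apply csum_ext. intros k _.
    rewrite Cmult_conj. ring.
Qed.

(** On the circle [|f| = 1], so the integrand is [f ^ (n - k)], whose mean is its value at 0. *)
Lemma gram_le (f : C -> C) (n k : nat) : inner f -> (k <= n)%nat ->
  gram f n k = (f 0 ^ (n - k))%C.
Proof.
  intros [Hf [Hu _]] Hkn. assert (Hc := hcd_ccont f Hf).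
  change (f 0 ^ (n - k))%C with ((fun z => f z ^ (n - k))%C 0).
  rewrite <- tcoef_0 by now apply hcd_pow.
  apply cmean_ext. intros t _. simpl (Cconj (cis t) ^ 0)%C. rewrite Cmult_1_r.
  assert (E : (f (cis t) * Cconj (f (cis t)))%C = 1).
  { rewrite <- Cmod2_conj, Hu by apply Cmod_cis. f_equal. ring. }
  replace n with ((n - k) + k)%nat at 1 by lia.
  rewrite Cpow_add_r, Cpow_conj, <- Cmult_assoc, <- Cpow_mult_l, E, Cpow_1_l. ring.
Qed.

Lemma gram_sym (f : C -> C) (n k : nat) : hcd f -> gram f n k = Cconj (gram f k n).
Proof.
  intros Hf. assert (Hc := hcd_ccont f Hf). unfold gram. rewrite <- cmean_conj by ccont_tac.
  apply cmean_ext. intros t _. rewrite Cmult_conj, Cconj_conj. ring.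
Qed.

(** With truncated subtraction, [(n - k) + (k - n)] is the distance [|n - k|]. *)
Lemma Cmod_gram (f : C -> C) (n k : nat) : inner f ->
  Cmod (gram f n k) = Cmod (f 0) ^ ((n - k) + (k - n)).
Proof.
  intros Hf. destruct (Nat.le_ge_cases k n) as [H|H].
  - rewrite gram_le, Cmod_pow by auto. f_equal. lia.
  - rewrite gram_sym, Cmod_conj, gram_le, Cmod_pow by (auto; apply Hf). f_equal. lia.
Qed.

Lemma rsum_toeplitz (r : R) (n N : nat) : 0 <= r < 1 ->
  rsum (fun k => r ^ ((n - k) + (k - n))) N <= 2 / (1 - r).
Proof.
  intros Hr.
  assert (Hi : 0 < / (1 - r)) by (apply Rinv_0_lt_compat; lra).
  (* The sum is split at the diagonal. [H1] treats indices up to [n], [H2] those beyond; their power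
     terms are the exact geometric remainders needed by the inductions, and the total is at most
     [(1 + r) / (1 - r)]. *)
  assert (H1 : forall N, (N <= S n)%nat ->
     rsum (fun k => r ^ ((n - k) + (k - n))) N <= r ^ (S n - N) / (1 - r)).
  { clear N. induction N as [|N IH]; intros HN.
    - simpl rsum. apply Rmult_le_pos; [apply pow_le; lra|lra].
    - simpl rsum. apply Rle_trans with (r ^ (S n - N) / (1 - r) + r ^ (S n - S N)).
      + apply Rplus_le_compat; [apply IH; lia|]. right. f_equal. lia.
      + right. replace (S n - N)%nat with (S (S n - S N)) by lia.
        cbn [pow]. field. lra. }
  assert (H2 : forall j, rsum (fun k => r ^ ((n - k) + (k - n))) (j + S n)
     <= (1 + r - r ^ S j) / (1 - r)).
  { induction j as [|j IH].
    - change (0 + S n)%nat with (S n). apply Rle_trans with (1 := H1 _ (Nat.le_refl _)).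
      rewrite Nat.sub_diag. apply Rmult_le_compat_r; [lra|]. simpl. lra.
    - change (S j + S n)%nat with (S (j + S n)). cbn [rsum].
      apply Rle_trans with (1 := Rplus_le_compat_r _ _ _ IH).
      replace ((n - (j + S n)) + (j + S n - n))%nat with (S j) by lia.
      right. cbn [pow]. field. lra. }
  destruct (Nat.le_ge_cases N (S n)) as [H|H].
  - apply Rle_trans with (1 := H1 N H). apply Rmult_le_compat_r; [lra|].
    assert (r ^ (S n - N) <= 1) by (rewrite <- (pow1 (S n - N)); apply pow_incr; lra). lra.
  - replace N with ((N - S n) + S n)%nat by lia.
    apply Rle_trans with (1 := H2 _). apply Rmult_le_compat_r; [lra|].
    assert (0 <= r ^ S (N - S n)) by (apply pow_le; lra). lra.
Qed.

(** Bounding [x n * x k] by the mean of the two squares reduces the form, by symmetry of the matrix,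
    to its row sums. *)
Lemma rsum_Schur (r : R) (x : nat -> R) (N : nat) : 0 <= r < 1 ->
  rsum (fun n => rsum (fun k => x n * x k * r ^ ((n - k) + (k - n))) N) N
  <= 2 / (1 - r) * rsum (fun n => x n ^ 2) N.
Proof.
  intros Hr.
  set (u := fun n k : nat => r ^ ((n - k) + (k - n))).
  assert (Hu : forall n k, 0 <= u n k) by (intros; apply pow_le; lra).
  assert (Husym : forall n k, u n k = u k n) by (intros; unfold u; f_equal; lia).
  apply Rle_trans with (rsum (fun n => rsum (fun k => / 2 * (x n ^ 2 * u n k)
     + / 2 * (x k ^ 2 * u n k)) N) N).
  { apply rsum_le. intros n _. apply rsum_le. intros k _. fold (u n k).
    specialize (Hu n k). assert (0 <= (x n - x k) ^ 2) by apply pow2_ge_0. nra. }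
  assert (E1 : rsum (fun n => rsum (fun k => / 2 * (x n ^ 2 * u n k)) N) N
     <= / 2 * (2 / (1 - r) * rsum (fun n => x n ^ 2) N)).
  { rewrite <- !rsum_scal. apply rsum_le. intros n _. rewrite rsum_scal.
    apply Rmult_le_compat_l; [lra|]. rewrite rsum_scal, Rmult_comm.
    apply Rmult_le_compat_r; [apply pow2_ge_0|]. now apply rsum_toeplitz. }
  assert (E2 : rsum (fun n => rsum (fun k => / 2 * (x k ^ 2 * u n k)) N) N
     = rsum (fun n => rsum (fun k => / 2 * (x n ^ 2 * u n k)) N) N).
  { rewrite rsum_switch. apply rsum_ext. intros n _. apply rsum_ext. intros k _.
    now rewrite Husym. }
  rewrite (rsum_ext _ (fun n => rsum (fun k => / 2 * (x n ^ 2 * u n k)) N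
      + rsum (fun k => / 2 * (x k ^ 2 * u n k)) N)).
  - rewrite rsum_plus, E2. lra.
  - intros n _. apply rsum_plus.
Qed.

(* The Gram matrix of the powers of [f] is dominated by the Toeplitz matrix
   [|f(0)|^|n-k|], to which Schur's test applies. *)
Lemma composition_l2_bound (f : C -> C) : inner f ->
  exists C0, 0 <= C0 /\ forall a N P,
    rsum (fun m => Cmod (csum (fun n => a n * tcoef (fun z => f z ^ n)%C m)%C N) ^ 2) P
    <= C0 * rsum (fun n => Cmod (a n) ^ 2) N.
Proof.
  intros Hf. assert (H0 : Cmod (f 0) < 1) by (apply Hf; rewrite Cmod_0; lra).
  assert (H00 := Cmod_ge_0 (f 0)).
  exists (2 / (1 - Cmod (f 0))). split.
  { apply Rmult_le_pos; [lra|]. apply Rlt_le, Rinv_0_lt_compat; lra. }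
  intros a N P.
  assert (Hh : hcd f) by apply Hf.
  assert (Hp := hcd_polyval_comp f a N Hh).
  apply Rle_trans with (rsum (fun m => Cmod (tcoef (fun z => polyval a N (f z)) m) ^ 2) P).
  { right. apply rsum_ext. intros m _. now rewrite tcoef_polyval_comp. }
  apply Rle_trans with (Re (cmean (fun t => polyval a N (f (cis t)) * Cconj (polyval a N (f (cis t))))%C)).
  { apply (is_lim_seq_incr_compare _ _ (Parseval_norm _ Hp)).
    intros m. cbn [rsum]. generalize (pow2_ge_0 (Cmod (tcoef (fun z => polyval a N (f z)) m))). lra. }
  apply Rle_trans with (1 := Rle_abs _). apply Rle_trans with (1 := re_le_Cmod _).
  rewrite cmean_polyval_comp by auto.
  apply Rle_trans with (1 := Cmod_csum_le _ _).
  apply Rle_trans with (2 := rsum_Schur (Cmod (f 0)) (fun n => Cmod (a n)) N (conj H00 H0)).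
  apply rsum_le. intros n _. apply Rle_trans with (1 := Cmod_csum_le _ _).
  right. apply rsum_ext. intros k _.
  now rewrite !Cmod_mult, Cmod_conj, Cmod_gram.
Qed.

Lemma pow_decr (q : R) (n m : nat) : 0 <= q <= 1 -> (n <= m)%nat -> q ^ m <= q ^ n.
Proof.
  intros Hq Hnm. replace m with (n + (m - n))%nat by lia. rewrite pow_add.
  rewrite <- (Rmult_1_r (q ^ n)) at 2. apply Rmult_le_compat_l; [apply pow_le; lra|].
  rewrite <- (pow1 (m - n)). apply pow_incr. lra.
Qed.

Lemma fourth_root (x : R) : 0 < x < 1 -> exists q, 0 < q < 1 /\ q ^ 4 = x.
Proof.
  intros Hx.
  assert (H : forall y, 0 < y < 1 -> 0 < sqrt y < 1 /\ sqrt y ^ 2 = y).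
  { intros y Hy. assert (E : sqrt y ^ 2 = y) by (apply pow2_sqrt; lra).
    assert (0 < sqrt y) by (apply sqrt_lt_R0; lra). split; auto. nra. }
  destruct (H x Hx) as [H1 E1]. destruct (H (sqrt x) H1) as [H2 E2].
  exists (sqrt (sqrt x)). split; auto.
  replace (sqrt (sqrt x) ^ 4) with ((sqrt (sqrt x) ^ 2) ^ 2) by ring.
  now rewrite E2, E1.
Qed.

(** Choose [N] with [s ^ N < r]; then [A <= s ^ (j - N i)]. For [j >= (2 N + 1) i] the exponent is
    at least [(i + j) / 4], hence the fourth root of [s]. *)
Lemma off_diagonal_decay (r s : R) : 0 < r -> 0 < s < 1 ->
  exists (M : nat) q, 0 < q < 1 /\ forall (A : R) (i j : nat), (M * i <= j)%nat ->
    0 <= A -> A * r ^ i <= s ^ j -> A <= q ^ (i + j).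
Proof.
  intros Hr Hs. destruct (fourth_root s Hs) as [q [Hq E]].
  destruct (pow_lt_1_zero s) with (y := r) as [N HN]; auto.
  { rewrite Rabs_pos_eq; lra. }
  specialize (HN N (Nat.le_refl N)). rewrite Rabs_pos_eq in HN by (apply pow_le; lra).
  exists (2 * N + 1)%nat, q. split; auto. intros A i j Hij HA H.
  assert (HsN : 0 < s ^ (N * i)) by (apply pow_lt; lra).
  assert (Hri : s ^ (N * i) <= r ^ i).
  { rewrite pow_mult. apply pow_incr. split; [apply pow_le; lra|lra]. }
  apply Rle_trans with (s ^ (j - N * i)).
  - apply Rmult_le_reg_r with (s ^ (N * i)); auto.
    rewrite <- pow_add. replace (j - N * i + N * i)%nat with j by nia.
    apply Rle_trans with (2 := H). now apply Rmult_le_compat_l.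
  - rewrite <- E, <- pow_mult. apply pow_decr; [lra|]. nia.
Qed.

Lemma inner_small_circle (f : C -> C) : inner f ->
  exists r s, 0 < r < 1 /\ 0 < s < 1 /\ forall t, Cmod (f (r * cis t)%C) <= s.
Proof.
  intros [Hf [_ Hd]].
  assert (H0 : Cmod (f 0) < 1) by (apply Hd; rewrite Cmod_0; lra).
  assert (H00 := Cmod_ge_0 (f 0)).
  destruct (hcd_continuous f 0 Hf) with (eps := (1 - Cmod (f 0)) / 2) as [d [Hd0 Hdc]].
  { rewrite Cmod_0; lra. }
  { lra. }
  assert (Hm : 0 < Rmin d 1) by (apply Rmin_pos; lra).
  assert (Hm1 := Rmin_l d 1). assert (Hm2 := Rmin_r d 1).
  exists (Rmin d 1 / 2), ((1 + Cmod (f 0)) / 2). split; [lra|]. split; [lra|].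
  intros t. set (z := (RtoC (Rmin d 1 / 2) * cis t)%C).
  assert (Hz : Cmod (z - 0) < d).
  { replace (z - 0)%C with z by ring. unfold z. rewrite Cmod_circle; lra. }
  generalize (Cmod_le_minus (f z) (f 0)) (Hdc z Hz). lra.
Qed.

(** Cauchy's estimate on two circles. On one of radius [r1 > 1], where [|f| <= B], the [m]-th
    coefficient of [f ^ n] is at most [B ^ n / r1 ^ m], small when [m] is much larger than [n]. On
    one of radius [r2 < 1], where [|f| <= s < 1], it is at most [s ^ n / r2 ^ m], small when [n] is
    much larger than [m]. *)
Lemma power_coef_decay (f : C -> C) : inner f ->
  exists (M : nat) q, 0 < q < 1 /\ forall m n,
    ((M * n <= m)%nat \/ (M * m <= n)%nat) -> Cmod (tcoef (fun z => f z ^ n)%C m) <= q ^ (m + n).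
Proof.
  intros Hi. assert (Hf := proj1 Hi).
  assert (Hcoef : exists R0, 1 < R0 /\ holo (ballC R0) f /\ forall n m r, 0 < r < R0 ->
     cmean (fun t => f (r * cis t) ^ n * Cconj (cis t) ^ m)%C
     = (tcoef (fun z => f z ^ n)%C m * r ^ m)%C).
  { destruct Hf as [R1 [HR1 Hh]]. exists R1. split; auto. split; auto. intros n m r Hr.
    destruct (Taylor R1 (fun z => f z ^ n)%C) as [a Ha]; [lra|now apply holo_pow|].
    rewrite (Taylor_coef R1 r a (fun z => f z ^ n)%C m Ha Hr).
    now rewrite (tcoef_eq _ a R1 HR1 Ha). }
  destruct Hcoef as [R0 [HR [Hh Hcoef]]].
  assert (Hbound : forall r B, 0 < r < R0 -> 0 <= B ->
     (forall t, 0 <= t <= 2 * PI -> Cmod (f (r * cis t)%C) <= B) ->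
     forall n m, Cmod (tcoef (fun z => f z ^ n)%C m) * r ^ m <= B ^ n).
  { intros r B Hr HB0 HB n m.
    replace (Cmod (tcoef (fun z => f z ^ n)%C m) * r ^ m) with
      (Cmod (cmean (fun t => f (r * cis t) ^ n * Cconj (cis t) ^ m)%C)).
    - assert (Hc : ccont (fun t => f (r * cis t)%C)).
      { apply (ccont_comp (ballC R0)); auto using ccont_circle.
        intros t. unfold ballC. rewrite Cmod_circle; lra. }
      apply cmean_bound; [ccont_tac|]. intros t Ht.
      rewrite Cmod_mult, !Cmod_pow, Cmod_conj, Cmod_cis, pow1, Rmult_1_r.
      apply pow_incr. split; auto using Cmod_ge_0.
    - rewrite Hcoef by auto. rewrite Cmod_mult, Cmod_pow, Cmod_R, Rabs_pos_eq; auto; lra. }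
  set (r1 := (1 + R0) / 2). assert (Hr1 : 1 < r1 < R0) by (unfold r1; lra).
  destruct (ccont_bounded (fun t => f (r1 * cis t)%C) (2 * PI)) as [B0 HB0].
  { generalize two_PI_pos; lra. }
  { apply (ccont_comp (ballC R0)); auto using ccont_circle.
    intros t. unfold ballC. rewrite Cmod_circle; lra. }
  set (B := Rmax B0 1). assert (HB1 : 1 <= B) by apply Rmax_r.
  assert (HB : forall n m, Cmod (tcoef (fun z => f z ^ n)%C m) * r1 ^ m <= B ^ n).
  { apply Hbound; [lra|lra|]. intros t Ht. apply Rle_trans with (1 := HB0 t Ht), Rmax_l. }
  destruct (inner_small_circle f Hi) as [r2 [s [Hr2 [Hs Hsmall]]]].
  assert (Hsm : forall n m, Cmod (tcoef (fun z => f z ^ n)%C m) * r2 ^ m <= s ^ n).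
  { apply Hbound; [lra|lra|]. intros t _. apply Hsmall. }
  assert (HBi : 0 < / B) by (apply Rinv_0_lt_compat; lra).
  assert (Hr1i : 0 < / r1 < 1).
  { split; [apply Rinv_0_lt_compat; lra|]. rewrite <- Rinv_1.
    apply Rinv_lt_contravar; lra. }
  destruct (off_diagonal_decay (/ B) (/ r1) HBi Hr1i) as [M1 [q1 [Hq1 H1]]].
  destruct (off_diagonal_decay r2 s (proj1 Hr2) Hs) as [M2 [q2 [Hq2 H2]]].
  exists (M1 + M2)%nat, (Rmax q1 q2). split.
  { split; [apply Rlt_le_trans with (1 := proj1 Hq1), Rmax_l|apply Rmax_lub_lt; lra]. }
  assert (Hmax : forall q k, (q = q1 \/ q = q2) -> q ^ k <= Rmax q1 q2 ^ k).
  { intros q k [-> | ->]; apply pow_incr; split; try lra; [apply Rmax_l|apply Rmax_r]. }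
  intros m n [H|H].
  - apply Rle_trans with (q1 ^ (m + n)); auto. rewrite Nat.add_comm.
    apply H1; auto using Cmod_ge_0; [nia|].
    assert (Hp1 : 0 < B ^ n) by (apply pow_lt; lra).
    assert (Hp2 : 0 < r1 ^ m) by (apply pow_lt; lra).
    rewrite !pow_inv. apply Rmult_le_reg_r with (B ^ n * r1 ^ m); [now apply Rmult_lt_0_compat|].
    replace (/ r1 ^ m * (B ^ n * r1 ^ m)) with (B ^ n) by (field; lra).
    replace (Cmod (tcoef (fun z => f z ^ n)%C m) * / B ^ n * (B ^ n * r1 ^ m)) with
      (Cmod (tcoef (fun z => f z ^ n)%C m) * r1 ^ m) by (field; lra).
    apply HB.
  - apply Rle_trans with (q2 ^ (m + n)); auto.
    apply H2; auto using Cmod_ge_0. nia.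
Qed.

(** * Weighted bounds for polynomials *)

(* The index of the geometric block [2^(L j) <= n + 1 < 2^(L (j + 1))]. *)
Definition blk (L n : nat) : nat := (Nat.log2 (n + 1) / L)%nat.

Definition near (j k : nat) : bool := andb (Nat.leb j (S k)) (Nat.leb k (S j)).

Lemma near_true (j k : nat) : near j k = true <-> (j <= S k /\ k <= S j)%nat.
Proof.
  unfold near. rewrite Bool.andb_true_iff, !Nat.leb_le. easy.
Qed.

Lemma near_sym (j k : nat) : near j k = near k j.
Proof. unfold near. apply Bool.andb_comm. Qed.

Lemma blk_spec (L n : nat) : (1 <= L)%nat ->
  (2 ^ (L * blk L n) <= n + 1 < 2 ^ (L * S (blk L n)))%nat.
Proof.
  intros HL. unfold blk.
  destruct (Nat.log2_spec (n + 1)) as [H1 H2]; [lia|].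
  assert (H3 := Nat.Div0.mul_div_le (Nat.log2 (n + 1)) L).
  assert (H4 := Nat.mul_succ_div_gt (Nat.log2 (n + 1)) L ltac:(lia)).
  split.
  - apply Nat.le_trans with (2 := H1). apply Nat.pow_le_mono_r; lia.
  - apply Nat.lt_le_trans with (1 := H2). apply Nat.pow_le_mono_r; lia.
Qed.

Lemma blk_far_le (L m n : nat) : (1 <= L)%nat -> (S (S (blk L n)) <= blk L m)%nat ->
  (2 ^ L * (n + 1) <= m + 1)%nat.
Proof.
  intros HL H. destruct (blk_spec L m HL) as [H1 _]. destruct (blk_spec L n HL) as [_ H2].
  apply Nat.le_trans with (2 := H1).
  apply Nat.le_trans with (2 ^ L * 2 ^ (L * S (blk L n)))%nat.
  - apply Nat.mul_le_mono_l. lia.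
  - rewrite <- Nat.pow_add_r. apply Nat.pow_le_mono_r; nia.
Qed.

Lemma blk_far (L m n : nat) : (1 <= L)%nat -> near (blk L m) (blk L n) = false ->
  (2 ^ L * (n + 1) <= m + 1 \/ 2 ^ L * (m + 1) <= n + 1)%nat.
Proof.
  intros HL H.
  destruct (Nat.le_gt_cases (S (S (blk L n))) (blk L m)) as [H1|H1].
  { left. now apply blk_far_le. }
  destruct (Nat.le_gt_cases (S (S (blk L m))) (blk L n)) as [H2|H2].
  { right. now apply blk_far_le. }
  assert (near (blk L m) (blk L n) = true) by (apply near_true; lia). congruence.
Qed.

Lemma blk_near (L m n : nat) : (1 <= L)%nat -> near (blk L m) (blk L n) = true ->
  (m + 1 <= 2 ^ (2 * L) * (n + 1))%nat.
Proof.
  intros HL H. apply near_true in H.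
  destruct (blk_spec L m HL) as [_ H1]. destruct (blk_spec L n HL) as [H2 _].
  apply Nat.le_trans with (2 ^ (2 * L) * 2 ^ (L * blk L n))%nat.
  - rewrite <- Nat.pow_add_r. apply Nat.le_trans with (2 ^ (L * S (blk L m)))%nat; [lia|].
    apply Nat.pow_le_mono_r; nia.
  - now apply Nat.mul_le_mono_l.
Qed.

Lemma blk_le (L n : nat) : (1 <= L)%nat -> (blk L n <= n)%nat.
Proof.
  intros HL. unfold blk. apply Nat.le_trans with (Nat.log2 (n + 1)).
  - apply Nat.Div0.div_le_upper_bound. nia.
  - generalize (Nat.log2_lt_lin (n + 1)). lia.
Qed.

Lemma blk_rep (L j : nat) : (1 <= L)%nat -> blk L (2 ^ (L * j) - 1) = j.
Proof.
  intros HL. unfold blk.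
  assert (0 < 2 ^ (L * j))%nat by (apply Nat.neq_0_lt_0, Nat.pow_nonzero; lia).
  replace (2 ^ (L * j) - 1 + 1)%nat with (2 ^ (L * j))%nat by lia.
  rewrite Nat.log2_pow2 by lia. rewrite Nat.mul_comm. apply Nat.div_mul. lia.
Qed.

(** Indices of equal or adjacent blocks have a ratio of at most [2 ^ (2 L)], so a regular weight of
    exponent [p] varies by at most the [p]-th power of this. *)
Lemma regular_near (b : nat -> R) (L : nat) : regular b -> (1 <= L)%nat ->
  exists D, 0 < D /\ forall m n, near (blk L m) (blk L n) = true -> b m <= D * b n.
Proof.
  intros [Hb [p Hp]] HL.
  set (d := INR (2 ^ (2 * L))).
  assert (Hd : 1 <= d).
  { unfold d. rewrite <- INR_1. apply le_INR.
    generalize (Nat.pow_nonzero 2 (2 * L)). lia. }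
  assert (Hr : forall m n, near (blk L m) (blk L n) = true ->
     (INR m + 1) ^ p <= d ^ p * (INR n + 1) ^ p).
  { intros m n H. rewrite <- Rpow_mult_distr. apply pow_incr.
    split; [apply Rlt_le, INR_1_pos|].
    apply blk_near in H; auto. apply le_INR in H.
    rewrite mult_INR, !plus_INR in H. exact H. }
  exists (d ^ p). split; [apply pow_lt; lra|]. intros m n H.
  assert (Hm := pow_lt _ p (INR_1_pos m)). assert (Hn := pow_lt _ p (INR_1_pos n)).
  assert (Hbm := Hb m). assert (Hbn := Hb n).
  destruct (Nat.le_ge_cases m n) as [Hmn|Hmn].
  - apply Rmult_le_reg_r with ((INR m + 1) ^ p); auto.
    apply Rle_trans with (1 := proj1 (Hp m n Hmn)).
    rewrite near_sym in H.
    replace (d ^ p * b n * (INR m + 1) ^ p) with (b n * (d ^ p * (INR m + 1) ^ p)) by ring.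
    apply Rmult_le_compat_l; [lra|]. now apply Hr.
  - apply Rmult_le_reg_r with ((INR n + 1) ^ p); auto.
    apply Rle_trans with (1 := proj2 (Hp n m Hmn)).
    replace (d ^ p * b n * (INR n + 1) ^ p) with (b n * (d ^ p * (INR n + 1) ^ p)) by ring.
    apply Rmult_le_compat_l; [lra|]. now apply Hr.
Qed.

Lemma rsum_eqb_le (k P : nat) (y : R) : 0 <= y ->
  rsum (fun j => if Nat.eqb j k then y else 0) P <= y.
Proof.
  intros Hy.
  assert (H : forall P, rsum (fun j => if Nat.eqb j k then y else 0) P
     = if Nat.ltb k P then y else 0).
  { clear P. induction P as [|P IH]; simpl; [easy|]. rewrite IH.
    destruct (Nat.eqb_spec P k) as [->|Hne].
    - rewrite Nat.ltb_irrefl. replace (Nat.ltb k (S k)) with true; [ring|].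
      symmetry. apply Nat.ltb_lt. lia.
    - destruct (Nat.ltb_spec k P), (Nat.ltb_spec k (S P)); try lia; ring. }
  rewrite H. destruct (Nat.ltb k P); lra.
Qed.

Lemma rsum_near_le (k P : nat) (y : R) : 0 <= y ->
  rsum (fun j => if near j k then y else 0) P <= 3 * y.
Proof.
  intros Hy.
  (* A block has at most three near blocks. For [k = 0] the index [pred k] repeats [k], which only
     weakens the bound. *)
  apply Rle_trans with (rsum (fun j => (if Nat.eqb j k then y else 0) +
    ((if Nat.eqb j (S k) then y else 0) + (if Nat.eqb j (pred k) then y else 0))) P).
  - apply rsum_le. intros j _. destruct (near j k) eqn:E.
    + apply near_true in E.
      destruct (Nat.eqb_spec j k), (Nat.eqb_spec j (S k)), (Nat.eqb_spec j (pred k)); try lra; lia.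
    + destruct (Nat.eqb j k), (Nat.eqb j (S k)), (Nat.eqb j (pred k)); lra.
  - rewrite !rsum_plus.
    generalize (rsum_eqb_le k P y Hy) (rsum_eqb_le (S k) P y Hy) (rsum_eqb_le (pred k) P y Hy). lra.
Qed.

Lemma rsum_by_blocks (J : nat -> nat) (x : nat -> R) P : (forall m, J m <= m)%nat ->
  rsum x P = rsum (fun j => rsum (fun m => if Nat.eqb j (J m) then x m else 0) P) P.
Proof.
  intros HJ. rewrite rsum_switch. apply rsum_ext. intros m Hm.
  assert (H : forall Q, rsum (fun j => if Nat.eqb j (J m) then x m else 0) Q
     = if Nat.ltb (J m) Q then x m else 0).
  { induction Q as [|Q IH]; simpl; [easy|]. rewrite IH.
    destruct (Nat.eqb_spec Q (J m)) as [->|Hne].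
    - rewrite Nat.ltb_irrefl. replace (Nat.ltb (J m) (S (J m))) with true; [ring|].
      symmetry. apply Nat.ltb_lt. lia.
    - destruct (Nat.ltb_spec (J m) Q), (Nat.ltb_spec (J m) (S Q)); try lia; ring. }
  rewrite H. replace (Nat.ltb (J m) P) with true; auto.
  symmetry. apply Nat.ltb_lt. specialize (HJ m). lia.
Qed.

Lemma sqr_sum_le (x y z : R) : 0 <= x <= y + z -> x ^ 2 <= 2 * y ^ 2 + 2 * z ^ 2.
Proof.
  intros H. assert (x ^ 2 <= (y + z) ^ 2) by (apply pow_incr; lra).
  assert (0 <= (y - z) ^ 2) by apply pow2_ge_0. nra.
Qed.

Lemma Cmod_sqr_sum_le (u v : C) : Cmod (u + v) ^ 2 <= 2 * Cmod u ^ 2 + 2 * Cmod v ^ 2.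
Proof. apply sqr_sum_le. split; [apply Cmod_ge_0|apply Cmod_triangle]. Qed.

(** * Weighted boundedness of a matrix that is bounded on [l2] and decays off a cone *)

Section MatrixBound.

Variables (A : nat -> nat -> C) (C0 q : R) (M : nat) (b : nat -> R).
Hypothesis HC0 : 0 <= C0.
Hypothesis HA : forall a N P,
  rsum (fun m => Cmod (csum (fun n => a n * A m n)%C N) ^ 2) P
  <= C0 * rsum (fun n => Cmod (a n) ^ 2) N.
Hypothesis Hq : 0 < q < 1.
Hypothesis Hdecay : forall m n, ((M * n <= m)%nat \/ (M * m <= n)%nat) ->
  Cmod (A m n) <= q ^ (m + n).
Hypothesis Hb : regular b.

(** The block ratio [2 ^ L] then exceeds [M], so entries between blocks that are neither equal nor
    adjacent lie outside the cone. *)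
Let L := S M.
Let J := blk L.

Let far_decay (m n : nat) : near (J m) (J n) = false -> Cmod (A m n) <= q ^ (m + n).
Proof.
  intros H. apply Hdecay. apply blk_far in H; [|unfold L; lia].
  assert (M < 2 ^ L)%nat.
  { unfold L. generalize (Nat.pow_gt_lin_r 2 (S M)). lia. }
  destruct H; [left|right]; nia.
Qed.

Let near_part (a : nat -> C) (N m : nat) : C :=
  csum (fun n => (if near (J m) (J n) then a n else 0) * A m n)%C N.

Let far_part (a : nat -> C) (N m : nat) : C :=
  csum (fun n => (if near (J m) (J n) then 0 else a n) * A m n)%C N.

(** Rows of block [j] see only coefficients from blocks near [j], on which the weight is comparable
    to its value at one index [r]. The unweighted bound applies to these coefficients. One [D ^ 2]
    replaces [b m] by [b r], the other [b r] by [b n], and 3 counts the blocks in which a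
    coefficient is used. *)
Let near_bound : exists K, 0 <= K /\ forall a N P,
  rsum (fun m => Cmod (near_part a N m) ^ 2 * b m ^ 2) P
  <= K * rsum (fun n => Cmod (a n) ^ 2 * b n ^ 2) N.
Proof.
  destruct (regular_near b L Hb) as [D [HD Hnear]]; [unfold L; lia|].
  assert (Hbpos : forall n, 0 < b n) by apply Hb.
  assert (HD4 : 0 <= D ^ 2 * C0 * D ^ 2).
  { repeat apply Rmult_le_pos; auto; try lra; apply pow2_ge_0. }
  exists (3 * (D ^ 2 * C0 * D ^ 2)). split; [lra|]. intros a N P.
  rewrite (rsum_by_blocks J) by (intros m; apply blk_le; unfold L; lia).
  apply Rle_trans with (rsum (fun j => D ^ 2 * C0 * D ^ 2 *
     rsum (fun n => if near j (J n) then Cmod (a n) ^ 2 * b n ^ 2 else 0) N) P).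
  - apply rsum_le. intros j _.
    set (r := (2 ^ (L * j) - 1)%nat).
    assert (Hr : J r = j) by (apply blk_rep; unfold L; lia).
    set (aj := fun n => if near j (J n) then a n else 0%C).
    apply Rle_trans with (D ^ 2 * b r ^ 2 * rsum (fun m => Cmod (csum (fun n => aj n * A m n)%C N) ^ 2) P).
    + rewrite <- rsum_scal. apply rsum_le. intros m _.
      destruct (Nat.eqb_spec j (J m)) as [E|E].
      * assert (Hbm : b m <= D * b r).
        { apply Hnear. change (near (J m) (J r) = true). rewrite Hr, E. apply near_true. lia. }
        unfold near_part. rewrite <- E. fold aj. change (csum _ N) with (csum (fun n => aj n * A m n)%C N).
        rewrite Rmult_comm. apply Rmult_le_compat_r; [apply pow2_ge_0|].
        rewrite <- Rpow_mult_distr. apply pow_incr. split; auto. now apply Rlt_le.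
      * apply Rmult_le_pos; [|apply pow2_ge_0]. apply Rmult_le_pos; apply pow2_ge_0.
    + apply Rle_trans with (D ^ 2 * b r ^ 2 * (C0 * rsum (fun n => Cmod (aj n) ^ 2) N)).
      { apply Rmult_le_compat_l; auto. apply Rmult_le_pos; apply pow2_ge_0. }
      replace (D ^ 2 * b r ^ 2 * (C0 * rsum (fun n => Cmod (aj n) ^ 2) N)) with
        (D ^ 2 * C0 * rsum (fun n => b r ^ 2 * Cmod (aj n) ^ 2) N) by (rewrite rsum_scal; ring).
      rewrite (Rmult_assoc (D ^ 2 * C0)).
      apply Rmult_le_compat_l; [apply Rmult_le_pos; auto; apply pow2_ge_0|].
      rewrite <- rsum_scal. apply rsum_le. intros n _. unfold aj.
      destruct (near j (J n)) eqn:E.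
      * assert (Hbr : b r <= D * b n).
        { apply Hnear. change (near (J r) (J n) = true). now rewrite Hr. }
        replace (D ^ 2 * (Cmod (a n) ^ 2 * b n ^ 2)) with ((D * b n) ^ 2 * Cmod (a n) ^ 2) by ring.
        apply Rmult_le_compat_r; [apply pow2_ge_0|]. apply pow_incr. split; auto.
        now apply Rlt_le.
      * rewrite Cmod_0. right. ring.
  - rewrite rsum_scal. replace (3 * (D ^ 2 * C0 * D ^ 2)) with (D ^ 2 * C0 * D ^ 2 * 3) by ring.
    rewrite (Rmult_assoc (D ^ 2 * C0 * D ^ 2)). apply Rmult_le_compat_l; auto.
    rewrite rsum_switch, <- rsum_scal. apply rsum_le. intros n _.
    apply rsum_near_le. apply Rmult_le_pos; apply pow2_ge_0.
Qed.

(** The far entries are dominated by the rank-one matrix [q ^ m * q ^ n]. Cauchy-Schwarz in [n]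
    needs [q ^ n / b n] to be square summable, and the sum over [m] needs the same for
    [q ^ m * b m]; both hold for a regular weight. *)
Let far_bound : exists K, 0 <= K /\ forall a N P,
  rsum (fun m => Cmod (far_part a N m) ^ 2 * b m ^ 2) P
  <= K * rsum (fun n => Cmod (a n) ^ 2 * b n ^ 2) N.
Proof.
  assert (Hbpos : forall n, 0 < b n) by apply Hb.
  assert (Hq' : 0 <= q < 1) by lra.
  assert (HT1 := regular_summable b q Hb Hq').
  assert (HT2 := regular_summable _ q (regular_inv b Hb) Hq').
  assert (Hp1 : forall k, 0 <= (q ^ k) ^ 2 * b k ^ 2)
    by (intros; apply Rmult_le_pos; apply pow2_ge_0).
  assert (Hp2 : forall k, 0 <= (q ^ k) ^ 2 * (/ b k) ^ 2)
    by (intros; apply Rmult_le_pos; apply pow2_ge_0).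
  set (T1 := Series (fun k => (q ^ k) ^ 2 * b k ^ 2)) in *.
  set (T2 := Series (fun k => (q ^ k) ^ 2 * (/ b k) ^ 2)) in *.
  assert (HT10 : 0 <= T1) by now apply Series_nonneg.
  assert (HT20 : 0 <= T2) by now apply Series_nonneg.
  exists (T1 * T2). split; [now apply Rmult_le_pos|]. intros a N P.
  set (S0 := rsum (fun n => Cmod (a n) ^ 2 * b n ^ 2) N).
  assert (HS0 : 0 <= S0) by (apply rsum_nonneg; intros; apply Rmult_le_pos; apply pow2_ge_0).
  assert (Hfar : forall m, Cmod (far_part a N m) ^ 2 <= (q ^ m) ^ 2 * (S0 * T2)).
  { intros m.
    assert (H1 : Cmod (far_part a N m) <= q ^ m * rsum (fun n => (Cmod (a n) * b n) * (q ^ n * / b n)) N).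
    { apply Rle_trans with (1 := Cmod_csum_le _ _). rewrite <- rsum_scal.
      apply rsum_le. intros n _. rewrite Cmod_mult.
      replace (q ^ m * (Cmod (a n) * b n * (q ^ n * / b n))) with (Cmod (a n) * q ^ (m + n)).
      2:{ rewrite pow_add. field. generalize (Hbpos n); lra. }
      destruct (near (J m) (J n)) eqn:E.
      - rewrite Cmod_0, Rmult_0_l. apply Rmult_le_pos; [apply Cmod_ge_0|apply pow_le; lra].
      - apply Rmult_le_compat_l; [apply Cmod_ge_0|]. now apply far_decay. }
    apply Rle_trans with ((q ^ m * rsum (fun n => (Cmod (a n) * b n) * (q ^ n * / b n)) N) ^ 2).
    { apply pow_incr. split; auto. apply Cmod_ge_0. }
    rewrite Rpow_mult_distr. apply Rmult_le_compat_l; [apply pow2_ge_0|].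
    apply Rle_trans with (1 := rsum_Cauchy_Schwarz _ _ _).
    apply Rmult_le_compat.
    - apply rsum_nonneg; intros; apply pow2_ge_0.
    - apply rsum_nonneg; intros; apply pow2_ge_0.
    - right. apply rsum_ext. intros; ring.
    - apply Rle_trans with (2 := rsum_le_Series _ N Hp2 HT2).
      right. apply rsum_ext. intros; ring. }
  apply Rle_trans with (rsum (fun m => (S0 * T2) * ((q ^ m) ^ 2 * b m ^ 2)) P).
  - apply rsum_le. intros m _.
    replace (S0 * T2 * ((q ^ m) ^ 2 * b m ^ 2)) with ((q ^ m) ^ 2 * (S0 * T2) * b m ^ 2) by ring.
    apply Rmult_le_compat_r; auto. apply pow2_ge_0.
  - rewrite rsum_scal. replace (T1 * T2 * S0) with (S0 * T2 * T1) by ring.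
    apply Rmult_le_compat_l; [now apply Rmult_le_pos|]. now apply rsum_le_Series.
Qed.

Lemma weighted_matrix_bound : exists K, 0 <= K /\ forall a N P,
  rsum (fun m => Cmod (csum (fun n => a n * A m n)%C N) ^ 2 * b m ^ 2) P
  <= K * rsum (fun n => Cmod (a n) ^ 2 * b n ^ 2) N.
Proof.
  destruct near_bound as [K1 [HK1 H1]]. destruct far_bound as [K2 [HK2 H2]].
  exists (2 * K1 + 2 * K2). split; [lra|]. intros a N P.
  specialize (H1 a N P). specialize (H2 a N P).
  apply Rle_trans with (rsum (fun m => 2 * (Cmod (near_part a N m) ^ 2 * b m ^ 2)
     + 2 * (Cmod (far_part a N m) ^ 2 * b m ^ 2)) P).
  - apply rsum_le. intros m _.
    replace (csum (fun n => a n * A m n)%C N) with (near_part a N m + far_part a N m)%C.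
    + generalize (Cmod_sqr_sum_le (near_part a N m) (far_part a N m)) (pow2_ge_0 (b m)).
      nra.
    + unfold near_part, far_part. rewrite <- csum_plus. apply csum_ext. intros n _.
      destruct (near (J m) (J n)); ring.
  - rewrite rsum_plus, !rsum_scal. lra.
Qed.

End MatrixBound.

Lemma polyval_composition_bound (f : C -> C) (b : nat -> R) : inner f -> regular b ->
  exists K, 0 <= K /\ forall a N P,
  rsum (fun m => Cmod (tcoef (fun z => polyval a N (f z)) m) ^ 2 * b m ^ 2) P
  <= K * rsum (fun n => Cmod (a n) ^ 2 * b n ^ 2) N.
Proof.
  intros Hf Hb.
  destruct (composition_l2_bound f Hf) as [C0 [HC0 H0]].
  destruct (power_coef_decay f Hf) as [M [q [Hq Hd]]].
  destruct (weighted_matrix_bound (fun m n => tcoef (fun z => f z ^ n)%C m) C0 q M b)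
    as [K [HK H]]; auto.
  exists K. split; auto. intros a N P. apply Rle_trans with (2 := H a N P).
  right. apply rsum_ext. intros m _. rewrite tcoef_polyval_comp; auto. apply Hf.
Qed.

Lemma RtoC_rsum (x : nat -> R) n : RtoC (rsum x n) = csum (fun k => RtoC (x k)) n.
Proof. induction n as [|n IH]; simpl; [easy|now rewrite RtoC_plus, IH]. Qed.

(** [X] stands for the squared weighted norm of the composed polynomial, entering through its
    partial sums so that convergence is not part of the statement. *)
Lemma polyval_composition_below (f : C -> C) (b : nat -> R) : inner f -> f 0 = 0 ->
  regular b -> exists K, 0 <= K /\ forall a N X,
  (forall P, rsum (fun m => Cmod (tcoef (fun z => polyval a N (f z)) m) ^ 2 * b m ^ 2) P <= X) ->
  rsum (fun n => Cmod (a n) ^ 2 * b n ^ 2) N <= K * X.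
Proof.
  intros Hf Hf0 Hb.
  assert (Hh : hcd f) by apply Hf.
  assert (Hbpos : forall n, 0 < b n) by apply Hb.
  destruct (polyval_composition_bound f _ Hf (regular_inv b Hb)) as [K [HK HB]].
  exists K. split; auto. intros a N X HX.
  set (S0 := rsum (fun n => Cmod (a n) ^ 2 * b n ^ 2) N).
  assert (HS0 : 0 <= S0) by (apply rsum_nonneg; intros; apply Rmult_le_pos; apply pow2_ge_0).
  assert (HX0 : 0 <= X) by apply (HX O).
  set (h := fun n => (RtoC (b n ^ 2) * a n)%C).
  set (c := tcoef (fun z => polyval a N (f z))) in *.
  set (d := tcoef (fun z => polyval h N (f z))).
  assert (Hd : forall P, rsum (fun m => Cmod (d m) ^ 2 * (/ b m) ^ 2) P <= K * S0).
  { intros P. apply Rle_trans with (1 := HB h N P). apply Rmult_le_compat_l; auto.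
    right. apply rsum_ext. intros n _. unfold h.
    rewrite Cmod_mult, Cmod_R, Rabs_pos_eq by apply pow2_ge_0.
    field. generalize (Hbpos n); lra. }
  assert (Hlim : clim (csum (fun m => c m * Cconj (d m))%C) S0).
  { replace (RtoC S0) with (cmean (fun t => polyval a N (f (cis t)) * Cconj (polyval h N (f (cis t))))%C).
    - apply (Parseval (fun z => polyval a N (f z)) (fun z => polyval h N (f z)));
        now apply hcd_polyval_comp.
    - rewrite cmean_polyval_comp by auto.
      (* As [f 0 = 0], the powers of [f] are orthonormal on the circle, and the double sum collapses
         to its diagonal. *)
      assert (Hg : forall n k, n <> k -> gram f n k = 0).
      { assert (Hlt : forall n k, (k < n)%nat -> gram f n k = 0).
        { intros n k Hkn. rewrite gram_le by (auto; lia). rewrite Hf0.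
          replace (n - k)%nat with (S (n - k - 1)) by lia. simpl. ring. }
        intros n k Hnk. destruct (Nat.lt_ge_cases k n) as [H|H]; auto.
        rewrite gram_sym, Hlt by (auto; lia). unfold Cconj, RtoC; simpl. f_equal; ring. }
      transitivity (csum (fun n => RtoC (Cmod (a n) ^ 2 * b n ^ 2)) N).
      + apply csum_ext. intros n Hn.
        rewrite (csum_delta _ n); auto.
        * rewrite gram_le, Nat.sub_diag by auto. unfold h.
          rewrite Cmult_conj, RtoC_mult, Cmod2_conj.
          replace (Cconj (b n ^ 2)%R) with (RtoC (b n ^ 2)).
          -- simpl. ring.
          -- unfold Cconj, RtoC; simpl. f_equal; ring.
        * intros k Hk. rewrite Hg by auto. ring.
      + symmetry. apply RtoC_rsum. }
  (* The factors [b m] and [/ b m] cancel in each product, so Cauchy-Schwarz separates the bound [X]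
     for [c] from the bound [K * S0] for [d]; one [S0] is divided out at the end. *)
  assert (Hsq : S0 ^ 2 <= X * (K * S0)).
  { assert (Hm : Cmod S0 <= sqrt (X * (K * S0))).
    { apply clim_bound with (1 := Hlim). intros P.
      apply Rle_trans with (1 := Cmod_csum_le _ _).
      rewrite <- (sqrt_pow2 (rsum _ P)).
      2:{ apply rsum_nonneg. intros; apply Cmod_ge_0. }
      apply sqrt_le_1_alt.
      apply Rle_trans with ((rsum (fun m => (Cmod (c m) * b m) * (Cmod (d m) * / b m)) P) ^ 2).
      { right. f_equal. apply rsum_ext. intros m _. rewrite Cmod_mult, Cmod_conj.
        field. generalize (Hbpos m); lra. }
      apply Rle_trans with (1 := rsum_Cauchy_Schwarz _ _ _).
      apply Rmult_le_compat.
      - apply rsum_nonneg; intros; apply pow2_ge_0.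
      - apply rsum_nonneg; intros; apply pow2_ge_0.
      - apply Rle_trans with (2 := HX P). right. apply rsum_ext. intros; ring.
      - apply Rle_trans with (2 := Hd P). right. apply rsum_ext. intros; ring. }
    rewrite Cmod_R, Rabs_pos_eq in Hm by auto.
    rewrite <- (pow2_sqrt (X * (K * S0))).
    - apply pow_incr. lra.
    - apply Rmult_le_pos; auto. now apply Rmult_le_pos. }
  destruct HS0 as [HS0|HS0].
  - apply Rmult_le_reg_r with S0; auto. lra.
  - rewrite <- HS0. now apply Rmult_le_pos.
Qed.

(** * Weighted bounds for power series *)

Definition l2 (b : nat -> R) (a : nat -> C) : Prop :=
  ex_series (fun k => Cmod (a k) ^ 2 * b k ^ 2).

Definition sqnorm (b : nat -> R) (a : nat -> C) : R :=
  Series (fun k => Cmod (a k) ^ 2 * b k ^ 2).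

Lemma l2_term_nonneg (b : nat -> R) (a : nat -> C) k : 0 <= Cmod (a k) ^ 2 * b k ^ 2.
Proof. apply Rmult_le_pos; apply pow2_ge_0. Qed.

Lemma rsum_le_sqnorm (b : nat -> R) (a : nat -> C) N : l2 b a ->
  rsum (fun k => Cmod (a k) ^ 2 * b k ^ 2) N <= sqnorm b a.
Proof. intros H. apply rsum_le_Series; auto. intros; apply l2_term_nonneg. Qed.

Lemma sqnorm_nonneg (b : nat -> R) (a : nat -> C) : l2 b a -> 0 <= sqnorm b a.
Proof. intros H. apply (rsum_le_sqnorm b a O H). Qed.

Lemma l2_of_bounded (b : nat -> R) (a : nat -> C) (X : R) :
  (forall N, rsum (fun k => Cmod (a k) ^ 2 * b k ^ 2) N <= X) ->
  l2 b a /\ sqnorm b a <= X.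
Proof. apply series_of_bounded. intros; apply l2_term_nonneg. Qed.

Lemma l2_minus (b : nat -> R) (a c : nat -> C) : l2 b a -> l2 b c ->
  l2 b (fun k => a k - c k)%C /\
  sqnorm b (fun k => a k - c k)%C <= 2 * sqnorm b a + 2 * sqnorm b c.
Proof.
  intros Ha Hc. apply l2_of_bounded. intros N.
  apply Rle_trans with (rsum (fun k => 2 * (Cmod (a k) ^ 2 * b k ^ 2)
     + 2 * (Cmod (c k) ^ 2 * b k ^ 2)) N).
  - apply rsum_le. intros k _. generalize (Cmod_sqr_sum_le (a k) (- c k)).
    rewrite Cmod_opp. generalize (pow2_ge_0 (b k)). unfold Cminus. nra.
  - rewrite rsum_plus, !rsum_scal.
    generalize (rsum_le_sqnorm b a N Ha) (rsum_le_sqnorm b c N Hc). lra.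
Qed.

Lemma l2_ext (b : nat -> R) (a c : nat -> C) : (forall k, a k = c k) -> l2 b a -> l2 b c.
Proof. intros H. apply ex_series_ext. intros k. now rewrite H. Qed.

Lemma sqnorm_ext (b : nat -> R) (a c : nat -> C) : (forall k, a k = c k) -> sqnorm b a = sqnorm b c.
Proof. intros H. apply Series_ext. intros k. now rewrite H. Qed.

Lemma is_lim_seq_rsum (u : nat -> nat -> R) (l : nat -> R) P :
  (forall k, is_lim_seq (fun N => u N k) (l k)) ->
  is_lim_seq (fun N => rsum (u N) P) (rsum l P).
Proof.
  intros H. induction P as [|P IH]; simpl; [apply is_lim_seq_const|].
  now apply is_lim_seq_plus'.
Qed.

Definition disk_series (F : C -> C) (a : nat -> C) : Prop :=
  forall z, ballC 1 z -> pseries a z (F z).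

Lemma disk_series_unique (F G : C -> C) (a c : nat -> C) :
  (forall z, ballC 1 z -> F z = G z) -> disk_series F a -> disk_series G c ->
  forall k, a k = c k.
Proof.
  intros E Ha Hc. apply (pseries_coef_unique 1 a c F Rlt_0_1 Ha).
  intros z Hz. rewrite E by auto. now apply Hc.
Qed.

Lemma disk_series_comp (F f : C -> C) (a : nat -> C) : inner f -> disk_series F a ->
  exists c, disk_series (fun z => F (f z)) c.
Proof.
  intros [[r [Hr Hh]] [_ Hd]] Ha. apply Taylor; [lra|].
  apply (holo_comp _ (ballC 1) F f); auto.
  - now apply pseries_holo with a.
  - apply holo_subset with (2 := Hh). intros z. apply ballC_mono; lra.
Qed.

Lemma disk_series_hcd (F : C -> C) : hcd F -> disk_series F (tcoef F).
Proof.
  intros HF z Hz. destruct (hcd_pseries F HF) as [r [Hr H]]. apply H.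
  apply ballC_mono with (2 := Hz). lra.
Qed.

(** On a small circle [|f| <= s < 1], where the partial sums of [F] converge uniformly at the values
    of [f]; coefficients are means over that circle and so converge too. *)
Lemma disk_series_coef_lim (F f : C -> C) (a c : nat -> C) (m : nat) : inner f ->
  disk_series F a -> disk_series (fun z => F (f z)) c ->
  clim (fun N => tcoef (fun z => polyval a N (f z)) m) (c m).
Proof.
  intros Hf Ha Hc. assert (Hh := proj1 Hf).
  destruct (inner_small_circle f Hf) as [r [s [Hr [Hs Hsm]]]].
  set (u := (1 + s) / 2). assert (Hu : s < u < 1) by (unfold u; lra).
  destruct (pseries_coef_bound a u (F u)) as [K [HK0 HK]]; [lra| |].
  { apply Ha. unfold ballC. rewrite Cmod_R, Rabs_pos_eq; lra. }
  assert (Hsu : 0 < s / u < 1).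
  { split; [apply Rdiv_lt_0_compat; lra|]. apply Rmult_lt_reg_r with u; [lra|].
    unfold Rdiv. rewrite Rmult_assoc, Rinv_l; lra. }
  assert (Hunif : forall N w, Cmod w <= s ->
     Cmod (F w - polyval a N w) <= K / (1 - s / u) * (s / u) ^ N).
  { intros N w Hw.
    assert (Hs0 : RtoC s <> 0) by (apply RtoC_neq_0; lra).
    (* Rescaling by [s] turns the disk of radius [s] into the unit disk, as the remainder estimate
       requires, with ratio [s / u]. *)
    assert (E : forall k, (a k * s ^ k * (w / s) ^ k)%C = (a k * w ^ k)%C).
    { intros k. rewrite <- Cmult_assoc, <- Cpow_mult_l. do 2 f_equal. field; auto. }
    replace (polyval a N w) with (csum (fun k => a k * s ^ k * (w / s) ^ k)%C N)
      by (apply csum_ext; auto).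
    apply (pseries_remainder (fun k => a k * s ^ k)%C); auto.
    - intros k. rewrite Cmod_mult, Cmod_pow, Cmod_R, Rabs_pos_eq by lra.
      assert (Huk : 0 < u ^ k) by (apply pow_lt; lra).
      unfold Rdiv. rewrite Rpow_mult_distr, pow_inv.
      replace (Cmod (a k) * s ^ k) with (Cmod (a k) * u ^ k * (s ^ k * / u ^ k)) by (field; lra).
      apply Rmult_le_compat_r; auto.
      apply Rmult_le_pos; [apply pow_le; lra|]. apply Rlt_le, Rinv_0_lt_compat; auto.
    - rewrite Cmod_div, Cmod_R, Rabs_pos_eq by (auto; lra).
      apply Rmult_le_reg_r with s; [lra|]. unfold Rdiv.
      rewrite Rmult_assoc, Rinv_l by lra. lra.
    - apply clim_ext with (csum (fun k => a k * w ^ k)%C).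
      + intros n. apply csum_ext. intros k _. now rewrite E.
      + apply Ha. unfold ballC; lra. }
  assert (Hrm : 0 < r ^ m) by (apply pow_lt; lra).
  apply clim_le with (fun N => / r ^ m * (K / (1 - s / u)) * (s / u) ^ N).
  2:{ apply is_lim_seq_0_scal, is_lim_seq_0_pow. lra. }
  intros N.
  assert (Hp := hcd_polyval_comp f a N Hh).
  assert (E1 : cmean (fun t => F (f (r * cis t)) * Cconj (cis t) ^ m)%C = (c m * r ^ m)%C).
  { apply (Taylor_coef 1 r c (fun z => F (f z)) m Hc). lra. }
  assert (E2 : cmean (fun t => polyval a N (f (r * cis t)) * Cconj (cis t) ^ m)%C
     = (tcoef (fun z => polyval a N (f z)) m * r ^ m)%C).
  { apply (Taylor_coef 1 r _ (fun z => polyval a N (f z)) m); [|lra].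
    now apply disk_series_hcd. }
  assert (Hcc : forall G, holo (ballC 1) G -> ccont (fun t => G (r * cis t)%C)).
  { intros G HG. apply (ccont_comp (ballC 1)); auto using ccont_circle.
    intros t. unfold ballC. rewrite Cmod_circle; lra. }
  assert (Hc1 : ccont (fun t => F (f (r * cis t)%C))).
  { apply (Hcc (fun z => F (f z))). now apply pseries_holo with c. }
  assert (Hc2 : ccont (fun t => polyval a N (f (r * cis t)%C))).
  { apply (Hcc (fun z => polyval a N (f z))).
    apply pseries_holo with (tcoef (fun z => polyval a N (f z))).
    now apply (disk_series_hcd (fun z => polyval a N (f z))). }
  apply Rmult_le_reg_r with (r ^ m); auto.
  replace (/ r ^ m * (K / (1 - s / u)) * (s / u) ^ N * r ^ m) with
    (K / (1 - s / u) * (s / u) ^ N) by (field; split; [lra|]; split; lra).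
  rewrite Cmod_minus_sym.
  replace (r ^ m) with (Cmod (r ^ m)%C) by (rewrite Cmod_pow, Cmod_R, Rabs_pos_eq; lra).
  rewrite <- Cmod_mult.
  replace ((c m - tcoef (fun z => polyval a N (f z)) m) * r ^ m)%C with
    (c m * r ^ m - tcoef (fun z => polyval a N (f z)) m * r ^ m)%C by ring.
  rewrite <- E1, <- E2, <- cmean_minus by ccont_tac.
  apply cmean_bound; [ccont_tac|]. intros t _.
  replace (_ - _)%C with ((F (f (r * cis t)%C) - polyval a N (f (r * cis t)%C)) * Cconj (cis t) ^ m)%C
    by ring.
  rewrite Cmod_mult, Cmod_pow, Cmod_conj, Cmod_cis, pow1, Rmult_1_r. now apply Hunif.
Qed.

(** The polynomial bound is uniform in [N] and [P]. For fixed [P] only finitely many coefficients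
    occur and [N] can tend to infinity; the bound then holds for every [P]. *)
Lemma composition_bounded (f : C -> C) (b : nat -> R) : inner f -> regular b ->
  exists K, 0 <= K /\ forall F a c, disk_series F a -> l2 b a ->
    disk_series (fun z => F (f z)) c -> l2 b c /\ sqnorm b c <= K * sqnorm b a.
Proof.
  intros Hf Hb. destruct (polyval_composition_bound f b Hf Hb) as [K [HK H]].
  exists K. split; auto. intros F a c Ha Hla Hc. apply l2_of_bounded. intros P.
  apply (is_lim_seq_le (fun N => rsum (fun m => Cmod (tcoef (fun z => polyval a N (f z)) m) ^ 2 * b m ^ 2) P)
    (fun _ => K * sqnorm b a) (Finite (rsum (fun k => Cmod (c k) ^ 2 * b k ^ 2) P)) (K * sqnorm b a)).
  - intros N. apply Rle_trans with (1 := H a N P). apply Rmult_le_compat_l; auto.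
    now apply rsum_le_sqnorm.
  - apply is_lim_seq_rsum. intros m.
    apply (is_lim_seq_scal_r _ (b m ^ 2) (Cmod (c m) ^ 2)).
    replace (Cmod (c m) ^ 2) with (Cmod (c m) * Cmod (c m)) by ring.
    apply is_lim_seq_ext with (fun N => Cmod (tcoef (fun z => polyval a N (f z)) m)
      * Cmod (tcoef (fun z => polyval a N (f z)) m)); [intros; ring|].
    apply is_lim_seq_mult'; apply clim_mod; now apply disk_series_coef_lim with F.
  - apply is_lim_seq_const.
Qed.

Lemma disk_series_truncation (F : C -> C) (a : nat -> C) N : disk_series F a ->
  disk_series (fun z => F z - polyval a N z)%C (fun k => if Nat.ltb k N then RtoC 0 else a k).
Proof.
  intros Ha z Hz.
  apply (is_lim_seq_incr_n (fun n => Cmod (csum (fun k => (if Nat.ltb k N then RtoC 0 else a k) * z ^ k)%C n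
     - (F z - polyval a N z))) N).
  apply clim_ext with (fun n => csum (fun k => a k * z ^ k)%C (n + N) - polyval a N z)%C.
  - intros n. induction n as [|n IH]; simpl.
    + unfold polyval. transitivity (0 * csum (fun _ => 0%C) N)%C; [ring|].
      rewrite <- csum_scal. apply csum_ext.
      intros k Hk. apply Nat.ltb_lt in Hk. rewrite Hk. ring.
    + rewrite <- IH. replace (Nat.ltb (n + N) N) with false; [ring|].
      symmetry. apply Nat.ltb_ge. lia.
  - apply clim_minus; [|apply clim_const].
    apply (is_lim_seq_incr_n (fun n => Cmod (csum (fun k => a k * z ^ k)%C n - F z)) N).
    now apply Ha.
Qed.

Lemma sqnorm_truncation (b : nat -> R) (a : nat -> C) N : l2 b a ->
  l2 b (fun k => if Nat.ltb k N then RtoC 0 else a k) /\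
  sqnorm b (fun k => if Nat.ltb k N then RtoC 0 else a k)
  <= sqnorm b a - rsum (fun k => Cmod (a k) ^ 2 * b k ^ 2) N.
Proof.
  intros Ha. apply l2_of_bounded. intros P.
  assert (H : forall Q, rsum (fun k => Cmod (if Nat.ltb k N then RtoC 0 else a k) ^ 2 * b k ^ 2) (Q + N)
     + rsum (fun k => Cmod (a k) ^ 2 * b k ^ 2) N
     = rsum (fun k => Cmod (a k) ^ 2 * b k ^ 2) (Q + N)).
  { induction Q as [|Q IH]; cbn [rsum Nat.add].
    - rewrite (rsum_ext _ (fun _ => 0 * 0)), rsum_scal; [ring|].
      intros k Hk. apply Nat.ltb_lt in Hk. rewrite Hk, Cmod_0. ring.
    - rewrite <- IH. replace (Nat.ltb (Q + N) N) with false; [ring|].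
      symmetry. apply Nat.ltb_ge. lia. }
  apply Rle_trans with (rsum (fun k => Cmod (if Nat.ltb k N then RtoC 0 else a k) ^ 2 * b k ^ 2) (P + N)).
  - apply rsum_mono; [|lia]. intros k. apply Rmult_le_pos; apply pow2_ge_0.
  - generalize (rsum_le_sqnorm b a (P + N) Ha). specialize (H P). lra.
Qed.

(** The lower bound is applied to the partial sums of [F]. Their compositions differ from [F o f] by
    the composed tail, which the upper bound [K1] controls by the norm of the tail; this vanishes as
    [N] grows. The factor 2 comes from squaring a sum. *)
Lemma composition_below_fixing_0 (f : C -> C) (b : nat -> R) : inner f -> f 0 = 0 ->
  regular b -> exists K, 0 <= K /\ forall F a c, disk_series F a -> l2 b a ->
    disk_series (fun z => F (f z)) c -> sqnorm b a <= K * sqnorm b c.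
Proof.
  intros Hf Hf0 Hb.
  destruct (polyval_composition_below f b Hf Hf0 Hb) as [K [HK H]].
  destruct (composition_bounded f b Hf Hb) as [K1 [HK1 H1]].
  exists (K * 2). split; [lra|]. intros F a c Ha Hla Hc.
  destruct (H1 F a c Ha Hla Hc) as [Hlc _].
  set (S0 := fun N => rsum (fun k => Cmod (a k) ^ 2 * b k ^ 2) N).
  assert (HN : forall N, S0 N <= K * (2 * sqnorm b c + 2 * (K1 * (sqnorm b a - S0 N)))).
  { intros N. apply H. intros P.
    set (e := fun k => if Nat.ltb k N then RtoC 0 else a k).
    set (cN := tcoef (fun z => polyval a N (f z))).
    assert (Hp := hcd_polyval_comp f a N (proj1 Hf)).
    assert (He := disk_series_truncation F a N Ha).
    destruct (sqnorm_truncation b a N Hla) as [Hle Hse].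
    assert (Hce : disk_series (fun z => F (f z) - polyval a N (f z))%C (fun k => c k - cN k)%C).
    { intros z Hz. apply pseries_minus; [now apply Hc|].
      now apply (disk_series_hcd (fun z => polyval a N (f z))). }
    destruct (H1 (fun z => F z - polyval a N z)%C e _ He Hle Hce) as [Hlce Hsce].
    apply Rle_trans with (rsum (fun m => 2 * (Cmod (c m) ^ 2 * b m ^ 2)
       + 2 * (Cmod (c m - cN m) ^ 2 * b m ^ 2)) P).
    - apply rsum_le. intros m _. fold cN.
      assert (Hm : Cmod (cN m) ^ 2 <= 2 * Cmod (c m) ^ 2 + 2 * Cmod (c m - cN m) ^ 2).
      { rewrite <- (Cmod_opp (c m - cN m)).
        replace (cN m) with (c m + - (c m - cN m))%C at 1 by ring. apply Cmod_sqr_sum_le. }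
      generalize (pow2_ge_0 (b m)). nra.
    - rewrite rsum_plus, !rsum_scal.
      generalize (rsum_le_sqnorm b c P Hlc) (rsum_le_sqnorm b _ P Hlce).
      assert (K1 * sqnorm b e <= K1 * (sqnorm b a - S0 N)) by now apply Rmult_le_compat_l.
      lra. }
  assert (Hlim : is_lim_seq S0 (sqnorm b a)).
  { apply is_series_rsum. now apply Series_correct. }
  apply (is_lim_seq_le S0 (fun N => K * (2 * sqnorm b c + 2 * (K1 * (sqnorm b a - S0 N))))
    (sqnorm b a) (K * 2 * sqnorm b c)); auto.
  replace (K * 2 * sqnorm b c) with (K * (2 * sqnorm b c + 2 * (K1 * (sqnorm b a - sqnorm b a)))) by ring.
  apply (is_lim_seq_scal_l _ K (2 * sqnorm b c + 2 * (K1 * (sqnorm b a - sqnorm b a)))).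
  apply is_lim_seq_plus'; [apply is_lim_seq_const|].
  apply (is_lim_seq_scal_l _ 2 (K1 * (sqnorm b a - sqnorm b a))).
  apply (is_lim_seq_scal_l _ K1 (sqnorm b a - sqnorm b a)).
  apply is_lim_seq_minus'; [apply is_lim_seq_const|auto].
Qed.

(* [F o f = (F o psi^-1) o (psi o f)] with [psi] the automorphism sending [f 0] to 0. *)
Lemma composition_below (f : C -> C) (b : nat -> R) : inner f -> regular b ->
  exists K, 0 <= K /\ forall F a c, disk_series F a -> l2 b a ->
    disk_series (fun z => F (f z)) c -> sqnorm b a <= K * sqnorm b c.
Proof.
  intros Hf Hb.
  assert (Hp : Cmod (f 0) < 1) by (apply Hf; rewrite Cmod_0; lra).
  set (p := f 0) in *.
  assert (Hp' : Cmod (- p) < 1) by now rewrite Cmod_opp.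
  assert (Hi := inner_bfactor p Hp). assert (Hi' := inner_bfactor (- p) Hp').
  destruct (composition_bounded _ b Hi Hb) as [K1 [HK1 H1]].
  destruct (composition_bounded _ b Hi' Hb) as [K2 [HK2 H2]].
  destruct (composition_below_fixing_0 (fun z => bfactor p (f z)) b) as [K [HK H]]; auto.
  { now apply inner_comp. }
  { fold p. apply bfactor_self. }
  exists (K1 * K). split; [now apply Rmult_le_pos|]. intros F a c Ha Hla Hc.
  set (G := fun z => F (bfactor (- p) z)).
  destruct (disk_series_comp F _ a Hi' Ha) as [g Hg].
  destruct (H2 F a g Ha Hla Hg) as [Hlg _].
  assert (HGF : forall z, ballC 1 z -> G (bfactor p z) = F z).
  { intros z Hz. unfold G. rewrite bfactor_inv; auto. unfold ballC in Hz; lra. }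
  assert (Hga : disk_series (fun z => G (bfactor p z)) a).
  { intros z Hz. rewrite HGF by auto. now apply Ha. }
  assert (Hgc : disk_series (fun z => G (bfactor p (f z))) c).
  { intros z Hz. rewrite HGF; [now apply Hc|]. now apply Hf. }
  destruct (H1 G g a Hg Hlg Hga) as [_ E1].
  assert (E2 := H G g c Hg Hlg Hgc).
  apply Rle_trans with (1 := E1). rewrite Rmult_assoc. now apply Rmult_le_compat_l.
Qed.

(** Point evaluations are continuous, by Cauchy-Schwarz with the weights [b] and [1 / b]; norm
    limits are thus also pointwise limits. *)
Lemma disk_series_eval_bound (b : nat -> R) (z : C) : regular b -> ballC 1 z ->
  exists K, 0 <= K /\ forall F a, disk_series F a -> l2 b a ->
    Cmod (F z) ^ 2 <= K * sqnorm b a.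
Proof.
  intros Hb Hz.
  assert (Hq : 0 <= Cmod z < 1) by (split; [apply Cmod_ge_0|exact Hz]).
  assert (HT := regular_summable _ _ (regular_inv b Hb) Hq).
  assert (Hp : forall k, 0 <= (Cmod z ^ k) ^ 2 * (/ b k) ^ 2)
    by (intros; apply Rmult_le_pos; apply pow2_ge_0).
  set (T := Series (fun k => (Cmod z ^ k) ^ 2 * (/ b k) ^ 2)) in *.
  assert (HT0 : 0 <= T) by now apply Series_nonneg.
  exists T. split; auto. intros F a Ha Hla.
  assert (Hs := sqnorm_nonneg b a Hla).
  assert (H : Cmod (F z) <= sqrt (T * sqnorm b a)).
  { apply clim_bound with (1 := Ha z Hz). intros N.
    apply Rle_trans with (1 := Cmod_csum_le _ _).
    rewrite <- (sqrt_pow2 (rsum _ N)) by (apply rsum_nonneg; intros; apply Cmod_ge_0).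
    apply sqrt_le_1_alt.
    apply Rle_trans with ((rsum (fun k => (Cmod z ^ k * / b k) * (Cmod (a k) * b k)) N) ^ 2).
    { right. f_equal. apply rsum_ext. intros k _. rewrite Cmod_mult, Cmod_pow. field.
      generalize (proj1 Hb k); lra. }
    apply Rle_trans with (1 := rsum_Cauchy_Schwarz _ _ _).
    apply Rmult_le_compat.
    - apply rsum_nonneg; intros; apply pow2_ge_0.
    - apply rsum_nonneg; intros; apply pow2_ge_0.
    - apply Rle_trans with (2 := rsum_le_Series _ N Hp HT). right. apply rsum_ext. intros; ring.
    - apply Rle_trans with (2 := rsum_le_sqnorm b a N Hla). right. apply rsum_ext. intros; ring. }
  rewrite <- (pow2_sqrt (T * sqnorm b a)) by now apply Rmult_le_pos.
  apply pow_incr. split; auto. apply Cmod_ge_0.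
Qed.

Lemma l2_disk_series (b : nat -> R) (a : nat -> C) : regular b -> l2 b a ->
  exists F, disk_series F a.
Proof.
  intros Hb Ha. exists (fun z => epsilon (inhabits (RtoC 0)) (pseries a z)).
  intros z Hz. apply epsilon_spec. apply csum_abs_cv.
  assert (Hq : 0 <= Cmod z < 1) by (split; [apply Cmod_ge_0|exact Hz]).
  assert (HT := regular_summable _ _ (regular_inv b Hb) Hq).
  apply (ex_series_le (V := R_CompleteNormedModule)) with
    (fun k => (Cmod z ^ k) ^ 2 * (/ b k) ^ 2 + Cmod (a k) ^ 2 * b k ^ 2).
  - intros k. unfold norm; simpl norm; unfold abs; simpl abs.
    rewrite Rabs_pos_eq by apply Cmod_ge_0. rewrite Cmod_mult, Cmod_pow.
    assert (Hbk := proj1 Hb k).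
    replace (Cmod (a k) * Cmod z ^ k) with ((Cmod z ^ k * / b k) * (Cmod (a k) * b k))
      by (field; lra).
    rewrite <- !Rpow_mult_distr.
    generalize (pow2_ge_0 (Cmod z ^ k * / b k - Cmod (a k) * b k))
      (pow2_ge_0 (Cmod z ^ k * / b k)) (pow2_ge_0 (Cmod (a k) * b k)). nra.
  - now apply (ex_series_plus (K := R_AbsRing) (V := R_NormedModule)).
Qed.

(** The Cauchy condition in the form [eps n + eps m] gives the explicit rate [eps n] towards the
    limit, by letting [m] tend to infinity in partial sums. *)
Lemma l2_complete (b : nat -> R) (a : nat -> nat -> C) (eps : nat -> R) : regular b ->
  (forall n, l2 b (a n)) -> is_lim_seq eps 0 ->
  (forall n m, sqnorm b (fun k => a n k - a m k)%C <= eps n + eps m) ->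
  exists c, l2 b c /\ forall n, sqnorm b (fun k => a n k - c k)%C <= eps n.
Proof.
  intros Hb Ha Heps H.
  assert (Hterm : forall k n m, Cmod (a n k - a m k) ^ 2 * b k ^ 2 <= eps n + eps m).
  { intros k n m. apply Rle_trans with (2 := H n m).
    destruct (l2_minus b (a n) (a m) (Ha n) (Ha m)) as [Hl _].
    apply Rle_trans with (2 := rsum_le_sqnorm b _ (S k) Hl).
    apply (rsum_term_le (fun k => Cmod (a n k - a m k) ^ 2 * b k ^ 2)); [|lia].
    intros j. apply Rmult_le_pos; apply pow2_ge_0. }
  assert (Hcv : forall k, exists l, clim (fun n => a n k) l).
  { intros k. assert (Hbk := proj1 Hb k).
    assert (HC : forall e, 0 < e -> exists N, forall n m, (N <= n)%nat -> (N <= m)%nat ->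
       Cmod (a n k - a m k) < e).
    { intros e He. apply is_lim_seq_spec in Heps.
      assert (He2 : 0 < (e * b k) ^ 2 / 2).
      { apply Rdiv_lt_0_compat; [|lra]. apply pow_lt. now apply Rmult_lt_0_compat. }
      destruct (Heps (mkposreal _ He2)) as [N HN]. exists N. intros n m Hn Hm.
      assert (Hn' := HN n Hn). assert (Hm' := HN m Hm). simpl in Hn', Hm'.
      rewrite Rminus_0_r in Hn', Hm'. apply Rabs_lt_between in Hn', Hm'.
      specialize (Hterm k n m).
      apply Rnot_le_lt. intros Hle.
      assert ((e * b k) ^ 2 <= (Cmod (a n k - a m k) * b k) ^ 2).
      { apply pow_incr. split; [apply Rmult_le_pos; lra|]. apply Rmult_le_compat_r; lra. }
      rewrite (Rpow_mult_distr (Cmod _)) in H0. simpl in *. lra. }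
    assert (HR : forall p : C -> R, (forall x y, p (x - y)%C = p x - p y) ->
       (forall x, Rabs (p x) <= Cmod x) -> ex_finite_lim_seq (fun n => p (a n k))).
    { intros p Hp1 Hp2. apply ex_lim_seq_cauchy_corr. intros e.
      destruct (HC e (cond_pos e)) as [N HN]. exists N. intros n m Hn Hm.
      rewrite <- Hp1. apply Rle_lt_trans with (1 := Hp2 _). now apply HN. }
    destruct (HR Re Re_minus re_le_Cmod) as [x Hx].
    destruct (HR Im Im_minus im_le_Cmod) as [y Hy].
    exists (x, y). now apply clim_re_im. }
  set (c := fun k => proj1_sig (constructive_indefinite_description _ (Hcv k))).
  assert (Hc : forall k, clim (fun n => a n k) (c k)) by (intros k; unfold c; apply proj2_sig).
  assert (Hn : forall n, l2 b (fun k => a n k - c k)%C /\ sqnorm b (fun k => a n k - c k)%C <= eps n).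
  { intros n. apply l2_of_bounded. intros P.
    apply (is_lim_seq_le (fun m => rsum (fun k => Cmod (a n k - a m k) ^ 2 * b k ^ 2) P)
      (fun m => eps n + eps m) (Finite (rsum (fun k => Cmod (a n k - c k) ^ 2 * b k ^ 2) P)) (eps n)).
    - intros m. apply Rle_trans with (2 := H n m). apply rsum_le_sqnorm. now apply l2_minus.
    - apply is_lim_seq_rsum. intros k.
      apply (is_lim_seq_scal_r _ (b k ^ 2) (Cmod (a n k - c k) ^ 2)).
      replace (Cmod (a n k - c k) ^ 2) with (Cmod (a n k - c k) * Cmod (a n k - c k)) by ring.
      apply is_lim_seq_ext with (fun m => Cmod (a n k - a m k) * Cmod (a n k - a m k));
        [intros; ring|].
      assert (Hm : is_lim_seq (fun m => Cmod (a n k - a m k)) (Cmod (a n k - c k))).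
      { apply (clim_mod (fun m => a n k - a m k)%C).
        apply clim_minus; [apply clim_const|apply Hc]. }
      now apply is_lim_seq_mult'.
    - replace (Finite (eps n)) with (Finite (eps n + 0)) by (f_equal; ring).
      apply is_lim_seq_plus'; [apply is_lim_seq_const|exact Heps]. }
  exists c. split; [|intros n; apply Hn].
  apply l2_ext with (fun k => a O k - (a O k - c k))%C; [intros; ring|].
  apply l2_minus; [apply Ha|apply Hn].
Qed.

(** * The equivalences *)

Lemma power_series_disk_series (f : C -> C) (a : nat -> C) :
  power_series_on_disk f a <-> disk_series f a.
Proof. split; intros H z Hz; apply is_pseries_pseries; now apply H. Qed.

Lemma coef_disk_series (f : C -> C) (a : nat -> C) :
  disk_series f a -> disk_series f (coef f).
Proof.
  intros H. apply power_series_disk_series. unfold coef. apply epsilon_spec.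
  exists a. now apply power_series_disk_series.
Qed.

Lemma coef_eq (f : C -> C) (a : nat -> C) : disk_series f a -> forall k, coef f k = a k.
Proof.
  intros H. apply (disk_series_unique f f); auto. now apply coef_disk_series with a.
Qed.

Lemma H2_iff (w : nat -> R) (f : C -> C) :
  H2 w f <-> disk_series f (coef f) /\ l2 (beta w) (coef f).
Proof. unfold H2. now rewrite power_series_disk_series. Qed.

Lemma H2_intro (w : nat -> R) (f : C -> C) (a : nat -> C) :
  disk_series f a -> l2 (beta w) a -> H2 w f.
Proof.
  intros H Ha. apply H2_iff. split; [now apply coef_disk_series with a|].
  apply l2_ext with a; auto. intros k. symmetry. now apply coef_eq.
Qed.

Lemma H2_norm_eq (w : nat -> R) (f : C -> C) (a : nat -> C) :
  disk_series f a -> H2_norm w f = sqrt (sqnorm (beta w) a).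
Proof.
  intros H. change (sqrt (sqnorm (beta w) (coef f)) = sqrt (sqnorm (beta w) a)).
  f_equal. apply sqnorm_ext. now apply coef_eq.
Qed.

Lemma disk_series_minus (f g : C -> C) (a c : nat -> C) :
  disk_series f a -> disk_series g c ->
  disk_series (fun z => f z - g z)%C (fun k => a k - c k)%C.
Proof. intros Hf Hg z Hz. apply pseries_minus; auto. Qed.

Lemma l2_of_decay (b : nat -> R) (a : nat -> C) (q K : R) : regular b -> 0 <= q < 1 ->
  (forall k, Cmod (a k) <= K * q ^ k) ->
  l2 b a /\ sqnorm b a <= K ^ 2 * Series (fun k => (q ^ k) ^ 2 * b k ^ 2).
Proof.
  intros Hb Hq Ha.
  assert (HT := regular_summable b q Hb Hq).
  assert (Hp : forall k, 0 <= (q ^ k) ^ 2 * b k ^ 2)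
    by (intros; apply Rmult_le_pos; apply pow2_ge_0).
  apply l2_of_bounded. intros N.
  apply Rle_trans with (rsum (fun k => K ^ 2 * ((q ^ k) ^ 2 * b k ^ 2)) N).
  - apply rsum_le. intros k _. rewrite <- Rmult_assoc.
    apply Rmult_le_compat_r; [apply pow2_ge_0|]. rewrite <- Rpow_mult_distr.
    apply pow_incr. split; auto. apply Cmod_ge_0.
  - rewrite rsum_scal. apply Rmult_le_compat_l; [apply pow2_ge_0|].
    now apply rsum_le_Series.
Qed.

Lemma hcd_H2 (w : nat -> R) (f : C -> C) : regular (beta w) -> hcd f -> H2 w f.
Proof.
  intros Hb Hf. apply H2_intro with (tcoef f); [now apply disk_series_hcd|].
  destruct (tcoef_decay f Hf) as [q [K [Hq [_ HK]]]].
  apply (l2_of_decay (beta w) (tcoef f) q K); auto. lra.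
Qed.

Lemma inner_bounded_operator (w : nat -> R) (f : C -> C) :
  inner f -> regular (beta w) -> bounded_operator w (composition_operator f).
Proof.
  intros Hf Hb. destruct (composition_bounded f _ Hf Hb) as [K [HK H]].
  assert (HH : forall F, H2 w F -> exists c, disk_series (fun z => F (f z)) c /\
     l2 (beta w) c /\ sqnorm (beta w) c <= K * sqnorm (beta w) (coef F)).
  { intros F HF. apply H2_iff in HF. destruct HF as [HF1 HF2].
    destruct (disk_series_comp F f _ Hf HF1) as [c Hc]. exists c. split; auto.
    now apply (H F). }
  split; [|split].
  - intros F HF. destruct (HH F HF) as [c [Hc [Hl _]]]. now apply H2_intro with c.
  - intros a b F G _ _ z _. reflexivity.
  - exists (sqrt K). intros F HF. destruct (HH F HF) as [c [Hc [Hl Hn]]].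
    rewrite (H2_norm_eq w (composition_operator f F) c Hc). apply H2_iff in HF. destruct HF as [HF1 HF2].
    rewrite (H2_norm_eq w F (coef F) HF1), <- sqrt_mult_alt by auto.
    now apply sqrt_le_1_alt.
Qed.

Lemma inner_kernel (w : nat -> R) (f : C -> C) :
  inner f -> regular (beta w) -> finite_dimensional (kernel w (composition_operator f)).
Proof.
  intros Hf Hb. destruct (composition_below f _ Hf Hb) as [K [HK H]].
  (* The lower bound makes the kernel zero, so the empty family spans it; the sum from 1 to 0 is the
     empty sum. *)
  exists O, (fun _ _ => RtoC 0). split; [lia|]. intros F [HF H0].
  exists (fun _ => RtoC 0). intros z Hz. rewrite sum_n_m_zero by lia.
  apply H2_iff in HF. destruct HF as [HF1 HF2].
  assert (Hc : disk_series (fun z => F (f z)) (fun _ => RtoC 0)).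
  { intros y Hy. change (F (f y)) with (composition_operator f F y). rewrite H0 by auto.
    apply clim_ext with (fun _ => RtoC 0); [|apply clim_const].
    intros n. rewrite (csum_ext _ (fun _ => 0 * 0)%C), csum_scal; [ring|].
    intros; ring. }
  assert (Hn := H F _ _ HF1 HF2 Hc).
  replace (sqnorm (beta w) (fun _ => RtoC 0)) with 0 in Hn.
  2:{ symmetry. apply is_series_unique, is_series_rsum.
      apply is_lim_seq_ext with (fun _ => 0); [|apply is_lim_seq_const].
      intros n. rewrite (rsum_ext _ (fun _ => 0 * 0)), rsum_scal; [ring|].
      intros k _. rewrite Cmod_0. ring. }
  rewrite Rmult_0_r in Hn.
  apply (pseries_zero (coef F) z); auto. intros k.
  assert (Hk : Cmod (coef F k) ^ 2 * beta w k ^ 2 <= 0).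
  { apply Rle_trans with (2 := Hn). apply Rle_trans with (2 := rsum_le_sqnorm _ _ (S k) HF2).
    apply (rsum_term_le (fun k => Cmod (coef F k) ^ 2 * beta w k ^ 2)); [|lia].
    intros; apply l2_term_nonneg. }
  assert (Hbk : 0 < beta w k ^ 2) by (apply pow_lt, Hb).
  apply Cmod_eq_0. assert (Hm := Cmod_ge_0 (coef F k)).
  destruct Hm as [Hm|Hm]; auto. assert (0 < Cmod (coef F k) ^ 2) by now apply pow_lt. nra.
Qed.

(** The lower bound turns a convergent sequence of images into a Cauchy sequence of preimages. Its
    limit [G] satisfies [G o f = g] because both sides are pointwise limits of the same sequence. *)
Lemma inner_closed_range (w : nat -> R) (f : C -> C) :
  inner f -> regular (beta w) -> closed_range w (composition_operator f).
Proof.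
  intros Hf Hb u g Hu Hg Hlim.
  destruct (composition_below f _ Hf Hb) as [K [HK H]].
  set (F := fun n => proj1_sig (constructive_indefinite_description _ (proj2 (Hu n)))).
  assert (HF : forall n, H2 w (F n) /\ eq_on_disk (composition_operator f (F n)) (u n))
    by (intros n; unfold F; apply proj2_sig).
  set (a := fun n => coef (F n)). set (c := fun n => coef (u n)). set (d := coef g).
  assert (Ha : forall n, disk_series (F n) (a n) /\ l2 (beta w) (a n))
    by (intros n; apply H2_iff, HF).
  assert (Hc : forall n, disk_series (u n) (c n) /\ l2 (beta w) (c n))
    by (intros n; apply H2_iff, Hu).
  apply H2_iff in Hg. fold d in Hg. destruct Hg as [Hd1 Hd2].
  set (e := fun n => sqnorm (beta w) (fun k => c n k - d k)%C).
  assert (Hcd : forall n, l2 (beta w) (fun k => c n k - d k)%C)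
    by (intros n; apply l2_minus; auto; apply Hc).
  assert (He0 : forall n, 0 <= e n) by (intros n; now apply sqnorm_nonneg).
  assert (He : is_lim_seq e 0).
  { apply is_lim_seq_ext with (fun n => H2_norm w (fun z => u n z - g z)%C * H2_norm w (fun z => u n z - g z)%C).
    - intros n. rewrite (H2_norm_eq w _ (fun k => c n k - d k)%C).
      + now apply sqrt_sqrt.
      + apply disk_series_minus; auto. apply Hc.
    - replace (Finite 0) with (Finite (0 * 0)) by (f_equal; ring).
      now apply is_lim_seq_mult'. }
  assert (Hcomp : forall n, disk_series (fun z => F n (f z)) (c n)).
  { intros n z Hz. change (F n (f z)) with (composition_operator f (F n) z).
    rewrite (proj2 (HF n) z Hz). now apply Hc. }
  assert (Hcauchy : forall n m, sqnorm (beta w) (fun k => a n k - a m k)%C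
     <= (2 * K) * e n + (2 * K) * e m).
  { intros n m.
    apply Rle_trans with (K * sqnorm (beta w) (fun k => c n k - c m k)%C).
    - apply (H (fun z => F n z - F m z)%C).
      + apply disk_series_minus; apply Ha.
      + apply l2_minus; apply Ha.
      + now apply (disk_series_minus (fun z => F n (f z)) (fun z => F m (f z))).
    - replace (2 * K * e n + 2 * K * e m) with (K * (2 * e n + 2 * e m)) by ring.
      apply Rmult_le_compat_l; auto.
      rewrite (sqnorm_ext _ _ (fun k => (c n k - d k) - (c m k - d k))%C) by (intros; ring).
      now apply l2_minus. }
  destruct (l2_complete (beta w) a (fun n => (2 * K) * e n) Hb) as [al [Hal1 Hal2]]; auto.
  { intros n; apply Ha. }
  { now apply is_lim_seq_0_scal. }
  destruct (l2_disk_series (beta w) al Hb Hal1) as [G HG].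
  exists G. split; [now apply H2_intro with al|].
  intros z Hz. unfold composition_operator.
  assert (Hfz : ballC 1 (f z)) by now apply Hf.
  destruct (disk_series_eval_bound (beta w) (f z) Hb Hfz) as [K1 [HK1 E1]].
  destruct (disk_series_eval_bound (beta w) z Hb Hz) as [K2 [HK2 E2]].
  assert (Hsq : Cmod (G (f z) - g z) ^ 2 <= 0).
  { apply (is_lim_seq_le (fun _ => Cmod (G (f z) - g z) ^ 2)
      (fun n => (2 * K1 * (2 * K) + 2 * K2) * e n) (Cmod (G (f z) - g z) ^ 2) 0).
    - intros n.
      replace (G (f z) - g z)%C with (- (F n (f z) - G (f z)) + (u n z - g z))%C.
      2:{ rewrite <- (proj2 (HF n) z Hz). unfold composition_operator. ring. }
      apply Rle_trans with (1 := Cmod_sqr_sum_le _ _). rewrite Cmod_opp.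
      assert (B1 := E1 (fun z => F n z - G z)%C _ (disk_series_minus _ _ _ _ (proj1 (Ha n)) HG)
        (proj1 (l2_minus _ _ _ (proj2 (Ha n)) Hal1))).
      assert (B2 := E2 (fun z => u n z - g z)%C _ (disk_series_minus _ _ _ _ (proj1 (Hc n)) Hd1)
        (Hcd n)).
      fold (e n) in B2. specialize (Hal2 n).
      apply Rmult_le_compat_l with (r := K1) in Hal2; auto. lra.
    - apply is_lim_seq_const.
    - now apply is_lim_seq_0_scal. }
  apply Cminus_eq_0. generalize (Cmod_ge_0 (G (f z) - g z)). nra.
Qed.

(* [binser N k] is the coefficient of [z^k] in [(1 - z)^-(N+1)]. *)
Fixpoint binser (N k : nat) : R :=
  match N with O => 1 | S M => rsum (binser M) (S k) end.

Lemma binser_nonneg (N k : nat) : 0 <= binser N k.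
Proof.
  revert k. induction N as [|N IH]; intros k; simpl binser; [lra|].
  exact (rsum_nonneg _ (S k) IH).
Qed.

Lemma binser_upper (N k : nat) : binser N k <= (INR k + 1) ^ N.
Proof.
  revert k. induction N as [|N IH]; intros k; [simpl; lra|].
  cbn [binser]. apply Rle_trans with (rsum (fun _ => (INR k + 1) ^ N) (S k)).
  - apply rsum_le. intros j Hj. apply Rle_trans with (1 := IH j).
    apply pow_incr. split; [apply Rlt_le, INR_1_pos|].
    apply Rplus_le_compat_r, le_INR. lia.
  - right. replace ((INR k + 1) ^ S N) with ((INR k + 1) * (INR k + 1) ^ N) by (simpl; ring).
    generalize ((INR k + 1) ^ N). clear. intros y.
    replace (INR k + 1) with (INR (S k)) by (rewrite S_INR; ring).
    induction (S k) as [|n IHn]; [simpl; ring|]. rewrite S_INR. cbn [rsum]. rewrite IHn. ring.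
Qed.

Lemma pow_diff_le (x : R) (N : nat) : 1 <= x ->
  x ^ S N - (x - 1) ^ S N <= (INR N + 1) * x ^ N.
Proof.
  intros Hx. induction N as [|N IH]; [simpl; lra|].
  assert (Hp : 0 <= x ^ N) by (apply pow_le; lra).
  replace (x ^ S (S N) - (x - 1) ^ S (S N)) with
    (x ^ S N + (x - 1) * (x ^ S N - (x - 1) ^ S N)) by (simpl; ring).
  apply Rle_trans with (x ^ S N + (x - 1) * ((INR N + 1) * x ^ N)).
  - apply Rplus_le_compat_l, Rmult_le_compat_l; lra.
  - rewrite S_INR. assert (HN := INR_1_pos N).
    assert (0 <= (INR N + 1) * x ^ N) by (apply Rmult_le_pos; lra).
    simpl. nra.
Qed.

(** By telescoping, [(k + 1) ^ (N + 1)] is a sum of differences of consecutive powers, each at most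
    [(N + 1) (j + 1) ^ N] by [pow_diff_le]; the factors [N + 1] build up the factorial. *)
Lemma binser_lower (N k : nat) : (INR k + 1) ^ N <= INR (fact N) * binser N k.
Proof.
  revert k. induction N as [|N IH]; intros k; [simpl; lra|].
  rewrite fact_simpl, mult_INR, S_INR. cbn [binser].
  apply Rle_trans with ((INR N + 1) * rsum (fun j => (INR j + 1) ^ N) (S k)).
  - induction k as [|k IHk].
    + cbn [rsum]. simpl (INR 0). rewrite !Rplus_0_l, !pow1. generalize (pos_INR N). lra.
    + change (rsum (fun j => (INR j + 1) ^ N) (S (S k))) with
        (rsum (fun j => (INR j + 1) ^ N) (S k) + (INR (S k) + 1) ^ N).
      assert (H := pow_diff_le (INR (S k) + 1) N).
      replace (INR (S k) + 1 - 1) with (INR k + 1) in H by (rewrite S_INR; ring).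
      assert (1 <= INR (S k) + 1) by (generalize (pos_INR (S k)); lra).
      specialize (H H0). lra.
  - rewrite Rmult_assoc, <- (rsum_scal (INR (fact N))).
    apply Rmult_le_compat_l; [apply Rlt_le, INR_1_pos|].
    apply rsum_le. intros j _. apply IH.
Qed.

Lemma is_lim_seq_poly_geom (p : nat) (q : R) : 0 <= q < 1 ->
  is_lim_seq (fun n => (INR n + 1) ^ p * q ^ n) 0.
Proof.
  intros Hq. assert (H := ex_series_lim_0 _ (ex_series_poly_geom p q Hq)). exact H.
Qed.

Lemma binser_pseries (N : nat) (z : C) : Cmod z < 1 ->
  pseries (fun k => RtoC (binser N k)) z ((/ (1 - z)) ^ S N)%C.
Proof.
  intros Hz.
  assert (Hd : (1 - z)%C <> 0).
  { intros E. apply (f_equal Cmod) in E. rewrite Cmod_0 in E.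
    generalize (Cmod_le_minus 1 z). rewrite E, Cmod_1. lra. }
  assert (Hq : 0 <= Cmod z < 1) by (split; [apply Cmod_ge_0|easy]).
  (* Summation by parts: multiplying by [1 - z] undoes the passage from [x] to its partial sums, up
     to a boundary term, which tends to 0 because [binser] grows polynomially. *)
  assert (Habel : forall (x : nat -> R) n,
    ((1 - z) * csum (fun k => RtoC (rsum x (S k)) * z ^ k) n
    = csum (fun k => x k * z ^ k) n - RtoC (rsum x n) * z ^ n)%C).
  { intros x n. induction n as [|n IH]; cbn [csum]; [simpl; ring|].
    rewrite Cmult_plus_distr_l, IH. cbn [rsum]. rewrite RtoC_plus. simpl. ring. }
  induction N as [|N IH].
  - apply clim_le with (fun n => / Cmod (1 - z) * Cmod z ^ n).
    2:{ apply is_lim_seq_0_scal, is_lim_seq_0_pow. easy. }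
    intros n. right.
    replace (csum (fun k => RtoC (binser 0 k) * z ^ k)%C n) with ((1 - z ^ n) / (1 - z))%C.
    + replace ((1 - z ^ n) / (1 - z) - (/ (1 - z)) ^ 1)%C with (- (/ (1 - z) * z ^ n))%C
        by (simpl; field; auto).
      now rewrite Cmod_opp, Cmod_mult, Cmod_inv, Cmod_pow.
    + rewrite <- csum_geom. rewrite (csum_ext (fun k => RtoC (binser 0 k) * z ^ k)%C (fun k => z ^ k)%C).
      * field; auto.
      * intros k _. simpl binser. ring.
  - replace ((/ (1 - z)) ^ S (S N))%C with (/ (1 - z) * ((/ (1 - z)) ^ S N - 0))%C
      by (simpl; ring).
    apply clim_ext with (fun n => / (1 - z) *
      (csum (fun k => RtoC (binser N k) * z ^ k) n - RtoC (rsum (binser N) n) * z ^ n))%C.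
    + intros n. rewrite <- Habel.
      change (csum (fun k => RtoC (binser (S N) k) * z ^ k)%C n) with
        (csum (fun k => RtoC (rsum (binser N) (S k)) * z ^ k)%C n).
      field; auto.
    + apply clim_scal, clim_minus; auto.
      apply clim_le with (fun n => (INR n + 1) ^ S N * Cmod z ^ n).
      2:{ now apply is_lim_seq_poly_geom. }
      intros n. replace (_ - 0)%C with (RtoC (rsum (binser N) n) * z ^ n)%C by ring.
      rewrite Cmod_mult, Cmod_pow, Cmod_R, Rabs_pos_eq.
      * apply Rmult_le_compat_r; [apply pow_le, Cmod_ge_0|].
        apply Rle_trans with (2 := binser_upper (S N) n). cbn [binser rsum].
        generalize (binser_nonneg N n). lra.
      * apply rsum_nonneg, binser_nonneg.
Qed.

(** * A missed point of the circle prevents closed range *)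

Lemma Cpow_diff_le (x y : C) (M : R) (n : nat) : Cmod x <= M -> Cmod y <= M ->
  Cmod (x ^ S n - y ^ S n) <= (INR n + 1) * M ^ n * Cmod (x - y).
Proof.
  intros Hx Hy. assert (HM : 0 <= M) by (apply Rle_trans with (2 := Hx), Cmod_ge_0).
  induction n as [|n IH].
  - simpl. rewrite !Cmult_1_r. lra.
  - replace (x ^ S (S n) - y ^ S (S n))%C with (x * (x ^ S n - y ^ S n) + (x - y) * y ^ S n)%C
      by (simpl; ring).
    apply Rle_trans with (1 := Cmod_triangle _ _). rewrite !(Cmod_mult _ (_ ^ _ - _ ^ _)).
    rewrite (Cmod_mult (x - y)), Cmod_pow.
    assert (H1 : Cmod x * Cmod (x ^ S n - y ^ S n) <= M * ((INR n + 1) * M ^ n * Cmod (x - y))).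
    { apply Rmult_le_compat; auto using Cmod_ge_0. }
    assert (H2 : Cmod (x - y) * Cmod y ^ S n <= Cmod (x - y) * M ^ S n).
    { apply Rmult_le_compat_l; [apply Cmod_ge_0|]. apply pow_incr. split; auto using Cmod_ge_0. }
    rewrite S_INR. simpl in *. lra.
Qed.

Lemma holo_bounded (R0 r : R) (f : C -> C) : holo (ballC R0) f -> 0 < r < R0 ->
  exists B, 0 <= B /\ forall z, Cmod z <= r -> Cmod (f z) <= B.
Proof.
  intros Hf Hr. destruct (Taylor R0 f) as [a Ha]; [lra|auto|].
  set (s := (r + R0) / 2). assert (Hs : r < s < R0) by (unfold s; lra).
  destruct (pseries_coef_bound a s (f s)) as [K [HK0 HK]]; [lra| |].
  { apply Ha. unfold ballC. rewrite Cmod_R, Rabs_pos_eq; lra. }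
  assert (HS := ex_series_coef_bound a s K r 0 HK (conj (Rlt_le _ _ (proj1 Hr)) (proj1 Hs))).
  assert (Hp : forall k, 0 <= (INR k + 1) ^ 0 * Cmod (a k) * r ^ k).
  { intros k. simpl. rewrite Rmult_1_l. apply Rmult_le_pos; [apply Cmod_ge_0|apply pow_le; lra]. }
  exists (Series (fun k => (INR k + 1) ^ 0 * Cmod (a k) * r ^ k)).
  split; [now apply Series_nonneg|]. intros z Hz.
  apply clim_bound with (1 := Ha z ltac:(unfold ballC; lra)). intros n.
  apply Rle_trans with (1 := Cmod_csum_le _ _).
  apply Rle_trans with (2 := rsum_le_Series _ n Hp HS).
  apply rsum_le. intros k _. rewrite Cmod_mult, Cmod_pow. simpl. rewrite Rmult_1_l.
  apply Rmult_le_compat_l; [apply Cmod_ge_0|]. apply pow_incr. split; auto using Cmod_ge_0.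
Qed.

Lemma tcoef_Cauchy_estimate (R0 r B : R) (f : C -> C) : holo (ballC R0) f -> 1 < r < R0 ->
  0 <= B -> (forall z, Cmod z = r -> Cmod (f z) <= B) ->
  forall k, Cmod (tcoef f k) <= B * (/ r) ^ k.
Proof.
  intros Hf Hr HB0 HB k. destruct (Taylor R0 f) as [a Ha]; [lra|auto|].
  rewrite (tcoef_eq f a R0) by (auto; lra).
  assert (Hrk : 0 < r ^ k) by (apply pow_lt; lra).
  apply Rmult_le_reg_r with (r ^ k); auto.
  rewrite pow_inv, Rmult_assoc, Rinv_l, Rmult_1_r by lra.
  replace (Cmod (a k) * r ^ k) with (Cmod (a k * r ^ k)).
  2:{ rewrite Cmod_mult, Cmod_pow, Cmod_R, Rabs_pos_eq; auto; lra. }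
  rewrite <- (Taylor_coef R0 r a f k Ha) by lra.
  assert (Hc : ccont (fun t => f (r * cis t)%C)).
  { apply (ccont_comp (ballC R0)); auto using ccont_circle.
    intros t. unfold ballC. rewrite Cmod_circle; lra. }
  apply cmean_bound; [ccont_tac|]. intros t _.
  rewrite Cmod_mult, Cmod_pow, Cmod_conj, Cmod_cis, pow1, Rmult_1_r.
  apply HB, Cmod_circle. lra.
Qed.

Lemma closed_range_covers_circle (w : nat -> R) (f : C -> C) : regular (beta w) -> hcd f ->
  nonconstant f -> (forall z, Cmod z <= 1 -> Cmod (f z) <= 1) ->
  closed_range w (composition_operator f) ->
  forall y, circle y -> image f closed_disk y.
Proof.
  intros Hb Hf Hn Hm Hcl zeta Hzeta. apply NNPP. intros Hno.
  assert (Hfd : forall z, Cmod z < 1 -> Cmod (f z) < 1).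
  { apply self_map_disk; auto. intros z Hz. apply Hm. lra. }
  (* The exponent of the weight: [beta w k >= beta w 0 / (k + 1) ^ N], which coefficients of order
     [k ^ N] compensate. *)
  destruct (proj2 Hb) as [N HN].
  set (kap := Cconj zeta).
  assert (Hkap : Cmod kap = 1) by (unfold kap; now rewrite Cmod_conj).
  assert (Hkz : (zeta * kap)%C = 1).
  { unfold kap. rewrite <- Cmod2_conj, Hzeta. f_equal. ring. }
  set (psi := fun z => (1 - kap * f z)%C).
  assert (Hpsi : hcd psi).
  { apply hcd_minus; [apply hcd_const|]. apply hcd_mult; [apply hcd_const|auto]. }
  assert (Hpsi0 : forall z, Cmod z <= 1 -> psi z <> 0).
  { intros z Hz E. apply Hno. exists z. split; auto.
    unfold psi in E.
    replace (f z) with ((zeta * kap) * f z)%C by (rewrite Hkz; ring).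
    replace (zeta * kap * f z)%C with (zeta * (1 - (1 - kap * f z)))%C by ring.
    rewrite E. ring. }
  destruct (hcd_nonvanishing psi Hpsi Hpsi0) as [R0 [HR [Hh Hnz]]].
  set (q := fun z => (/ psi z)%C).
  assert (Hq : holo (ballC R0) q) by now apply holo_inv.
  (* Estimates of [q] are made on the disk of radius [r]. Cauchy estimates on the circle of radius
     [r1], strictly between 1 and [r], turn uniform smallness into geometric decay of coefficients,
     hence into smallness in the weighted norm. *)
  set (r := (1 + R0) / 2). set (r1 := (1 + r) / 2).
  assert (Hr : 1 < r1 < r /\ r < R0) by (unfold r1, r; lra).
  destruct (holo_bounded R0 r q Hq) as [B [HB0 HB]]; [lra|].
  (* The dilation factor is [1 - t n]. The normalisation gives [t n * (B + 1) <= / 2], so that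
     [1 + t n * (q z - 1)] has modulus at least [/ 2]. *)
  set (t := fun n => / (2 * (B + 1)) * / (INR n + 1)).
  assert (Ht : forall n, 0 < t n /\ t n * (B + 1) <= / 2 /\ t n <= / 2).
  { intros n. assert (Hn1 := INR_1_pos n). assert (Hn0 := pos_INR n).
    assert (H1 : 0 < / (INR n + 1) <= 1).
    { split; [now apply Rinv_0_lt_compat|]. rewrite <- Rinv_1. apply Rinv_le_contravar; lra. }
    assert (H2 : 0 < / (2 * (B + 1)) <= / 2).
    { split; [apply Rinv_0_lt_compat; lra|]. apply Rinv_le_contravar; lra. }
    assert (H3 : / (2 * (B + 1)) * (B + 1) = / 2) by (field; lra).
    unfold t. split; [now apply Rmult_lt_0_compat|]. split; nra. }
  assert (Htlim : is_lim_seq t 0).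
  { apply is_lim_seq_0_scal.
    apply is_lim_seq_ext with (fun n => / INR (S n)); [intros; now rewrite S_INR|].
    apply (is_lim_seq_incr_1 (fun n => / INR n)).
    apply (is_lim_seq_inv INR p_infty); [apply is_lim_seq_INR|easy]. }
  set (F := fun z => ((/ (1 - kap * z)) ^ S N)%C).
  set (Fn := fun n z => ((/ (1 - (1 - t n)%R * kap * z)) ^ S N)%C).
  assert (HFn : forall n, hcd (Fn n)).
  { intros n. apply hcd_pow, hcd_inv.
    - apply hcd_minus; [apply hcd_const|]. apply hcd_mult; [apply hcd_const|apply hcd_id].
    - intros z Hz E. apply (f_equal Cmod) in E. rewrite Cmod_0 in E.
      generalize (Cmod_le_minus 1 ((1 - t n)%R * kap * z)).
      rewrite E, Cmod_1, !Cmod_mult, Hkap, Cmod_R, Rabs_pos_eq.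
      + destruct (Ht n) as [H1 [_ H2]]. generalize (Cmod_ge_0 z). nra.
      + destruct (Ht n) as [H1 [_ H2]]. lra. }
  set (g := fun z => F (f z)).
  assert (Hg : hcd g) by (apply hcd_pow; now apply hcd_inv).
  (* The first two factors are the Lipschitz constant of the power [N + 1] on the disk of radius
     [2 B]; the last bounds [|v - q z| / t n], where [v] is the dilated version of [q z]. *)
  set (K := (INR N + 1) * (2 * B) ^ N * ((B + 1) * (2 * B))).
  assert (HK : 0 <= K).
  { unfold K. apply Rmult_le_pos; [apply Rmult_le_pos|apply Rmult_le_pos; lra].
    - apply Rlt_le, INR_1_pos.
    - apply pow_le; lra. }
  assert (Hun : forall n, hcd (fun z => Fn n (f z))) by (intros n; now apply hcd_comp).
  assert (Hq1 : forall n z, Cmod z <= r ->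
     / 2 <= Cmod (1 + t n * (q z - 1)) /\ Cmod (t n * (q z - 1)) <= t n * (B + 1)).
  { intros n z Hz. destruct (Ht n) as [H1 [H2 _]].
    assert (H3 : Cmod (t n * (q z - 1)) <= t n * (B + 1)).
    { rewrite Cmod_mult, Cmod_R, Rabs_pos_eq by lra. apply Rmult_le_compat_l; [lra|].
      apply Rle_trans with (1 := Cmod_minus_le _ _). rewrite Cmod_1.
      apply Rplus_le_compat_r. now apply HB. }
    split; auto. generalize (Cmod_le_minus 1 (- (t n * (q z - 1)))).
    rewrite Cmod_opp, Cmod_1.
    replace (1 - - (t n * (q z - 1)))%C with (1 + t n * (q z - 1))%C by ring. lra. }
  assert (Hv : forall n z, Cmod z <= r ->
     (1 - (1 - t n)%R * kap * f z)%C = (psi z * (1 + t n * (q z - 1)))%C).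
  { intros n z Hz. unfold q. rewrite RtoC_minus.
    assert (Hpz : psi z <> 0) by (apply Hnz; unfold ballC; lra).
    replace (psi z * (1 + t n * (/ psi z - 1)))%C with (psi z + t n * (1 - psi z))%C
      by (field; auto).
    unfold psi. ring. }
  assert (Hne : forall n z, Cmod z <= r -> (1 + t n * (q z - 1))%C <> 0).
  { intros n z Hz. apply Cmod_gt_0. destruct (Hq1 n z Hz). lra. }
  assert (Hdiff : forall n z, Cmod z <= r -> Cmod (Fn n (f z) - g z) <= K * t n).
  { intros n z Hz. destruct (Hq1 n z Hz) as [H1 H2]. specialize (HB z Hz).
    assert (Hpz : psi z <> 0) by (apply Hnz; unfold ballC; lra).
    unfold Fn, g, F. rewrite Hv by auto. fold (psi z). fold (q z).
    set (v := (/ (psi z * (1 + t n * (q z - 1))))%C).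
    assert (Ev : v = (q z * / (1 + t n * (q z - 1)))%C).
    { unfold v. unfold q at 2. field. split; auto. }
    assert (Hinv : Cmod (/ (1 + t n * (q z - 1))) <= 2).
    { rewrite Cmod_inv by auto. rewrite <- (Rinv_inv 2). apply Rinv_le_contravar; lra. }
    assert (Hvb : Cmod v <= 2 * B).
    { rewrite Ev, Cmod_mult, Rmult_comm. apply Rmult_le_compat; auto using Cmod_ge_0. }
    assert (Hvq : Cmod (v - q z) <= t n * (B + 1) * (2 * B)).
    { replace (v - q z)%C with (- (t n * (q z - 1) * v))%C.
      - rewrite Cmod_opp, Cmod_mult. apply Rmult_le_compat; auto using Cmod_ge_0.
      - rewrite Ev. field. auto. }
    apply Rle_trans with (1 := Cpow_diff_le v (q z) (2 * B) N Hvb ltac:(lra)).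
    unfold K. replace ((INR N + 1) * (2 * B) ^ N * ((B + 1) * (2 * B)) * t n) with
      ((INR N + 1) * (2 * B) ^ N * (t n * (B + 1) * (2 * B))) by ring.
    apply Rmult_le_compat_l; auto. apply Rmult_le_pos; [apply Rlt_le, INR_1_pos|apply pow_le; lra]. }
  (* The radius given by [hcd] depends on [n]; writing the function through [psi] and [q] makes it
     holomorphic on one ball for all [n]. *)
  assert (Hholo : forall n, holo (ballC r) (fun z => Fn n (f z) - g z)%C).
  { intros n. assert (Hpr : holo (ballC r) psi).
    { apply holo_subset with (2 := Hh). intros z. apply ballC_mono. lra. }
    assert (Hqr : holo (ballC r) q).
    { apply holo_subset with (2 := Hq). intros z. apply ballC_mono. lra. }
    apply holo_minus; [|now apply holo_pow].
    apply holo_ext_ball with (fun z => (/ (psi z * (1 + t n * (q z - 1)))) ^ S N)%C.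
    - intros z Hz. unfold Fn. rewrite Hv; auto. now apply Rlt_le.
    - apply holo_pow, holo_inv.
      + apply holo_mult; auto. apply holo_plus; [apply holo_const|].
        apply holo_mult; [apply holo_const|]. apply holo_minus; auto. apply holo_const.
      + intros z Hz. apply Cmult_neq_0.
        * apply Hnz. apply ballC_mono with (2 := Hz). lra.
        * apply Hne. now apply Rlt_le. }
  assert (Hr1 : 0 <= / r1 < 1).
  { split; [apply Rlt_le, Rinv_0_lt_compat; lra|]. rewrite <- Rinv_1.
    apply Rinv_lt_contravar; lra. }
  set (T := Series (fun k => ((/ r1) ^ k) ^ 2 * beta w k ^ 2)).
  assert (HT : 0 <= T).
  { apply Series_nonneg; [intros; apply Rmult_le_pos; apply pow2_ge_0|].
    now apply regular_summable. }
  assert (Hnorm : forall n, 0 <= H2_norm w (fun z => Fn n (f z) - g z)%C <= (K * sqrt T) * t n).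
  { intros n. destruct (Ht n) as [Ht0 _]. split; [apply sqrt_pos|].
    assert (Hd : hcd (fun z => Fn n (f z) - g z)%C) by now apply hcd_minus.
    rewrite (H2_norm_eq w _ _ (disk_series_hcd _ Hd)).
    assert (HKt : 0 <= K * t n) by (apply Rmult_le_pos; lra).
    assert (Hest : forall k, Cmod (tcoef (fun z => Fn n (f z) - g z)%C k) <= (K * t n) * (/ r1) ^ k).
    { apply (tcoef_Cauchy_estimate r r1); auto; [lra|].
      intros z Hz. apply Hdiff. lra. }
    destruct (l2_of_decay (beta w) _ (/ r1) (K * t n) Hb Hr1 Hest) as [_ Hs].
    apply Rle_trans with (1 := sqrt_le_1_alt _ _ Hs).
    rewrite sqrt_mult_alt by apply pow2_ge_0. rewrite sqrt_pow2 by auto.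
    right. fold T. ring. }
  destruct (Hcl (fun n z => Fn n (f z)) g) as [h [Hh2 Hhe]].
  - intros n. split; [now apply hcd_H2|]. exists (Fn n). split; [now apply hcd_H2|].
    intros z _. reflexivity.
  - now apply hcd_H2.
  - apply is_lim_seq_0_le with (1 := Hnorm). now apply is_lim_seq_0_scal.
  - apply H2_iff in Hh2. destruct Hh2 as [Hh1 Hh2].
    set (x := fun k => (RtoC (binser N k) * kap ^ k)%C).
    assert (HF : disk_series F x).
    { intros z Hz. unfold ballC in Hz.
      assert (Hkz1 : Cmod (kap * z) < 1) by (rewrite Cmod_mult, Hkap; lra).
      apply clim_ext with (2 := binser_pseries N (kap * z) Hkz1).
      intros n. apply csum_ext. intros k _. unfold x. rewrite Cpow_mult_l. ring. }
    (* A preimage [h] of [F o f] must be [F] itself, since composition with [f] is injective on the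
       disk; so [F] would belong to the space. *)
    assert (Heq : forall z, ballC 1 z -> h z = F z).
    { intros z Hz. apply Cminus_eq_0.
      rewrite (identity_composition f (fun z => h z - F z)%C); auto using Cmod_0.
      - apply holo_minus.
        + now apply pseries_holo with (coef h).
        + now apply pseries_holo with x.
      - intros y Hy. change (h (f y)) with (composition_operator f h y).
        rewrite Hhe by auto. unfold g. ring. }
    assert (Hx := disk_series_unique h F _ _ Heq Hh1 HF).
    assert (Hlx : l2 (beta w) x) by now apply l2_ext with (1 := Hx).
    apply ex_series_lim_0 in Hlx.
    set (c0 := beta w 0 / INR (fact N)).
    assert (Hfact : 0 < INR (fact N)) by (apply lt_0_INR, lt_O_fact).
    assert (Hc0 : 0 < c0) by (apply Rdiv_lt_0_compat; auto; apply Hb).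
    assert (Hlow : forall k, c0 <= binser N k * beta w k).
    { intros k. destruct (HN O k) as [H1 _]; [lia|]. simpl (INR 0) in H1.
      rewrite Rplus_0_l, pow1, Rmult_1_r in H1. unfold c0.
      apply Rmult_le_reg_r with (INR (fact N)); auto. unfold Rdiv.
      rewrite Rmult_assoc, Rinv_l, Rmult_1_r by lra.
      apply Rle_trans with (1 := H1).
      replace (binser N k * beta w k * INR (fact N)) with (beta w k * (INR (fact N) * binser N k)) by ring.
      apply Rmult_le_compat_l; [apply Rlt_le, Hb|apply binser_lower]. }
    (* The terms of the norm of [F] would tend to 0, yet each is at least [c0 ^ 2]. *)
    assert (Hcontra : c0 ^ 2 <= 0).
    { apply (is_lim_seq_le (fun _ => c0 ^ 2) (fun k => Cmod (x k) ^ 2 * beta w k ^ 2) (c0 ^ 2) 0).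
      - intros k. unfold x. rewrite Cmod_mult, Cmod_pow, Hkap, pow1, Rmult_1_r, Cmod_R.
        rewrite Rabs_pos_eq by apply binser_nonneg.
        rewrite <- Rpow_mult_distr. apply pow_incr. split; [lra|apply Hlow].
      - apply is_lim_seq_const.
      - exact Hlx. }
    assert (0 < c0 ^ 2) by now apply pow_lt. lra.
Qed.

Lemma Blaschke_product_unimodular (f : C -> C) : finite_Blaschke_product f ->
  forall z, Cmod z = 1 -> Cmod (f z) = 1.
Proof.
  intros [c [zs [Hc [Hzs H]]]] z Hz. rewrite H by (apply Req_le; auto).
  rewrite Cmod_mult, Hc, Rmult_1_l. clear H.
  induction Hzs as [|a zs Ha Hzs IH]; simpl; [apply Cmod_1|].
  rewrite Cmod_mult, IH, Rmult_1_r. now apply (bfactor_circle a z).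
Qed.

Theorem theorem4p4 (w : nat -> R) (phi : C -> C)
  (hw : weight_sequence w)
  (hgrowth : polynomial_growth w)
  (hphi_analytic : analytic_on_closed_disk phi)
  (hphi_maps : forall z, closed_disk z -> closed_disk (phi z))
  (hphi_nonconstant : nonconstant_on_closed_disk phi) :
  (semi_Fredholm w (composition_operator phi) <->
   closed_range w (composition_operator phi)) /\
  (closed_range w (composition_operator phi) <->
   (forall y, circle y -> image phi closed_disk y)) /\
  ((forall y, circle y -> image phi closed_disk y) <->
   (exists A, arc A /\ forall y, A y -> image phi circle y)) /\
  ((exists A, arc A /\ forall y, A y -> image phi circle y) <->
   finite_Blaschke_product phi).
Proof.
  assert (Hb := beta_regular w hw hgrowth).
  assert (Hf := hcd_of_analytic phi hphi_analytic).
  assert (Hd : forall z, Cmod z < 1 -> Cmod (phi z) < 1).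
  { apply self_map_disk; auto. intros z Hz. apply hphi_maps. unfold closed_disk. lra. }
  assert (H23 : closed_range w (composition_operator phi) ->
     forall y, circle y -> image phi closed_disk y)
    by now apply closed_range_covers_circle.
  assert (H34 : (forall y, circle y -> image phi closed_disk y) ->
     exists A, arc A /\ forall y, A y -> image phi circle y).
  { intros H. exists circle. split.
    - exists (- PI), PI. split; [generalize PI_RGT_0; lra|]. intros z. split.
      + intros Hz. destruct (circle_cis z Hz) as [t [Ht ->]]. now exists t.
      + intros [t [_ ->]]. apply Cmod_cis.
    - intros y Hy. destruct (H y Hy) as [z [[Hz|Hz] E]].
      + exfalso. specialize (Hd z Hz). rewrite E, Hy in Hd. lra.
      + exists z. now split. }
  assert (H45 : (exists A, arc A /\ forall y, A y -> image phi circle y) ->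
     finite_Blaschke_product phi).
  { intros [A [HA H]]. now apply (Blaschke_of_arc phi A). }
  assert (Hinner : finite_Blaschke_product phi -> inner phi).
  { intros H. split; [exact Hf|]. split; auto. now apply Blaschke_product_unimodular. }
  assert (H52 : finite_Blaschke_product phi -> closed_range w (composition_operator phi))
    by (intros H; apply inner_closed_range; auto).
  assert (H51 : finite_Blaschke_product phi -> semi_Fredholm w (composition_operator phi)).
  { intros H. split; [|split].
    - apply inner_bounded_operator; auto.
    - auto.
    - left. apply inner_kernel; auto. }
  (* The cycle (2), (3), (4), (5), (2) together with (5) to (1) gives everything except (1) to (2),
     which is read off the definition. *)
  split; [|split; [|split]]; split; auto.
  intros H. apply H.
Qed.
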